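(* For any nondecreasing function $g:\mathbb N\cup\{0\}\to[0,\infty)$ satisfying $\langle\mu,g^p\rangle<\infty$ for some $p>1$, we have $$\langle\mu_t,g\rangle\longrightarrow\langle\mu,g\rangle$$ in probability, as $t\to\infty$. Here $\mu_t$ is the empirical indegree distribution of the spatial preferential attachment graph $G_t$, and $\mu$ is the probability measure on $\mathbb N\cup\{0\}$ with weights $$\mu(k)=\frac{1}{1+f(k)}\prod_{l=0}^{k-1}\frac{f(l)}{1+f(l)},\qquad k\ge 0.$$
   Context: Parameters. The profile function $\varphi:[0,\infty)\to[0,1]$ is nonincreasing with $\int_0^\infty\varphi(x)\,\mathrm dx=\tfrac12$. The attachment rule $f:\mathbb N\cup\{0\}\to(0,\infty)$ is nondecreasing and has asymptotic slope $\gamma:=\lim_{k\to\infty}f(k)/k\in(0,1)$. Model. Let $\mathbb T_1=\mathbb R/\mathbb Z$ be the one-dimensional torus of length 1 with its usual distance $d$. Let $\mathcal X$ be a Poisson point process of unit intensity on $\mathbb T_1\times(0,\infty)$. A point $\mathbf x=(x,s)\in\mathcal X$ is a vertex born at time $s$ and placed at position $x$; $d(\mathbf x,\mathbf y)$ denotes the distance in $\mathbb T_1$ between the positions of $\mathbf x$ and $\mathbf y$. A vertex $(x,s)$ is older than $(y,t)$ if $s<t$. For $t>0$ put $\mathcal X_t=\mathcal X\cap(\mathbb T_1\times(0,t])$. A growing family of graphs $(G_t)_{t>0}$, where $G_t$ has vertex set $\mathcal X_t$ and edges are oriented from the younger to the older vertex, is built starting from the empty graph as follows: given $G_{t-}$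 and $\mathbf y=(y,t)\in\mathcal X$, add the vertex $\mathbf y$ and, independently for each vertex $\mathbf x$ of $G_{t-}$ (and independently of $\mathcal X$), insert the edge $(\mathbf y,\mathbf x)$ with probability $$\varphi\left(\frac{t\,d(\mathbf x,\mathbf y)}{f(Z_{\mathbf x}(t-))}\right),$$ where $Z_{\mathbf x}(t-)$ (resp. $Z_{\mathbf x}(t)$) is the indegree of $\mathbf x$ (number of incoming edges) in $G_{t-}$ (resp. $G_t$). Notation. The empirical indegree distribution is the random probability measure $\mu_t$ on $\mathbb N\cup\{0\}$ given by $\mu_t(k)=\frac1{|\mathcal X_t|}\sum_{\mathbf x\in\mathcal X_t}\mathbf 1\{Z_{\mathbf x}(t)=k\}$ if $\mathcal X_t\ne\varnothing$, and $\mu_t(k)=\mathbf 1\{k=0\}$ otherwise. For a measure $\lambda$ on $\mathbb N\cup\{0\}$, $\langle\lambda,g\rangle=\sum_{k\ge0}\lambda(k)g(k)$. *)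

(* Defs.v *)
From HB Require Import structures.
From mathcomp Require Import all_boot all_order all_algebra.
From mathcomp Require Import finmap.
From mathcomp Require Import all_classical all_reals all_analysis.

Set Implicit Arguments.
Unset Strict Implicit.
Unset Printing Implicit Defensive.

Import Order.TTheory GRing.Theory Num.Theory.
Import numFieldNormedType.Exports.

Local Open Scope classical_set_scope.
Local Open Scope ring_scope.
Local Open Scope card_scope.

Section poisson_process.
Context d (Omega : measurableType d) (R : realType) (P : probability Omega R).
Context d' (T : measurableType d').

(* A random set X is a (simple) Poisson point process with intensity measure
   Lam when the numbers of its points in finitely many pairwise disjoint sets
   of finite intensity are independent Poisson variables.  Sets of infinite
   intensity need no clause of their own when Lam is sigma-finite.
   [poisson_pmf] is the constant 1 at rate 0, so the pmf is read off
   [poisson_prob], which is the Dirac mass at 0 for rate 0 (its nat argument is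
   a dummy). *)
Definition is_poisson_process (X : Omega -> set T) (Lam : set T -> \bar R) :=
  [/\ forall (B : set T) (k : nat), measurable B ->
        measurable [set w | X w `&` B #= `I_k]
    & forall (n : nat) (B : 'I_n -> set T) (k : 'I_n -> nat),
        (forall i, measurable (B i)) -> (forall i, (Lam (B i) < +oo)%E) ->
        trivIset [set: 'I_n] B ->
        P [set w | forall i, X w `&` B i #= `I_(k i)] =
        (\prod_(i < n) poisson_prob (fine (Lam (B i))) 0%N [set k i])%E].

End poisson_process.

Section convergence_in_probability.
Context d (Omega : measurableType d) (R : realType) (P : probability Omega R).

Definition cvg_in_probability (X : R -> Omega -> \bar R) (l : \bar R) :=
  forall eps : R, 0 < eps ->
    P [set w | (eps%:E < `| X t w - l |)%E] @[t --> +oo] --> 0%E.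

End convergence_in_probability.

Section torus.
Context (R : realType).

(* The torus R/Z is represented by the fundamental domain [0, 1[. *)
Definition torus_dist (x y : R) : R := Num.min `|x - y| (1 - `|x - y|).

Definition torus_time_intensity (B : set (R * R)) : \bar R :=
  (lebesgue_measure \x lebesgue_measure)%E
    (B `&` (`[0, 1[%classic `*` `]0, +oo[%classic)).

End torus.

Section spatial_preferential_attachment.
Context d (Omega : measurableType d) (R : realType) (P : probability Omega R).
Context (phi : R -> R) (f : nat -> R).
(* [V n w] is the (n+1)-st vertex in order of birth, as a pair (position, birth
   time), so the point process is the range of [V ^~ w]; [E n m w], which is
   only relevant for m < n, tells whether the edge from vertex n to the older
   vertex m is present. *)
Context (V : nat -> Omega -> R * R) (E : nat -> nat -> Omega -> bool).

Definition vertices_at (t : R) (w : Omega) : set nat :=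
  [set n | (V n w).2 <= t].

(* [fset_set] is the empty set on an infinite set, which only concerns a null
   event below. *)
Definition indegree (m : nat) (t : R) (w : Omega) : nat :=
  #|` fset_set [set i | [/\ (m < i)%N, (V i w).2 <= t & E i m w]] |.

Definition indegree_before (m : nat) (t : R) (w : Omega) : nat :=
  #|` fset_set [set i | [/\ (m < i)%N, (V i w).2 < t & E i m w]] |.

Definition edge_prob (n m : nat) (w : Omega) : R :=
  let t := (V n w).2 in
  phi (t * torus_dist (V n w).1 (V m w).1 / f (indegree_before m t w)).

(* The sigma-algebra generated by the whole point process and by the edges
   between the n oldest vertices. *)
Definition history (n : nat) : set (set Omega) :=
  <<s [set A | (exists k (B : set (R * R)), measurable B /\ A = V k @^-1` B) \/
               (exists i j, (j < i < n)%N /\ A = [set w | E i j w])] >>.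

(* The last field says that, conditionally on [history n], the indicators of
   the edges from vertex n to the vertices m < n are independent Bernoulli
   variables with parameters [edge_prob n m]. *)
Record is_spatial_pa : Prop := IsSpatialPA {
  spa_vertex_measurable : forall n, measurable_fun [set: Omega] (V n) ;
  spa_vertex_domain : forall n w, 0 <= (V n w).1 < 1 /\ 0 < (V n w).2 ;
  spa_edge_measurable : forall n m, (m < n)%N -> measurable [set w | E n m w] ;
  spa_birth_order : {ae P, forall w, forall n, (V n w).2 < (V n.+1 w).2} ;
  spa_poisson : is_poisson_process P (fun w => range (V ^~ w))
                                   (@torus_time_intensity R) ;
  spa_attachment : forall n (A : set Omega) (b : 'I_n -> bool),
    history n A ->
    P (A `&` [set w | forall m : 'I_n, E n m w = b m]) =
    (\int[P]_(w in A)
       (\prod_(m < n) (if b m then edge_prob n m w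
                       else 1 - edge_prob n m w))%:E)%E
}.

Definition empirical_indegree (t : R) (w : Omega) (k : nat) : R :=
  if vertices_at t w == set0 then (k == 0%N)%:R
  else #|` fset_set (vertices_at t w) |%:R^-1 *
       \sum_(n \in vertices_at t w) ((indegree n t w == k)%:R : R).

End spatial_preferential_attachment.

Section indegree_distribution.
Context (R : realType).

Definition limit_indegree (f : nat -> R) (k : nat) : R :=
  1 / (1 + f k) * \prod_(l < k) (f l / (1 + f l)).

Definition pairing (lam g : nat -> R) : \bar R :=
  (\sum_(k <oo) (lam k * g k)%:E)%E.

End indegree_distribution.

(* Main.v *)
Require Import Defs.
From HB Require Import structures.
From mathcomp Require Import all_boot all_order all_algebra.
From mathcomp Require Import finmap.
From mathcomp Require Import all_classical all_reals all_analysis.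
From mathcomp Require Import measurable_realfun.
From mathcomp Require Import ring lra zify.

(** The theorem is a law of large numbers for degrees, proved vertex by vertex in
    the order of birth.

    Let S_k(n) be the number of vertices of indegree at least k among the n oldest
    ones, when only these are present ([tail_count]). When vertex n arrives, at a
    time T_n close to n, its position is uniform and independent of the graph built
    so far ([past_uniform]). Averaging the profile over a uniform position, an older
    vertex of degree k receives an edge with a probability that depends on k and
    T_n only ([Ex_edge]); it is close to f(k) / n because the profile has integral
    1/2. So S_(k+1) grows on average by f(k) * (S_k - S_(k+1)) / n. The linear
    solutions S_k = s_k * n of this evolution satisfy f(k) * (s_k - s_(k+1)) = s_(k+1),
    hence s_k is the product of f(l) / (1 + f(l)) over l < k, which is the tail of the
    limit law ([limit_tail_balance], [limit_indegreeE]).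

    Concentration is by second moments. The geometry couples the edges out of a
    vertex through its position, but for two older vertices the distances to it
    are independent ([uniform_pair]), so the number of vertices whose degree passes
    from k to k+1 at step n has a bounded second moment ([Ex_new_edges_sqr]). The mean
    square of S_k(n) - s_k * n therefore obeys a recursion ([Ex_square_step]) whose
    solution is o(n^2), by induction on k ([mean_square_vanishing]).

    For an unbounded g, summation by parts writes the sum of g over the degrees as a
    combination of the S_k with coefficients g(k) - g(k-1) >= 0. Truncating it needs
    a bound on the mean of S_k(n) by a multiple of s_k * n, uniform in k and n
    ([Ex_tail_count_le]); it follows from a recursion in which the relative errors of
    T_n against n, divided by n, have to be summable ([tail_recursion]). With it, the
    part k > K is bounded by a multiple of the remainder of the convergent series of
    the limit mean ([mean_abs_vanishing]).

    These expectations are taken on the event that T_i is within a factor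
    1 + O(i^(-1/4)) of i for all i from N to n. By Chebyshev's inequality along the
    sequence x^4, this event has probability close to 1 uniformly in n, if N is large
    ([probability_controlled]). On it, the number of vertices at time t lies between
    two deterministic indices equivalent to t, and monotonicity in n of the sum of
    g over the degrees transfers the convergence from indices to times
    ([degree_sum_sandwich], [deviation_event]). *)

Set Implicit Arguments.
Unset Strict Implicit.
Unset Printing Implicit Defensive.
Import Order.TTheory GRing.Theory Num.Theory.
Import numFieldNormedType.Exports.
Local Open Scope classical_set_scope.
Local Open Scope ring_scope.
Local Open Scope card_scope.

(** * Measurability, and reordering the vertices *)

Section random_sets.
Context d (Omega : measurableType d).

(** There are countably many finite sets, and [fset_set] sends the measurable event
    that the random set is infinite to the empty set. *)
Lemma measurable_fset_set (S : Omega -> set nat) (Q : set {fset nat}) :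
  (forall i, measurable [set w | S w i]) ->
  measurable [set w | Q (fset_set (S w))].
Proof.
move=> mS.
have mK (K : {fset nat}) : measurable [set w | S w = [set` K]].
  rewrite (_ : [set w | _] = \bigcap_i (if i \in K then [set w | S w i]
                                        else ~` [set w | S w i])).
    apply: bigcapT_measurable => i; case: ifP => _ //; exact: measurableC.
  apply/seteqP; split=> w /=.
    by move=> SK i _; case: ifPn => iK; rewrite /setC /= SK//=; exact/negP.
  move=> h; apply/seteqP; split=> i /=.
    by move=> Si; have := h i I; case: ifP => //.
  by move=> iK; have := h i I; rewrite iK.
have mfin : measurable [set w | finite_set (S w)].
  rewrite (_ : [set w | _] = \bigcup_K [set w | S w = [set` (K : {fset nat})]]).
    by apply: countable_bigcupT_measurable => //; exact: countableP.
  apply/seteqP; split=> w /=.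
    by move=> fS; exists (fset_set (S w)) => //=; rewrite fset_setK.
  by case=> K _ /= ->; exact: finite_fset.
rewrite (_ : [set w | _] =
    \bigcup_K ([set w | S w = [set` (K : {fset nat})]] `&` [set w | Q K]) `|`
    (~` [set w | finite_set (S w)] `&` [set w | Q fset0])).
  apply: measurableU.
    apply: countable_bigcupT_measurable => [|K]; first exact: countableP.
    apply: measurableI => //.
    by have [QK|QK] := pselect (Q K); [rewrite (_ : [set _ | _] = setT)|
      rewrite (_ : [set _ | _] = set0)] => //; apply/seteqP; split.
  apply: measurableI; first exact: measurableC.
  by have [QK|QK] := pselect (Q fset0); [rewrite (_ : [set _ | _] = setT)|
      rewrite (_ : [set _ | _] = set0)] => //; apply/seteqP; split.
have unfin w : ~ finite_set (S w) -> fset_set (S w) = fset0.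
  by rewrite /fset_set => nf; case: pselect.
apply/seteqP; split=> w /=.
  move=> Qw; have [fS|nS] := pselect (finite_set (S w)).
    by left; exists (fset_set (S w)) => //=; rewrite fset_setK.
  by right; split => //; rewrite -(unfin w).
case=> [[K _ /= [-> QK]]|[nS Q0]]; first by rewrite set_fsetK.
by rewrite unfin.
Qed.

Lemma measurable_fset_set_fun d' (T : measurableType d') (S : Omega -> set nat)
    (F : {fset nat} -> Omega -> T) :
  (forall i, measurable [set w | S w i]) ->
  (forall K, measurable_fun setT (F K)) ->
  measurable_fun setT (fun w => F (fset_set (S w)) w).
Proof.
move=> mS mF _ B mB; rewrite setTI.
rewrite (_ : _ @^-1` B = \bigcup_K ([set w | fset_set (S w) = K] `&` (F K @^-1` B))).
  apply: countable_bigcupT_measurable => [|K]; first exact: countableP.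
  apply: measurableI.
    exact: (@measurable_fset_set S [set K]).
  by rewrite -[X in measurable X]setTI; exact: mF.
apply/seteqP; split=> w /=; last by case=> K _ [/= ->].
by move=> BF; exists (fset_set (S w)).
Qed.

End random_sets.

Lemma measurable_ltr_set d (T : measurableType d) (R : realType) (a b : T -> R) :
  measurable_fun setT a -> measurable_fun setT b ->
  measurable [set w | a w < b w].
Proof.
move=> ma mb; rewrite (_ : [set w | _] = (fun w => a w < b w) @^-1` [set true]).
  by rewrite -[X in measurable X]setTI; exact: measurable_fun_ltr.
by apply/seteqP; split=> w /=.
Qed.

Lemma measurable_ler_set d (T : measurableType d) (R : realType) (a b : T -> R) :
  measurable_fun setT a -> measurable_fun setT b ->
  measurable [set w | a w <= b w].
Proof.
move=> ma mb; rewrite (_ : [set w | _] = (fun w => a w <= b w) @^-1` [set true]).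
  by rewrite -[X in measurable X]setTI; exact: measurable_fun_ler.
by apply/seteqP; split=> w /=.
Qed.

Lemma measurable_fun_of_set d (T : measurableType d) (b : T -> bool) :
  measurable [set w | b w] -> measurable_fun setT b.
Proof.
move=> mb; apply: (measurable_fun_bool true); rewrite setTI.
by rewrite (_ : _ @^-1` _ = [set w | b w])//; apply/seteqP; split.
Qed.

(** The indegree of vertex m once the n oldest vertices are present; it is read
    off the edges alone, whatever the birth times are. *)
Definition degree (Omega : Type) (E : nat -> nat -> Omega -> bool)
  (m n : nat) (w : Omega) : nat := \sum_(m.+1 <= i < n) E i m w.

Lemma card_fset_degree (Omega : Type) (E : nat -> nat -> Omega -> bool) m n w
    (S : set nat) : (forall i, S i <-> [/\ (m < i)%N, (i < n)%N & E i m w]) ->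
  #|` fset_set S |%fset = degree E m n w.
Proof.
move=> SE.
have fS : finite_set S.
  by apply: (@sub_finite_set _ _ `I_n) => // i /SE[].
rewrite card_fset_sum1 /degree -[RHS]big_mkcond/=.
rewrite -[RHS]big_filter; apply: perm_big.
apply: uniq_perm; [exact: fset_uniq|by rewrite filter_uniq ?iota_uniq|move=> i].
rewrite in_fset_set// mem_filter mem_index_iota; apply/idP/idP.
  by rewrite inE => /SE[-> -> ->].
by case/andP=> Ei /andP[mi lin]; rewrite inE; apply/SE.
Qed.

(** A monotone function is Borel, but [phi] is monotone on the half-line only;
    composing it with the positive part makes it monotone on the whole line. *)
Lemma measurable_nonincreasing_comp d (T : measurableType d) (R : realType)
    (phi : R -> R) (h : T -> R) :
  (forall x y, 0 <= x -> x <= y -> phi y <= phi x) ->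
  measurable_fun setT h -> (forall w, 0 <= h w) ->
  measurable_fun setT (fun w => phi (h w)).
Proof.
move=> phi_ni mh h0.
rewrite (_ : (fun w => _) = (fun x => phi (Num.max 0 x)) \o h); last first.
  by apply/funext => w /=; rewrite max_r.
apply: measurableT_comp => //; apply: nonincreasing_measurable => // x y xy.
apply: phi_ni; first by rewrite le_max lexx.
by rewrite ge_max !le_max lexx xy orbT.
Qed.

Section torus_distance.
Context (R : realType).
Implicit Types x y : R.

Lemma torus_dist_ge0 x y : 0 <= x < 1 -> 0 <= y < 1 -> 0 <= torus_dist x y.
Proof.
move=> /andP[x0 x1] /andP[y0 y1]; rewrite /torus_dist le_min normr_ge0/=.
by rewrite subr_ge0 ler_norml; apply/andP; split; lra.
Qed.

Lemma measurable_torus_dist d (T : measurableType d) (a b : T -> R) :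
  measurable_fun setT a -> measurable_fun setT b ->
  measurable_fun setT (fun w => torus_dist (a w) (b w)).
Proof.
move=> ma mb; rewrite /torus_dist.
have mab : measurable_fun setT (fun w => `|a w - b w|).
  by apply: measurableT_comp => //; exact: measurable_funB.
by apply: measurable_minr => //; exact: measurable_funB.
Qed.

End torus_distance.

Section regularisation.
Context d (Omega : measurableType d) (R : realType) (P : probability Omega R).
Context (phi : R -> R) (f : nat -> R).
Hypothesis phi_range : forall x : R, 0 <= x -> 0 <= phi x <= 1.
Hypothesis phi_nonincreasing : forall x y : R, 0 <= x -> x <= y -> phi y <= phi x.
Hypothesis f_gt0 : forall k, 0 < f k.

Section edge_probabilities.
Context (V : nat -> Omega -> R * R) (E : nat -> nat -> Omega -> bool).
Hypothesis mV : forall n, measurable_fun setT (V n).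
Hypothesis V_domain : forall n w, 0 <= (V n w).1 < 1 /\ 0 < (V n w).2.
Hypothesis mE : forall n m, (m < n)%N -> measurable [set w | E n m w].

Lemma measurable_position n : measurable_fun setT (fun w => (V n w).1).
Proof. exact: measurableT_comp. Qed.

Lemma measurable_birth n : measurable_fun setT (fun w => (V n w).2).
Proof. exact: measurableT_comp. Qed.

Lemma edge_arg_ge0 n m w k :
  0 <= (V n w).2 * torus_dist (V n w).1 (V m w).1 / f k.
Proof.
have [x01 t0] := V_domain n w; have [y01 _] := V_domain m w.
by rewrite divr_ge0 ?mulr_ge0 ?torus_dist_ge0 // ltW.
Qed.

Lemma edge_prob_ge0_le1 n m w : 0 <= edge_prob phi f V E n m w <= 1.
Proof. exact/phi_range/edge_arg_ge0. Qed.

Lemma edge_weight_ge0_le1 n m w (b : bool) :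
  0 <= (if b then edge_prob phi f V E n m w
        else 1 - edge_prob phi f V E n m w) <= 1.
Proof.
have /andP[? ?] := edge_prob_ge0_le1 n m w.
by case: b; apply/andP; split; lra.
Qed.

Lemma measurable_edge_prob n m : measurable_fun setT (edge_prob phi f V E n m).
Proof.
pose S w := [set i | [/\ (m < i)%N, (V i w).2 < (V n w).2 & E i m w]].
apply: (@measurable_fset_set_fun _ _ _ _ S (fun K w =>
  phi ((V n w).2 * torus_dist (V n w).1 (V m w).1 / f #|` K|%fset))).
  move=> i; have [mi|mi] := ltnP m i; last first.
    rewrite (_ : [set w | _] = set0)//; apply/seteqP; split=> w //= -[].
    by rewrite ltnNge mi.
  rewrite (_ : [set w | _] = [set w | (V i w).2 < (V n w).2] `&` [set w | E i m w]).
    by apply: measurableI; [apply: measurable_ltr_set; exact: measurable_birth|exact: mE].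
  by apply/seteqP; split=> w //= -[].
move=> K; apply: measurable_nonincreasing_comp => //; last first.
  by move=> w; exact: edge_arg_ge0.
apply: measurable_funM => //; apply: measurable_funM; first exact: measurable_birth.
by apply: measurable_torus_dist; exact: measurable_position.
Qed.

Lemma measurable_edge_weight n (b : 'I_n -> bool) :
  measurable_fun setT (fun w => \prod_(m < n)
    (if b m then edge_prob phi f V E n m w else 1 - edge_prob phi f V E n m w)).
Proof.
apply: measurable_prod => m _; case: (b m); first exact: measurable_edge_prob.
by apply: measurable_funB => //; exact: measurable_edge_prob.
Qed.

End edge_probabilities.

Context (V : nat -> Omega -> R * R) (E : nat -> nat -> Omega -> bool).

Definition well_ordered : set Omega :=
  [set w | forall n, (V n w).2 < (V n.+1 w).2].

(** Off a null event the births are in increasing order. Replacing the process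
    there by a fixed increasing one gives births in increasing order everywhere,
    which spares all later arguments this exception. *)
Definition reorder (n : nat) (w : Omega) : R * R :=
  if `[< well_ordered w >] then V n w else (0, n.+1%:R).

Lemma reorder_id w n : well_ordered w -> reorder n w = V n w.
Proof. by move=> h; rewrite /reorder asboolT. Qed.

Lemma reorder_default w n : ~ well_ordered w -> reorder n w = (0, n.+1%:R).
Proof. by move=> h; rewrite /reorder asboolF. Qed.

Lemma reorder_birth_lt n w : (reorder n w).2 < (reorder n.+1 w).2.
Proof.
have [h|h] := pselect (well_ordered w); first by rewrite !reorder_id//; exact: h.
by rewrite !reorder_default//= ltr_nat.
Qed.

Lemma measurable_well_ordered d' (T : measurableType d') (U : nat -> T -> R * R) :
  (forall n, measurable_fun setT (U n)) ->
  measurable [set w | forall n, (U n w).2 < (U n.+1 w).2].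
Proof.
move=> mU; rewrite (_ : [set w | _] = \bigcap_n [set w | (U n w).2 < (U n.+1 w).2]).
  apply: bigcapT_measurable => n.
  by apply: measurable_ltr_set; exact: (measurableT_comp measurable_snd (mU _)).
by apply/seteqP; split=> w /= h n; [move=> _; exact: h|exact: h].
Qed.

Let gen n := [set A : set Omega |
  (exists k (B : set (R * R)), measurable B /\ A = V k @^-1` B) \/
  (exists i j, (j < i < n)%N /\ A = [set w | E i j w])].

Lemma measurable_reorder_history n k :
  measurable_fun (setT : set (g_sigma_algebraType (gen n))) (reorder k).
Proof.
have mV j : measurable_fun (setT : set (g_sigma_algebraType (gen n))) (V j).
  move=> _ B mB; rewrite setTI; apply: sub_sigma_algebra; left.
  by exists j, B.
apply: measurable_fun_ifT => //; apply: measurable_fun_of_set.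
rewrite (_ : [set w | _] = well_ordered); first exact: measurable_well_ordered.
by apply/seteqP; split=> w /= /asboolP.
Qed.

Lemma reorder_history n A : history reorder E n A -> history V E n A.
Proof.
apply: smallest_sub; first exact: smallest_sigma_algebra.
move=> B [[k [C [mC ->]]]|[i [j [jin ->]]]]; last first.
  by apply: sub_sigma_algebra; right; exists i, j.
have := @measurable_reorder_history n k measurableT C mC.
by rewrite setTI.
Qed.

Hypothesis model : is_spatial_pa P phi f V E.

Let mV := spa_vertex_measurable model.

Let mgood : measurable well_ordered.
Proof. exact: measurable_well_ordered mV. Qed.

Lemma well_ordered_as : P (~` well_ordered) = 0%E.
Proof.
apply: measure_negligible; first exact: measurableC.
exact: spa_birth_order model.
Qed.

Lemma measurable_reorder k : measurable_fun setT (reorder k).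
Proof.
apply: measurable_fun_ifT => //; apply: measurable_fun_of_set.
by rewrite (_ : [set w | _] = well_ordered)//; apply/seteqP; split=> w /= /asboolP.
Qed.

(** Used to transport the Poisson law and the conditional law of the edges from
    [V] to [reorder]. *)
Lemma eq_probability_well_ordered A B : measurable A -> measurable B ->
  (forall w, well_ordered w -> A w <-> B w) -> P A = P B.
Proof.
have PI C : measurable C -> P C = P (C `&` well_ordered).
  move=> mC; rewrite [LHS](measureDI P mC mgood)// [X in (X + _)%E](_ : _ = 0%E) ?add0e//.
  apply/eqP; rewrite eq_le measure_ge0 andbT -well_ordered_as.
  apply: le_measure; rewrite ?inE; [exact: measurableD|exact: measurableC|].
  by move=> w [].
move=> mA mB AB; rewrite PI// (PI B)//; congr (P _).
by apply/seteqP; split=> w [? gw]; split => //; apply/AB.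
Qed.

Lemma reorder_range w : well_ordered w -> range (reorder ^~ w) = range (V ^~ w).
Proof. by move=> gw; apply: eq_imagel => n _; exact: reorder_id. Qed.

(** The default process has birth times n+1 and positions 0, so it satisfies the
    pointwise requirements; the distributional ones do not see a null event. *)
Lemma reorder_spatial_pa : is_spatial_pa P phi f reorder E.
Proof.
have mE := spa_edge_measurable model.
have dom n w : 0 <= (reorder n w).1 < 1 /\ 0 < (reorder n w).2.
  have [gw|gw] := pselect (well_ordered w).
    by rewrite reorder_id//; exact: spa_vertex_domain model n w.
  by rewrite reorder_default//= lexx ltr01 ltr0n.
have [mN PN] := spa_poisson model.
have mN' (B : set (R * R)) k : measurable B ->
    measurable [set w | range (reorder ^~ w) `&` B #= `I_k].
  move=> mB.
  rewrite (_ : [set w | _] = (well_ordered `&` [set w | range (V ^~ w) `&` B #= `I_k])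
      `|` (~` well_ordered `&` [set w |
        range (fun n => (0 : R, n.+1%:R : R)) `&` B #= `I_k])).
    apply: measurableU; apply: measurableI => //; [exact: mN|exact: measurableC|].
    have [h|h] := boolP (range (fun n => (0 : R, n.+1%:R : R)) `&` B #= `I_k).
      by rewrite (_ : [set _ | _] = setT)//; apply/seteqP; split.
    by rewrite (_ : [set _ | _] = set0)//; apply/seteqP; split=> // w /=; exact/negP.
  have rd w : ~ well_ordered w ->
      range (reorder ^~ w) = range (fun n => (0 : R, n.+1%:R : R)).
    by move=> gw; apply: eq_imagel => n _; exact: reorder_default.
  apply/seteqP; split=> w /=.
    have [gw|gw] := pselect (well_ordered w); first by rewrite reorder_range//; left.
    by rewrite rd//; right.
  by case=> -[gw]; [rewrite reorder_range|rewrite rd].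
split=> //.
- exact: measurable_reorder.
- by apply: aeW => w n; exact: reorder_birth_lt.
- split; first exact: mN'.
  move=> n B k mB Bfin tB; rewrite -(PN n B k mB Bfin tB).
  have mI (X : Omega -> set (R * R)) :
      (forall C j, measurable C -> measurable [set w | X w `&` C #= `I_j]) ->
      measurable [set w | forall i, X w `&` B i #= `I_(k i)].
    move=> mX; rewrite (_ : [set w | _] =
      \bigcap_(i in [set: 'I_n]) [set w | X w `&` B i #= `I_(k i)]).
      by apply: fin_bigcap_measurable => // i _; exact: mX.
    by apply/seteqP; split=> w /= h i; [move=> _; exact: h|exact: h].
  apply: eq_probability_well_ordered; [exact: mI|exact: mI|].
  by move=> w gw /=; split=> h i; have := h i; rewrite reorder_range.
- move=> n A b /reorder_history HA.
  rewrite (spa_attachment model b HA).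
  have mA : measurable A.
    apply: smallest_sub HA; first exact: sigma_algebra_measurable.
    move=> B [[k [C [mC ->]]]|[i [j [jin ->]]]].
      by rewrite -[X in measurable X]setTI; exact: mV.
    by apply: mE; case/andP: jin.
  have mw (U : nat -> Omega -> R * R) : (forall n, measurable_fun setT (U n)) ->
      (forall n w, 0 <= (U n w).1 < 1 /\ 0 < (U n w).2) ->
      measurable_fun A (fun w => (\prod_(m < n)
       (if b m then edge_prob phi f U E n m w
                       else 1 - edge_prob phi f U E n m w))%:E).
    move=> mU domU; apply: measurable_funTS; apply/measurable_EFinP.
    exact: measurable_edge_weight.
  have w0 (U : nat -> Omega -> R * R) w : (forall n w, 0 <= (U n w).1 < 1 /\ 0 < (U n w).2) -> A w ->
      (0 <= (\prod_(m < n) (if b m then edge_prob phi f U E n m w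
                       else 1 - edge_prob phi f U E n m w))%:E)%E.
    move=> domU _; rewrite lee_fin; apply: prodr_ge0 => m _.
    by have /andP[] := edge_weight_ge0_le1 E domU n m w (b m).
  apply: ge0_ae_eq_integral => //.
  + by apply: mw => //; exact: spa_vertex_domain model.
  + by apply: mw => //; exact: measurable_reorder.
  + by move=> w Aw; apply: w0 => //; exact: spa_vertex_domain model.
  + by move=> w Aw; apply: w0.
  exists (~` well_ordered); split; [exact: measurableC|exact: well_ordered_as|].
  move=> w /= /not_implyP[_ neq] gw; apply: neq; congr EFin.
  apply: eq_bigr => m _; suff -> : edge_prob phi f V E n m w =
     edge_prob phi f reorder E n m w by [].
  rewrite /edge_prob !reorder_id//; congr (phi (_ / f _)).
  by rewrite /indegree_before; congr (#|` fset_set _|%fset);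
     apply/seteqP; split=> i /=; rewrite reorder_id.
Qed.

End regularisation.

(** * Uniform positions of the points of a Poisson process *)

Lemma card_eq1E (T : choiceType) (A : set T) :
  A #= `I_1 -> exists x, A = [set x].
Proof.
move=> A1; have fA : finite_set A by apply/finite_setP; exists 1%N.
have /eqP/cardfs1P[x xE] := card_fset_set A1; exists x.
by rewrite -(fset_setK fA) xE; apply/seteqP; split=> y /=; rewrite inE => /eqP.
Qed.

Section strip_counts.
Context (R : realType) (v : nat -> R * R) (s : nat -> R).
Context (B : nat -> set (R * R)) (n : nat).
Hypothesis v_gt0 : forall i, 0 < (v i).2.
Hypothesis v_lt : forall i, (v i).2 < (v i.+1).2.
Hypothesis s0 : s 0%N = 0.
Hypothesis s_le : forall i, s i <= s i.+1.

(** The time strips between consecutive thresholds s i, each cut in two by a set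
    of marks. A configuration puts its first n+1 points in the successive strips,
    in prescribed sets, exactly when the cells contain 1 or 0 points as told by
    [cell_count]: an event about the ordered points becomes an event about counts,
    to which the definition of a Poisson process applies. *)
Definition strip (i : nat) : set (R * R) := setT `*` `]s i, s i.+1]%classic.

Definition cell (ib : 'I_n.+2 * bool) : set (R * R) :=
  if ib.2 then strip ib.1 `&` B ib.1 else strip ib.1 `\` B ib.1.

Definition cell_count (ib : 'I_n.+2 * bool) : nat := (ib.2 && (ib.1 <= n))%N.

Let v_mono : {mono (fun i => (v i).2) : i j / (i <= j)%N >-> i <= j}.
Proof. exact/Order.NatMonotonyTheory.incnP. Qed.

Let v_mono_lt : {mono (fun i => (v i).2) : i j / (i < j)%N >-> i < j}.
Proof. exact: leW_mono. Qed.

Let s_homo : {homo s : i j / (i <= j)%N >-> i <= j}.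
Proof. exact/Order.NatMonotonyTheory.nondecnP. Qed.

Let stripE i x : strip i x <-> s i < x.2 <= s i.+1.
Proof. by rewrite /strip/= in_itv/=; split=> [[]|]. Qed.

(** The strip of index n+1 is required to be empty, so that the threshold s n.+2
    separates the (n+1)-st point from the next one without any reference to the
    infinite strip above. *)
Lemma strip_countsP :
  (forall ib, range v `&` cell ib #= `I_(cell_count ib)) <->
  (forall i, (i <= n)%N -> s i < (v i).2 <= s i.+1 /\ B i (v i)) /\
  s n.+2 < (v n.+1).2.
Proof.
split=> [cnt|[bnd lst] [i b]]; last first.
  have alone j (k : nat) : (k <= n)%N -> strip k (v j) -> j = k.
    move=> kn /stripE/andP[lo hi]; case: (ltngtP j k) => // jk.
      have [/andP[_ h] _] := bnd j (leq_trans (ltnW jk) kn).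
      by move: (lt_le_trans lo (le_trans h (s_homo jk))); rewrite ltxx.
    have [jn|nj] := leqP j n.
      have [/andP[h _] _] := bnd j jn.
      by move: (lt_le_trans h (le_trans hi (s_homo jk))); rewrite ltxx.
    have h : (v n.+1).2 <= (v j).2 by rewrite v_mono.
    have /s_homo h2 : (k.+1 <= n.+2)%N by rewrite ltnW.
    by move: (lt_le_trans lst (le_trans h (le_trans hi h2))); rewrite ltxx.
  have none j : ~ strip n.+1 (v j).
    move=> /stripE/andP[lo hi]; have [jn|nj] := leqP j n.
      have [/andP[_ h] _] := bnd j jn.
      by move: (lt_le_trans lo (le_trans h (@s_homo j.+1 n.+1 jn))); rewrite ltxx.
    have h : (v n.+1).2 <= (v j).2 by rewrite v_mono.
    by move: (lt_le_trans lst (le_trans h hi)); rewrite ltxx.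
  rewrite /cell /cell_count/=; have [iln|nli] := leqP i n; last first.
    have -> : i = ord_max by apply/val_inj/eqP; rewrite eqn_leq -ltnS ltn_ord.
    rewrite andbF (_ : _ `&` _ = set0); first by rewrite II0 card_eq00.
    apply/seteqP; split=> //= x [[j _ <-]] h.
    by apply: (none j); case: b h => -[].
  have [vi Bi] := bnd i iln.
  case: b => /=.
    rewrite (_ : _ `&` _ = [set v i]); first exact: card_set1.
    apply/seteqP; split=> x /=.
      by case=> -[j _ <-] [h _]; rewrite (alone j i).
    by move=> ->; split; [exists i|split => //; exact/stripE].
  rewrite (_ : _ `&` _ = set0); first by rewrite II0 card_eq00.
  apply/seteqP; split=> //= x [[j _ <-]] [h nB].
  by apply: nB; rewrite (alone j i).
have cellP (i : 'I_n.+2) b : range v `&` cell (i, b) #= `I_(cell_count (i, b)) by exact: cnt.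
have none j : ~ strip n.+1 (v j).
  move=> sj.
  have h b : range v `&` cell (ord_max, b) = set0.
    have := cellP ord_max b; rewrite /cell_count/= ltnn andbF II0 card_eq0.
    by move/eqP.
  have [Bj|nBj] := pselect (B n.+1 (v j)).
    suff : (range v `&` cell (ord_max, true)) (v j) by rewrite h.
    by split; [exists j|].
  suff : (range v `&` cell (ord_max, false)) (v j) by rewrite h.
  by split; [exists j|].
have single (i : nat) : (i <= n)%N -> exists j, [/\ strip i (v j), B i (v j) &
    forall a, strip i (v a) -> a = j].
  move=> iln; pose i' := @Ordinal n.+2 i (leq_trans iln (ltnW (leqnn _))).
  have h0 : range v `&` cell (i', false) = set0.
    by have := cellP i' false; rewrite /cell_count/= II0 card_eq0 => /eqP.
  have := cellP i' true; rewrite /cell_count/= iln => /card_eq1E[x xE].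
  have : (range v `&` cell (i', true)) x by rewrite xE.
  case=> -[j _ vj] [sj Bj]; exists j; rewrite vj; split=> // a sa.
  have [Ba|nBa] := pselect (B i (v a)).
    have : (range v `&` cell (i', true)) (v a) by split; [exists a|].
    by rewrite xE /= -vj => h; apply/eqP; rewrite eqn_leq -!v_mono h lexx.
  suff : (range v `&` cell (i', false)) (v a) by rewrite h0.
  by split; [exists a|].
have main i : (i <= n)%N -> strip i (v i) /\ B i (v i).
  elim/ltn_ind: i => i IH iln; have [j [sj Bj uj]] := single i iln.
  suff ij : i = j by rewrite {2 4}ij.
  have /andP[lo hi] := (stripE i (v j)).1 sj.
  apply/esym; case: (ltngtP j i) => // ji.
    have [/stripE/andP[_ h] _] := IH j ji (leq_trans (ltnW ji) iln).
    by move: (lt_le_trans lo (le_trans h (s_homo ji))); rewrite ltxx.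
  apply/esym/uj/stripE; rewrite (ltW (lt_le_trans _ hi)) ?v_mono_lt// andbT.
  rewrite ltNge; apply/negP; case: i iln IH sj Bj uj ji lo hi => [|i] iln IH sj Bj uj ji lo hi.
    by rewrite s0 leNgt v_gt0.
  move=> le; have [si Bi] := IH i (ltnSn _) (ltnW iln).
  have [k [_ _ uk]] := single i (ltnW iln).
  have e1 : i.+1 = k.
    apply: uk; apply/stripE; rewrite le andbT.
    by case/stripE/andP: si => h _; rewrite (lt_trans h).
  by have e2 := uk i si; lia.
split; first by move=> i /main[/stripE].
rewrite ltNge; apply/negP => le.
have [sn Bn] := main n (leqnn _); have [k [_ _ uk]] := single n (leqnn n).
have /stripE/andP[lo _] := sn.
have [le1|gt1] := leP (v n.+1).2 (s n.+1).
  have e1 : n.+1 = k by apply: uk; apply/stripE; rewrite le1 (lt_trans lo).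
  by have e2 := uk n sn; lia.
by apply: (none n.+1); apply/stripE; rewrite gt1.
Qed.

End strip_counts.

Section poisson_weights.
Context (R : realType).
Implicit Types r : R.

Lemma poisson_prob0 r : 0 <= r -> poisson_prob r 0%N [set 0%N] = (expR (- r))%:E.
Proof.
rewrite le_eqVlt => /predU1P[<-|r0].
  by rewrite /poisson_prob ltxx diracE mem_set// oppr0 expR0.
rewrite /poisson_prob r0 esum_set1 ?lee_fin ?poisson_pmf_ge0//.
by rewrite /poisson_pmf r0 expr0 fact0 invr1 !mul1r.
Qed.

Lemma poisson_prob1 r : 0 <= r ->
  poisson_prob r 0%N [set 1%N] = (r * expR (- r))%:E.
Proof.
rewrite le_eqVlt => /predU1P[<-|r0].
  by rewrite /poisson_prob ltxx diracE memNset// mul0r.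
rewrite /poisson_prob r0 esum_set1 ?lee_fin ?poisson_pmf_ge0//.
by rewrite /poisson_pmf r0 expr1 factS fact0 muln1 invr1 mulr1.
Qed.

End poisson_weights.

Section intensity.
Context (R : realType).

Let box : set (R * R) := `[0, 1[%classic `*` `]0, +oo[%classic.

Let mbox : measurable box.
Proof. by apply: measurableX; exact: measurable_itv. Qed.

(** The uniform law on the fundamental domain of the torus. *)
Definition torus_measure : set (measurableTypeR R) -> \bar R :=
  mrestr (@lebesgue_measure R) (measurable_itv `[0, 1[).

HB.instance Definition _ := Measure.on torus_measure.

Let torus_measureT : torus_measure setT = 1%E.
Proof.
rewrite /torus_measure /mrestr setTI lebesgue_measure_itv/= lte_fin ltr01.
by rewrite -EFinD subr0.
Qed.

HB.instance Definition _ := Measure_isProbability.Build _ _ _ torus_measure torus_measureT.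

Lemma torus_time_intensityE :
  @torus_time_intensity R = mrestr (lebesgue_measure \x lebesgue_measure)%E mbox.
Proof. by []. Qed.

Lemma torus_time_intensityX (I J : set R) (a b : R) : 0 <= a ->
  measurable I -> measurable J ->
  torus_time_intensity ((I `*` J) `&` (setT `*` `]a, b]%classic)) =
  (torus_measure I * lebesgue_measure (J `&` `]a, b]%classic))%E.
Proof.
move=> a0 mI mJ; rewrite /torus_time_intensity.
rewrite (_ : _ `&` _ = (I `&` `[0, 1[%classic) `*` (J `&` `]a, b]%classic)).
  rewrite product_measure1E//; first by apply: measurableI => //; exact: measurable_itv.
  by apply: measurableI => //; exact: measurable_itv.
apply/seteqP; split=> x /=; rewrite !in_itv/= !andbT.
  by case=> -[[Ix Jx] [_ h]] [h1 h2].
case=> -[Ix h1] [Jx h]; do !split => //.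
by case/andP: h => h _; exact: le_lt_trans h.
Qed.

Lemma torus_time_intensityT (a b : R) : 0 <= a -> a <= b ->
  torus_time_intensity (setT `*` `]a, b]%classic) = (b - a)%:E.
Proof.
move=> a0 ab; have := @torus_time_intensityX setT setT a b a0 measurableT measurableT.
rewrite setXTT setTI probability_setT mul1e setTI => ->.
by rewrite lebesgue_measure_itv/= lte_fin; case: ltgtP ab => // -> _; rewrite subrr.
Qed.

(** The two halves of a strip cut by [B] have finite masses that add up to its
    length; this is all that the product of Poisson weights needs. *)
Lemma torus_time_intensity_strip (B : set (R * R)) (a b : R) :
  0 <= a -> a <= b -> measurable B ->
  exists p q : R, [/\ 0 <= p, 0 <= q, p + q = b - a,
    torus_time_intensity ((setT `*` `]a, b]%classic) `&` B) = p%:E &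
    torus_time_intensity ((setT `*` `]a, b]%classic) `\` B) = q%:E].
Proof.
move=> a0 ab mB; set S := _ `*` _.
have mS : measurable S by apply: measurableX => //; exact: measurable_itv.
have := torus_time_intensityT a0 ab; rewrite -/S torus_time_intensityE.
set M := mrestr _ _ => hS.
have hx : M S = (M (S `\` B) + M (S `&` B))%E by exact: measureDI.
set q := M (S `\` B) in hx *; set p := M (S `&` B) in hx *.
have p0 : (0 <= p)%E by exact: measure_ge0.
have q0 : (0 <= q)%E by exact: measure_ge0.
have hpq := hx; rewrite hS in hpq.
clearbody p q; clear hx hS.
have pf : p \is a fin_num.
  rewrite ge0_fin_numE// (@le_lt_trans _ _ (b - a)%:E) ?ltry// hpq leeDr//.
have qf : q \is a fin_num.
  rewrite ge0_fin_numE// (@le_lt_trans _ _ (b - a)%:E) ?ltry// hpq leeDl//.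
exists (fine p), (fine q); rewrite !fineK//; split=> //; rewrite ?fine_ge0//.
by apply: EFin_inj; rewrite EFinD !fineK// addeC -hpq.
Qed.

End intensity.
Arguments torus_measure {R}.

Lemma prod_scale (R : realType) n (u v e : nat -> R) (c : R) :
  (forall i, (i < n)%N -> u i = v i) -> u n = c * v n ->
  \prod_(i < n.+2) ((if (i <= n)%N then u i else 1) * e i) =
  c * \prod_(i < n.+2) ((if (i <= n)%N then v i else 1) * e i).
Proof.
move=> uv un; rewrite !big_ord_recr/= ltnn leqnn un !mul1r.
rewrite (eq_bigr (fun i : 'I_n => (if (i <= n)%N then v i else 1) * e i)).
  by set x := \prod_(i < n) _; ring.
by move=> i _; rewrite uv.
Qed.

Section separated_births.
Context d (Omega : measurableType d) (R : realType) (P : probability Omega R).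
Context (V : nat -> Omega -> R * R).
Hypothesis poisson : is_poisson_process P (fun w => range (V ^~ w))
                                   (@torus_time_intensity R).

Lemma poisson_finType (J : finType) (B : J -> set (R * R)) (k : J -> nat) :
  (forall j, measurable (B j)) ->
  (forall j, (torus_time_intensity (B j) < +oo)%E) ->
  trivIset [set: J] B ->
  P [set w | forall j, range (V ^~ w) `&` B j #= `I_(k j)] =
  (\prod_(j : J) poisson_prob (fine (torus_time_intensity (B j))) 0%N [set k j])%E.
Proof.
move=> mB fB tB; have [_ PN] := poisson.
have H := PN #|J| (B \o enum_val) (k \o enum_val) (fun i => mB _) (fun i => fB _).
rewrite (_ : [set w | _] =
    [set w | forall i : 'I_#|J|, range (V ^~ w) `&` (B \o enum_val) i #= `I_((k \o enum_val) i)]).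
  rewrite H; first by rewrite [RHS]big_enum_val.
  by apply/trivIsetP => i j _ _ ij; move/trivIsetP : tB; apply => //;
    apply: contra ij => /eqP/enum_val_inj ->.
apply/seteqP; split=> w /= h j; first exact: h.
by have := h (enum_rank j); rewrite /= enum_rankK.
Qed.

Hypothesis V_gt0 : forall n w, 0 < (V n w).2.
Hypothesis V_lt : forall n w, (V n w).2 < (V n.+1 w).2.

(** Each strip contributes the factor mass * exp(- length): of its two cells one
    has one point and the other none. *)
Lemma probability_separated (s : nat -> R) (B : nat -> set (R * R)) n :
  s 0%N = 0 -> (forall i, s i <= s i.+1) -> (forall i, measurable (B i)) ->
  P [set w | (forall i, (i <= n)%N -> s i < (V i w).2 <= s i.+1 /\ B i (V i w)) /\
             s n.+2 < (V n.+1 w).2] =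
  (\prod_(i < n.+2) ((if (i <= n)%N then
      fine (torus_time_intensity (strip s i `&` B i)) else 1) *
      expR (- (s i.+1 - s i))))%:E.
Proof.
move=> s0 s_le mB.
have s_ge0 i : 0 <= s i by elim: i => [|i IH]; rewrite ?s0// (le_trans IH).
have mstrip i : measurable (strip s i) by apply: measurableX => //; exact: measurable_itv.
rewrite (_ : [set w | _] =
  [set w | forall ib, range (V ^~ w) `&` cell s B ib #= `I_(cell_count (n:=n) ib)]); last first.
  by apply/seteqP; split=> w /=; rewrite strip_countsP.
have mass i : exists p q : R, [/\ 0 <= p, 0 <= q, p + q = s i.+1 - s i,
    torus_time_intensity (strip s i `&` B i) = p%:E &
    torus_time_intensity (strip s i `\` B i) = q%:E].
  exact: torus_time_intensity_strip (s_ge0 i) (s_le i) (mB i).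
rewrite poisson_finType.
- transitivity (\prod_(ib : 'I_n.+2 * bool)
     ((if ib.2 && (ib.1 <= n)%N then
         fine (torus_time_intensity (strip s ib.1 `&` B ib.1)) else 1) *
      expR (- fine (torus_time_intensity (cell s B ib))))%:E)%E.
    apply: eq_bigr => -[i b] _; rewrite /cell_count /cell/=.
    have [p [q [p0 q0 _ hp hq]]] := mass i.
    case: b => /=; last by rewrite hq mul1r poisson_prob0.
    by rewrite hp; case: leqP => _ /=; rewrite ?mul1r ?poisson_prob0 ?poisson_prob1.
  rewrite prodEFin; congr EFin; rewrite -(pair_bigA _ (fun (i : 'I_n.+2) b =>
     ((if b && (i <= n)%N then
         fine (torus_time_intensity (strip s i `&` B i)) else 1) *
      expR (- fine (torus_time_intensity (cell s B (i, b)))))))/=.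
  apply: eq_bigr => i _; rewrite big_bool/= /cell/=.
  have [p [q [p0 q0 pq -> ->]]] := mass i; rewrite /= mul1r -mulrA -expRD -pq.
  by congr (_ * expR _); rewrite opprD.
- by case=> i [] /=; [exact: measurableI|exact: measurableD].
- case=> i b; rewrite /cell/=; have [p [q [p0 q0 _ hp hq]]] := mass i.
  by case: b => /=; rewrite ?hp ?hq ltry.
- apply/trivIsetP => -[i b] [j c] _ _ /= ne.
  have [ij|ij] := eqVneq (i : nat) j.
    have bc : b != c.
      by apply: contra ne => /eqP ->; move/val_inj : ij => ->.
    move/val_inj : ij => <-; apply/seteqP; split=> // x.
    by rewrite /cell/=; case: b c bc {ne} => -[]//= _ [[_ ?] [_ ?]].
  apply/seteqP; split=> // x [/= ci cj].
  have {ci}si : strip s i x by move: ci; rewrite /cell/=; case: b {ne} => -[].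
  have {cj}sj : strip s j x by move: cj; rewrite /cell/=; case: c {ne} => -[].
  have s_homo : {homo s : i j / (i <= j)%N >-> i <= j}.
    exact/Order.NatMonotonyTheory.nondecnP.
  move: si sj; rewrite /strip/= !in_itv/= => -[_ /andP[l1 h1]] [_ /andP[l2 h2]].
  move: ij; rewrite neq_ltn => /orP[] /s_homo h.
    by move: (le_lt_trans (le_trans h1 h) l2); rewrite ltxx.
  by move: (le_lt_trans (le_trans h2 h) l1); rewrite ltxx.
Qed.

(** In the product formula [probability_separated] the position of the last point
    enters through one factor, the intensity of a rectangle, which is the
    uniform measure of [I] times the same factor with no restriction on the
    position. *)
Lemma separated_position_uniform (s : nat -> R) (B : nat -> set (R * R)) n
    (I J : set R) :
  s 0%N = 0 -> (forall i, s i <= s i.+1) -> (forall i, measurable (B i)) ->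
  measurable I -> measurable J ->
  let A := [set w | [/\ forall i, (i <= n)%N -> s i < (V i w).2 <= s i.+1,
     forall i, (i < n)%N -> B i (V i w), J (V n w).2 & s n.+2 < (V n.+1 w).2]] in
  P (A `&` [set w | I (V n w).1]) = (torus_measure I * P A)%E.
Proof.
move=> s0 s_le mB mI mJ A.
have s_ge0 i : 0 <= s i by elim: i => [|i IH]; rewrite ?s0// (le_trans IH).
pose C (K : set R) i : set (R * R) := if (i < n)%N then B i else K `*` J.
have mC K i : measurable K -> measurable (C K i).
  by move=> mK; rewrite /C; case: ifP => _ //; exact: measurableX.
have AE K : A `&` [set w | K (V n w).1] =
  [set w | (forall i, (i <= n)%N -> s i < (V i w).2 <= s i.+1 /\ C K i (V i w)) /\
             s n.+2 < (V n.+1 w).2].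
  apply/seteqP; split=> w /=.
    case=> -[h1 h2 h3 h4] h5; split=> // i iln; split; first exact: h1.
    rewrite /C; case: ltnP => ni; first exact: h2.
    by have -> : i = n by apply/eqP; rewrite eqn_leq iln.
  case=> h1 h2; have := h1 n (leqnn _); rewrite /C ltnn => -[_ [Kn Jn]].
  split=> //; split=> // i iln; first by case: (h1 i iln).
  by have := h1 i (ltnW iln); rewrite /C iln => -[].
have AE0 := etrans (esym (setIT A)) (AE setT).
rewrite (AE I) [in RHS]AE0.
do 2 (rewrite probability_separated//; last by move=> i; exact: mC).
rewrite -(fineK (fin_num_measure torus_measure I mI)) -EFinM; congr EFin.
apply: (@prod_scale R n (fun i => fine (torus_time_intensity (strip s i `&` C I i)))
  (fun i => fine (torus_time_intensity (strip s i `&` C setT i)))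
  (fun i => expR (- (s i.+1 - s i)))) => [i iln|].
  by rewrite /C iln.
rewrite /C ltnn !(setIC (strip s n)) !torus_time_intensityX// probability_setT mul1e.
apply: fineM; first exact: fin_num_measure.
rewrite ge0_fin_numE//.
apply: (@le_lt_trans _ _ (lebesgue_measure (`]s n, s n.+1]%classic : set R))).
  apply: le_measure; [|by rewrite inE; exact: measurable_itv|exact: subIsetr].
  by rewrite inE; apply: measurableI => //; exact: measurable_itv.
rewrite lebesgue_measure_itv/=; case: ifP => _; last exact: ltry.
by rewrite -EFinD ltry.
Qed.

End separated_births.

(** * Independence of a position from the past *)

Section proportional_measures.
Context d (T : measurableType d) (R : realType).
Context (mu : {measure set T -> \bar R}) (G : set (set T)) (D : set T) (c : R).
Hypotheses (mD : measurable D) (c0 : 0 <= c).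
Hypothesis Gm : G `<=` measurable.
Variable g : (set T)^nat.
Hypotheses (Gg : forall i, G (g i)) (g_cover : \bigcup_k (g k) = setT).

(** Uniqueness of measures, applied to the restriction of [mu] to [D] and to
    c * mu. *)
Lemma proportional_measure_cover :
  (forall n A, <<s G >> A -> mu (g n `&` A `&` D) = (c%:E * mu (g n `&` A))%E) ->
  forall A, <<s G >> A -> mu (A `&` D) = (c%:E * mu A)%E.
Proof.
move=> h; apply: (@g_sigma_algebra_measure_unique_cover _ R T G Gm g Gg g_cover
  (mrestr mu mD) (mscale (NngNum c0) mu)) => n A GA.
exact: h.
Qed.

Lemma proportional_measure_unique : setI_closed G -> (mu setT < +oo)%E ->
  (forall A, G A -> mu (A `&` D) = (c%:E * mu A)%E) ->
  forall A, <<s G >> A -> mu (A `&` D) = (c%:E * mu A)%E.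
Proof.
move=> GI muT h; apply: (@g_sigma_algebra_measure_unique _ R T G Gm g Gg g_cover
  (mrestr mu mD) (mscale (NngNum c0) mu)) => // k.
apply: le_lt_trans muT; apply: le_measure; rewrite ?inE//.
by apply: measurableI => //; exact: Gm.
Qed.

End proportional_measures.

Section independent_integral.
Local Open Scope ereal_scope.
Context d d1 d2 (Omega : measurableType d) (T1 : measurableType d1)
  (T2 : measurableType d2) (R : realType) (P : probability Omega R)
  (nu : probability T2 R) (U : Omega -> T1) (X : Omega -> T2).
Hypotheses (mU : measurable_fun setT U) (mX : measurable_fun setT X).
Hypothesis indep : forall A B, measurable A -> measurable B ->
  P (U @^-1` A `&` X @^-1` B) = P (U @^-1` A) * nu B.

Let U_mixin := isMeasurableFun.Build _ _ _ _ _ mU.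
Let U_pack : {mfun Omega >-> T1} := HB.pack U U_mixin.
Let UX w := (U w, X w).
Let mUX : measurable_fun setT UX.
Proof. exact: measurable_fun_pair. Qed.
Let UX_mixin := isMeasurableFun.Build _ _ _ _ _ mUX.
Let UX_pack : {mfun Omega >-> (T1 * T2)%type} := HB.pack UX UX_mixin.

Lemma ge0_integral_independent (H : T1 * T2 -> \bar R) :
  measurable_fun setT H -> (forall z, 0 <= H z) ->
  \int[P]_w H (U w, X w) = \int[P]_w \int[nu]_x H (U w, x).
Proof.
move=> mH H0.
transitivity (\int[distribution P UX_pack]_z H z).
  by rewrite ge0_integral_pushforward.
transitivity (\int[distribution P U_pack \x nu]_z H z).
  apply: eq_measure_integral => A mA _; apply/esym.
  exact: product_measure_unique.
rewrite fubini_tonelli1// ge0_integral_pushforward//.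
  exact: measurable_fun_fubini_tonelli_F.
by move=> x _; exact: integral_ge0.
Qed.

End independent_integral.

Section uniform_position.
Context d (Omega : measurableType d) (R : realType) (P : probability Omega R).
Context (phi : R -> R) (f : nat -> R).
Context (V : nat -> Omega -> R * R) (E : nat -> nat -> Omega -> bool).
Hypothesis phi_range : forall x : R, 0 <= x -> 0 <= phi x <= 1.
Hypothesis phi_nonincreasing : forall x y : R, 0 <= x -> x <= y -> phi y <= phi x.
Hypothesis f_gt0 : forall k, 0 < f k.
Hypothesis model : is_spatial_pa P phi f V E.
Hypothesis V_lt : forall n w, (V n w).2 < (V n.+1 w).2.

Let mV := spa_vertex_measurable model.
Let mX n := measurable_position mV n.
Let mT n := measurable_birth mV n.
Let V_gt0 n w : 0 < (V n w).2. Proof. by have [] := spa_vertex_domain model n w. Qed.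

(** Events about the positions and times of the n oldest vertices, the time of
    vertex n and the next birth time, but not the position of vertex n. The
    last constraint is there for the separating events below to belong to the
    family. *)
Definition births_gen n : set (set Omega) :=
  [set A | exists (B : nat -> set (R * R)) (J : set R) (r : R),
    [/\ forall i, measurable (B i), measurable J &
     A = [set w | [/\ forall i, (i < n)%N -> B i (V i w), J (V n w).2 &
                      r < (V n.+1 w).2]]]].

Lemma births_gen_measurable n : births_gen n `<=` measurable.
Proof.
move=> A [B [J [r [mB mJ ->]]]].
rewrite (_ : [set w | _] = (\bigcap_(i in `I_n) (V i @^-1` B i)) `&`
  (((fun w => (V n w).2) @^-1` J) `&` [set w | r < (V n.+1 w).2])).
  apply: measurableI.
    apply: fin_bigcap_measurable => // i _.
    by rewrite -[X in measurable X]setTI; exact: mV.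
  apply: measurableI; last exact: measurable_ltr_set.
  by rewrite -[X in measurable X]setTI; exact: mT.
by apply/seteqP; split=> w /= []; [|move=> h []].
Qed.

Lemma births_gen_setI n : setI_closed (births_gen n).
Proof.
move=> _ _ [B [J [r [mB mJ ->]]]] [C [K [q [mC mK ->]]]].
exists (fun i => B i `&` C i), (J `&` K), (Num.max r q); split.
- by move=> i; exact: measurableI.
- exact: measurableI.
apply/seteqP; split=> w /=.
  move=> [[h1 h2 h3] [h4 h5 h6]]; split=> //; last by rewrite gt_max h3.
  by move=> i iln; split; [exact: h1|exact: h4].
rewrite gt_max => -[h1 [h2 h3] /andP[h4 h5]].
by split; split=> // i iln; case: (h1 i iln).
Qed.

Definition separated (s : nat -> R) n : set Omega :=
  [set w | (forall i, (i <= n)%N -> s i < (V i w).2 <= s i.+1) /\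
           s n.+1 < (V n.+1 w).2].

Lemma separated_births_gen s n : births_gen n (separated s n).
Proof.
exists (fun i => setT `*` `]s i, s i.+1]%classic), `]s n, s n.+1]%classic, (s n.+1).
split=> [i||]; [|exact: measurable_itv|].
  by apply: measurableX => //; exact: measurable_itv.
apply/seteqP; split=> w /=.
  case=> h1 h2; split=> //; last by rewrite in_itv/=; exact: h1.
  by move=> i iln; split=> //=; rewrite in_itv/=; apply: h1; exact: ltnW.
case=> h1 h2 h3; split=> // i; rewrite leq_eqVlt => /predU1P[->|/h1[_]].
  by move: h2; rewrite in_itv.
by rewrite /= in_itv.
Qed.

(** On the event that fixed thresholds separate the births, the claim is the
    explicit computation of the previous part on generators, extended to the
    generated sigma-algebra. *)
Lemma separated_uniform (s : nat -> R) n (I : set R) (A : set Omega) :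
  s 0%N = 0 -> measurable I -> <<s births_gen n >> A ->
  P (separated s n `&` A `&` [set w | I (V n w).1]) =
  (torus_measure I * P (separated s n `&` A))%E.
Proof.
move=> s0 mI GA.
have [s_le|s_nle] := pselect (forall i, (i <= n)%N -> s i <= s i.+1); last first.
  rewrite (_ : separated s n = set0) ?set0I ?measure0 ?mule0//.
  apply/seteqP; split=> w //= -[h _]; apply: s_nle => i iln.
  by have /andP[/ltW h1 h2] := h i iln; exact: le_trans h1 h2.
have mU : measurable (separated s n) by exact/births_gen_measurable/separated_births_gen.
have mXI : measurable [set w | I (V n w).1].
  by rewrite -[X in measurable X]setTI; exact: mX.
rewrite -(fineK (fin_num_measure torus_measure I mI)).
rewrite -setIA (setIC (separated _ _)) (setIC (separated _ _) A).
apply: (@proportional_measure_unique _ _ _ (mrestr P mU) (births_gen n)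
  [set w | I (V n w).1] (fine (torus_measure I)) mXI _ (@births_gen_measurable n)
  (fun=> setT)) => //.
- by rewrite fine_ge0.
- move=> _; exists (fun=> setT), setT, 0; split=> //.
  by apply/seteqP; split=> w.
- by rewrite bigcup_const//; exists 0%N.
- exact: births_gen_setI.
- have : (P (setT `&` separated s n) < +oo)%E by rewrite setTI -ge0_fin_numE// fin_num_measure.
  by [].
move=> _ [B [J [r [mB mJ ->]]]].
(* The last threshold is raised to r, to absorb the constraint on the next birth. *)
pose s' i := if (i <= n.+1)%N then s i else Num.max r (s n.+1).
have := @separated_position_uniform _ _ _ P V (spa_poisson model) V_gt0 V_lt
  s' B n I J.
set U := [set w | _]; move=> /= H; rewrite fineK ?fin_num_measure//.
have UE : [set w | [/\ forall i, (i < n)%N -> B i (V i w), J (V n w).2 &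
                      r < (V n.+1 w).2]] `&` separated s n = U.
  apply/seteqP; split=> w; rewrite /U /separated /s'/= ltnn gt_max.
    case=> -[h1 h2 h3] [h4 h5]; split=> //; last by rewrite h3.
    by move=> i iln; rewrite (leq_trans iln)// ltnS iln; exact: h4.
  case=> h1 h2 h3 /andP[h4 h5]; split=> //; split=> // i iln.
  by have := h1 i iln; rewrite (leq_trans iln)// ltnS iln.
rewrite /mrestr setIAC UE; apply: H => //.
move=> i; rewrite /s'; case: (ltngtP i n.+1) => [iln|iln|->].
- exact: s_le.
- by [].
- by rewrite le_max lexx orbT.
Qed.

(** Separating thresholds are taken rational, so that countably many of the
    separating events cover the whole space. *)
Let sep (q : seq rat) i : R := if i is j.+1 then ratr (nth 0%Q q j) else 0.

Lemma births_uniform n (I : set R) (A : set Omega) :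
  measurable I -> <<s births_gen n >> A ->
  P (A `&` [set w | I (V n w).1]) = (torus_measure I * P A)%E.
Proof.
move=> mI GA; rewrite -(fineK (fin_num_measure torus_measure I mI)).
have mXI : measurable [set w | I (V n w).1].
  by rewrite -[X in measurable X]setTI; exact: mX.
pose g k : set Omega := separated (sep (odflt [::] (choice.unpickle k : option (seq rat)))) n.
apply: (@proportional_measure_cover _ _ _ P (births_gen n)
  [set w | I (V n w).1] (fine (torus_measure I)) mXI _ (@births_gen_measurable n) g) => //.
- by rewrite fine_ge0.
- by move=> k; exact: separated_births_gen.
- apply/seteqP; split=> // w _.
  have hq i : exists q : rat, (V i w).2 <= ratr q < (V i.+1 w).2.
    have /rat_in_itvoo[q] := V_lt i w; rewrite in_itv/= => /andP[h1 h2].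
    by exists q; rewrite (ltW h1) h2.
  have [q hqE] := choice hq.
  have sepE i : (i <= n)%N -> sep (mkseq q n.+1) i.+1 = ratr (q i).
    by move=> iln; rewrite /sep nth_mkseq.
  exists (choice.pickle (mkseq q n.+1)) => //; rewrite /g choice.pickleK.
  rewrite [odflt _ _]/(mkseq q n.+1); split=> [[_|i iln]|].
  + by rewrite sepE// V_gt0; case/andP: (hqE 0%N).
  + rewrite !sepE// ?(ltnW iln)//; have /andP[_ ->] := hqE i.
    by have /andP[-> _] := hqE i.+1.
  + by rewrite sepE//; case/andP: (hqE n).
move=> k B GB; rewrite fineK ?fin_num_measure//; exact: separated_uniform.
Qed.

(** What is known when vertex n is born, except its own position and the
    edges out of the vertices j and younger. Letting j grow from 0 to n is how the
    independence of the position of vertex n from the graph is proved. *)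
Definition past_gen n j : set (set Omega) :=
  [set A | [\/ exists k (B : set (R * R)),
                 [/\ (k < n)%N, measurable B & A = V k @^-1` B],
               exists J : set R, measurable J /\ A = [set w | J (V n w).2] |
               exists i m, (m < i < j)%N /\ A = [set w | E i m w]]].

Lemma past_gen_measurable n j : past_gen n j `<=` measurable.
Proof.
move=> A [[k [B [_ mB ->]]]|[J [mJ ->]]|[i [m [/andP[mi _] ->]]]].
- by rewrite -[X in measurable X]setTI; exact: mV.
- by rewrite -[X in measurable X]setTI; exact: mT.
- exact: spa_edge_measurable model _ _ mi.
Qed.

Lemma past_measurable n j A : <<s past_gen n j >> A -> measurable A.
Proof.
by apply: smallest_sub; [exact: sigma_algebra_measurable|exact: past_gen_measurable].
Qed.

Lemma past_history n j A (I : set R) : (j <= n)%N -> measurable I ->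
  <<s past_gen n j >> A -> history V E j (A `&` [set w | I (V n w).1]).
Proof.
move=> jn mI pA.
have sub : <<s past_gen n j >> `<=` history V E j.
  apply: smallest_sub; first exact: smallest_sigma_algebra.
  move=> B [[k [C [_ mC ->]]]|[J [mJ ->]]|[i [m [mij ->]]]]; apply: sub_sigma_algebra.
  - by left; exists k, C.
  - left; exists n, (setT `*` J); split; first exact: measurableX.
    by apply/seteqP; split=> w //= -[].
  - by right; exists i, m.
apply: (@measurableI _ (g_sigma_algebraType _)); first exact: sub.
apply: sub_sigma_algebra; left; exists n, (I `*` setT); split; first exact: measurableX.
by apply/seteqP; split=> w //= -[].
Qed.

Local Notation Past n j := (g_sigma_algebraType (past_gen n j)).

Lemma past_position n j k : (k < n)%N ->
  measurable_fun (setT : set (Past n j)) (fun w => (V k w).1).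
Proof.
move=> kn _ B mB; rewrite setTI; apply: sub_sigma_algebra; apply: Or31.
exists k, (B `*` setT); split=> //; first exact: measurableX.
by apply/seteqP; split=> w //= -[].
Qed.

Lemma past_birth n j k : (k <= n)%N ->
  measurable_fun (setT : set (Past n j)) (fun w => (V k w).2).
Proof.
rewrite leq_eqVlt => /predU1P[->|kn] _ B mB; rewrite setTI; apply: sub_sigma_algebra.
  by apply: Or32; exists B.
apply: Or31; exists k, (setT `*` B); split=> //; first exact: measurableX.
by apply/seteqP; split=> w //= -[].
Qed.

Lemma past_edge n j i m : (m < i < j)%N ->
  measurable_fun (setT : set (Past n j)) (E i m).
Proof.
move=> mij; apply: measurable_fun_of_set; apply: sub_sigma_algebra; apply: Or33.
by exists i, m.
Qed.

Lemma measurable_bool_nat d' (T : measurableType d') (b : T -> bool) :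
  measurable_fun setT b -> measurable_fun setT (fun w => b w : nat).
Proof. by move=> mb; apply: measurableT_comp => //. Qed.

Lemma past_degree n j m i : (i <= j)%N ->
  measurable_fun (setT : set (Past n j)) (degree E m i).
Proof.
move=> ij; rewrite /degree.
elim: i ij => [|i IH] ij.
  by under eq_fun do rewrite big_geq//; exact: measurable_cst.
have [mi|im] := ltnP m i; last first.
  by under eq_fun do rewrite big_geq//; exact: measurable_cst.
under eq_fun do rewrite big_nat_recr//=.
apply: measurable_fun_addn; first exact: IH (ltnW ij).
by apply: measurable_bool_nat; apply: past_edge; rewrite mi.
Qed.

Lemma measurable_nat_param d1 d2 (T1 : measurableType d1) (T2 : measurableType d2)
    (N : T1 -> nat) (F : nat -> T1 -> T2) :
  measurable_fun setT N -> (forall k, measurable_fun setT (F k)) ->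
  measurable_fun setT (fun w => F (N w) w).
Proof.
move=> mN mF _ B mB; rewrite setTI.
rewrite (_ : _ @^-1` B = \bigcup_k ((N @^-1` [set k]) `&` (F k @^-1` B))).
  apply: bigcupT_measurable => k; apply: measurableI.
    by rewrite -[X in measurable X]setTI; exact: mN.
  by rewrite -[X in measurable X]setTI; exact: mF.
by apply/seteqP; split=> w /= => [h|[k _ [-> h]]]; [exists (N w)|].
Qed.

Lemma indegree_before_birth n m w :
  indegree_before V E m (V n w).2 w = degree E m n w.
Proof.
have mono : {mono (fun i => (V i w).2) : i j / (i < j)%N >-> i < j}.
  by apply: leW_mono; exact/Order.NatMonotonyTheory.incnP.
by apply: card_fset_degree => i /=; rewrite mono.
Qed.

Lemma edge_probE n m w : edge_prob phi f V E n m w =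
  phi ((V n w).2 * torus_dist (V n w).1 (V m w).1 / f (degree E m n w)).
Proof. by rewrite /edge_prob indegree_before_birth. Qed.

Lemma past_edge_prob n j i m : (m < i)%N -> (i < n)%N -> (i <= j)%N ->
  measurable_fun (setT : set (Past n j)) (edge_prob phi f V E i m).
Proof.
move=> mi iln ij; rewrite (funext (edge_probE i m)).
pose F k (w : Past n j) : R :=
  phi ((V i w).2 * torus_dist (V i w).1 (V m w).1 / f k).
suff mF k : measurable_fun setT (F k).
  exact: (measurable_nat_param (@past_degree n j m i ij) mF).
rewrite /F; apply: measurable_nonincreasing_comp => //; last first.
  by move=> w; apply: edge_arg_ge0 => //; exact: spa_vertex_domain model.
apply: measurable_funM => //; apply: measurable_funM; first by apply: past_birth; exact: ltnW.
apply: measurable_torus_dist; first exact: past_position.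
by apply: past_position; exact: ltn_trans mi iln.
Qed.

Lemma past_uniform0 n (I : set R) A : measurable I -> <<s past_gen n 0 >> A ->
  P (A `&` [set w | I (V n w).1]) = (torus_measure I * P A)%E.
Proof.
move=> mI pA; apply: births_uniform => //.
apply: smallest_sub pA; first exact: smallest_sigma_algebra.
move=> B [[k [C [kn mC ->]]]|[J [mJ ->]]|[i [m [/andP[_ //]]]]];
  apply: sub_sigma_algebra.
- exists (fun i => if i == k then C else setT), setT, 0; split=> //.
    by move=> i; case: ifP.
  apply/seteqP; split=> w /=; last by case=> /(_ k kn); rewrite eqxx.
  by move=> Cw; split=> // i iln; case: eqP => // ->.
- exists (fun=> setT), J, 0; split=> //.
  by apply/seteqP; split=> w //= -[].
Qed.

Lemma past_integral n j (H : Past n j * R -> \bar R) :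
  (forall I A, measurable I -> <<s past_gen n j >> A ->
    P (A `&` [set w | I (V n w).1]) = (torus_measure I * P A)%E) ->
  measurable_fun setT H -> (forall z, 0 <= H z)%E ->
  (\int[P]_w H (w, (V n w).1) = \int[P]_w \int[torus_measure]_x H (w, x))%E.
Proof.
move=> unif mH H0.
have mid : measurable_fun (setT : set Omega) (id : Omega -> Past n j).
  by move=> _ B mB; rewrite setTI; exact: past_measurable mB.
apply: (@ge0_integral_independent _ _ _ _ (Past n j) _ _ P torus_measure id
    (fun w => (V n w).1) mid (mX n) _ H) => // A B mA mB.
by rewrite [RHS]muleC; exact: unif.
Qed.

(** By induction on j: by the attachment rule, given the points, the probability of
    a prescribed set of edges out of vertex j is a product of edge
    probabilities, which is a function of the past with edges between the j
    oldest vertices. By the induction hypothesis this past is independent of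
    the position of vertex n, so revealing the edges out of vertex j does not
    bias that position. *)
Lemma past_uniform n j (I : set R) A : (j <= n)%N -> measurable I ->
  <<s past_gen n j >> A ->
  P (A `&` [set w | I (V n w).1]) = (torus_measure I * P A)%E.
Proof.
elim: j I A => [|j IH] I A jn mI pA; first exact: past_uniform0.
have mXI : measurable [set w | I (V n w).1].
  by rewrite -[X in measurable X]setTI; exact: mX.
pose row (b : {ffun 'I_j -> bool}) := [set w | forall m : 'I_j, E j m w = b m].
have mrow b : measurable (row b).
  rewrite (_ : row b = \bigcap_(m in [set: 'I_j]) [set w | E j m w = b m]).
    apply: fin_bigcap_measurable => // m _; case: (b m).
      exact: spa_edge_measurable model _ _ (ltn_ord m).
    rewrite (_ : [set w | _] = ~` [set w | E j m w]).
      by apply: measurableC; apply: (spa_edge_measurable model).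
    by apply/seteqP; split=> w /=; [move=> ->|move=> /negP; exact: negbTE].
  by apply/seteqP; split=> w h m; [move=> _; exact: h|exact: h].
(* The past up to j+1 is generated by events that prescribe all the edges out of
   vertex j together. *)
pose G := [set C | exists B b, <<s past_gen n j >> B /\ C = B `&` row b].
have GsG : <<s past_gen n j.+1 >> `<=` <<s G >>.
  have GT b C : <<s past_gen n j >> C -> <<s G >> (C `&` row b).
    by move=> pC; apply: sub_sigma_algebra; exists C, b.
  have rowE C : C = \bigcup_b (C `&` row b).
    apply/seteqP; split=> [w Cw|w [b _ []]//].
    by exists [ffun m : 'I_j => E j m w] => //; split=> // m; rewrite ffunE.
  apply: smallest_sub; first exact: smallest_sigma_algebra.
  move=> C pC.
  have [pC'|[m [mj CE]]] : <<s past_gen n j >> C \/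
      exists m : nat, (m < j)%N /\ C = [set w | E j m w].
    case: pC => [h|h|[i [m [/andP[mi ij] ->]]]].
    - by left; apply: sub_sigma_algebra; exact: Or31.
    - by left; apply: sub_sigma_algebra; exact: Or32.
    move: ij; rewrite ltnS leq_eqVlt => /predU1P[ij|ij].
      by right; exists m; rewrite -ij.
    by left; apply: sub_sigma_algebra; apply: Or33; exists i, m; rewrite mi.
    rewrite (rowE C); apply: (@countable_bigcupT_measurable _ (g_sigma_algebraType G)).
      exact: countableP.
    by move=> b; exact: GT.
  rewrite (_ : C = \bigcup_b (if (b : {ffun 'I_j -> bool}) (Ordinal mj) then setT `&` row b else set0)).
    apply: (@countable_bigcupT_measurable _ (g_sigma_algebraType G)).
      exact: countableP.
    move=> b; case: ifP => _; last exact: measurable0.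
    by apply: GT; exact: (@measurableT _ (Past n j)).
  rewrite CE; apply/seteqP; split=> w /=.
    move=> Ew; exists [ffun m : 'I_j => E j m w] => //; rewrite ffunE/= Ew.
    by split=> // i; rewrite ffunE.
  by case=> b _; case: ifP => //= bm [_ /(_ (Ordinal mj))/=->].
have Gm : G `<=` measurable.
  by move=> _ [B [b [pB ->]]]; apply: measurableI => //; exact: past_measurable pB.
rewrite -(fineK (fin_num_measure torus_measure I mI)).
pose g k : set Omega :=
  if (choice.unpickle k : option {ffun 'I_j -> bool}) is Some b then row b else set0.
apply: (@proportional_measure_unique _ _ _ P G _ _ mXI _ Gm g) => //.
- by rewrite fine_ge0.
- move=> k; rewrite /g; case: (choice.unpickle k) => [b|].
    by exists setT, b; rewrite setTI; split=> //; exact: (@measurableT _ (Past n j)).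
  by exists set0, [ffun=> true]; rewrite set0I; split=> //; exact: (@measurable0 _ (Past n j)).
- apply/seteqP; split=> // w _; exists (choice.pickle [ffun m : 'I_j => E j m w]) => //.
  by rewrite /g choice.pickleK => m; rewrite ffunE.
- move=> _ _ [B [b [pB ->]]] [C [c [pC ->]]].
  have [<-|bc] := eqVneq b c.
    exists (B `&` C), b; rewrite setIACA setIid; split=> //.
    exact: (@measurableI _ (Past n j)).
  exists set0, b; split; first exact: (@measurable0 _ (Past n j)).
  rewrite set0I; apply/seteqP; split=> // w [[_ h] [_ h']].
  by move/eqP: bc; apply; apply/ffunP => m; rewrite -h -h'.
- by rewrite -ge0_fin_numE// fin_num_measure.
- move=> _ [B [b [pB ->]]]; rewrite fineK ?fin_num_measure//.
  suff key : P (B `&` row b `&` [set w | I (V n w).1]) =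
      (torus_measure I * P (B `&` row b))%E by exact: key.
  have jn' := ltnW jn.
  rewrite setIAC (spa_attachment model b (past_history jn' mI pB)).
  have pB' : history V E j B.
    have := past_history jn' measurableT pB.
    by rewrite (_ : [set w | _] = setT) ?setIT//; apply/seteqP; split.
  rewrite (spa_attachment model b pB').
  set W := (fun w => (\prod_(m < j) _)%:E).
  have mW : measurable_fun (setT : set (Past n j)) W.
    apply/measurable_EFinP; apply: measurable_prod => m _.
    have := past_edge_prob (ltn_ord m) jn (leqnn j).
    by case: (b m) => // h; apply: measurable_funB.
  have W0 w : (0 <= W w)%E.
    rewrite lee_fin; apply: prodr_ge0 => m _.
    by have /andP[] := edge_weight_ge0_le1 phi_range f_gt0 E (spa_vertex_domain model) j m w (b m).
  have BE D C : measurable D -> measurable C ->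
      (\int[P]_(w in D `&` C) W w = \int[P]_w ((\1_D w)%:E * W w * (\1_C w)%:E))%E.
    move=> mD mC; rewrite integral_mkcond; apply: eq_integral => w _.
    rewrite patchE in_setI !indicE; case: (w \in D); case: (w \in C);
      by rewrite /= ?mul1e ?mule1 ?mul0e ?mule0.
  have mB : measurable B by exact: past_measurable pB.
  rewrite BE// -{2}(setIT B) BE//.
  pose H (z : Past n j * R) := ((\1_B z.1)%:E * W z.1 * (\1_I z.2)%:E)%E.
  have mH : measurable_fun setT H.
    apply: emeasurable_funM; first apply: emeasurable_funM.
    - apply/measurable_EFinP; apply: measurableT_comp; last exact: measurable_fst.
      exact: (@measurable_indic _ (Past n j) R setT B pB).
    - exact: (measurableT_comp mW measurable_fst).
    - apply/measurable_EFinP; apply: measurableT_comp; last exact: measurable_snd.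
      exact: measurable_indic.
  have H0 z : (0 <= H z)%E by rewrite /H !mule_ge0// lee_fin.
  have HE := past_integral (fun I A mI pA => IH I A jn' mI pA) mH H0.
  have mW' : measurable_fun (setT : set Omega) W.
    by move=> _ C mC; rewrite setTI; apply: past_measurable (n) (j) _ _; rewrite -[X in <<s _ >> X]setTI; exact: mW.
  rewrite [RHS]muleC -ge0_integralZr//; first last.
  - by move=> w _; rewrite !mule_ge0// lee_fin.
  - apply: emeasurable_funM; last by apply/measurable_EFinP; exact: measurable_indic.
    by apply: emeasurable_funM => //; apply/measurable_EFinP; exact: measurable_indic.
  transitivity (\int[P]_w H (w, (V n w).1))%E; first by apply: eq_integral.
  rewrite HE; apply: eq_integral => w _; rewrite /H/= indicT mule1.
  rewrite ge0_integralZl//; first by rewrite integral_indic// setIT.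
    by apply/measurable_EFinP; exact: measurable_indic.
  by rewrite mule_ge0// lee_fin.
- exact: GsG.
Qed.

End uniform_position.

(** * The distance to a uniform point of the circle *)

Definition image_measure d d' (T1 : measurableType d) (T2 : measurableType d')
  (R : realType) (m : {measure set T1 -> \bar R}) (f : T1 -> T2)
  (mf : measurable_fun setT f) : {measure set T2 -> \bar R}.
Proof. by refine (pushforward m f : {measure set T2 -> \bar R}). Defined.

Section laws_on_the_line.
Context (R : realType).
Local Notation lambda := (@lebesgue_measure R).

Lemma eq_measure_rays (m1 m2 : {measure set (measurableTypeR R) -> \bar R}) :
  (m1 setT < +oo)%E -> (forall r : R, m1 `]-oo, r[%classic = m2 `]-oo, r[%classic) ->
  forall A, measurable A -> m1 A = m2 A.
Proof.
move=> m1fin m12; apply: (@measure_unique _ R (measurableTypeR R) (@RGenInftyO.G R)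
  (fun n => `]-oo, n%:R[%classic)).
- exact: RGenInftyO.measurableE.
- move=> _ _ [x ->] [y ->]; exists (Num.min x y).
  by apply/seteqP; split=> z /=; rewrite !in_itv/= lt_min; [case=> -> ->|move/andP].
- by move=> n; exists n%:R.
- apply/seteqP; split=> // x _; exists (Num.bound `|x|) => //=.
  by rewrite in_itv/= (le_lt_trans (ler_norm _))//; exact: archi_boundP.
- by move=> _ [x ->].
- move=> n; apply: le_lt_trans m1fin; apply: le_measure; rewrite ?inE//.
Qed.

Lemma torus_measure_ray (r : R) : torus_measure `]-oo, r[%classic =
  (if r <= 0 then 0 else if r <= 1 then r else 1)%:E.
Proof.
rewrite /torus_measure /mrestr; have [r0|r0] := leP r 0.
  rewrite (_ : _ `&` _ = set0) ?measure0//; apply/seteqP; split=> x //=.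
  by rewrite !in_itv/= => -[xr /andP[x0 _]]; lra.
have [r1|r1] := leP r 1.
  rewrite (_ : _ `&` _ = `[0, r[%classic).
    by rewrite lebesgue_measure_itv/= lte_fin r0 -EFinD subr0.
  apply/seteqP; split=> x /=; rewrite !in_itv/=; first by case=> ? /andP[-> _].
  by move=> /andP[x0 xr]; rewrite xr x0 (lt_le_trans xr).
rewrite (_ : _ `&` _ = `[0, 1[%classic).
  by rewrite lebesgue_measure_itv/= lte_fin ltr01 -EFinD subr0.
apply/seteqP; split=> x /=; rewrite !in_itv/=; first by case.
by move=> /andP[x0 x1]; rewrite x0 x1 (lt_trans x1).
Qed.

Let lambdaU (a b c e : R) : a <= b -> b <= c -> c <= e ->
  lambda (`[a, b[%classic `|` `]c, e[%classic) = ((b - a) + (e - c))%:E.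
Proof.
move=> ab bc ce.
have -> : lambda (`[a, b[%classic `|` `]c, e[%classic) =
    (lambda `[a, b[%classic + lambda `]c, e[%classic)%E.
  apply: measureU; [exact: measurable_itv|exact: measurable_itv|].
  apply/seteqP; split=> x //=; rewrite !in_itv/= => -[/andP[? ?] /andP[? ?]]; lra.
rewrite !lebesgue_measure_itv/= !lte_fin EFinD; congr (_ + _)%E.
  by move: ab; rewrite le_eqVlt => /predU1P[->|->]; rewrite ?ltxx ?subrr.
by move: ce; rewrite le_eqVlt => /predU1P[->|->]; rewrite ?ltxx ?subrr.
Qed.

(** The distance to a given point of a circle of length 1 is uniform on [0, 1/2]. *)
Lemma torus_dist_law (y r : R) : 0 <= y < 1 ->
  torus_measure [set x | 2 * torus_dist x y < r] = torus_measure `]-oo, r[%classic.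
Proof.
move=> /andP[y0 y1]; rewrite torus_measure_ray /torus_measure /mrestr.
have key x : 2 * torus_dist x y < r <->
    (- r / 2 < x - y < r / 2) \/ (x - y > 1 - r / 2) \/ (x - y < - (1 - r / 2)).
  rewrite /torus_dist; set z := x - y.
  have -> : (2 * Num.min `|z| (1 - `|z|) < r) = (`|z| < r / 2) || (1 - `|z| < r / 2).
    by rewrite -gt_min ltr_pdivlMr// mulrC.
  rewrite ltr_norml -mulNr; split.
    move=> /orP[->|h]; first by left.
    right; have [z0|z0] := leP 0 z; [left|right]; move: h.
      by rewrite ger0_norm//; lra.
    by rewrite ltr0_norm//; lra.
  move=> [->//|[h|h]]; apply/orP; [right|right].
    by have := ler_norm z; lra.
  by have := ler_norm (- z); rewrite normrN; lra.
have [r0|r0] := leP r 0.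
  rewrite (_ : _ `&` _ = set0) ?measure0//; apply/seteqP; split=> x //= [/key h].
  by rewrite in_itv/= => /andP[x0 x1]; case: h => [/andP[? ?]|[?|?]]; lra.
have [r1|r1] := leP r 1; last first.
  rewrite (_ : _ `&` _ = `[0, 1[%classic).
    by rewrite lebesgue_measure_itv/= lte_fin ltr01 -EFinD subr0.
  apply/seteqP; split=> x /=; first by case.
  move=> h; split=> //; move: h; rewrite in_itv/= => /andP[x0 x1].
  apply/key; have [h|h] := ltP (x - y) (r / 2); last by right; left; lra.
  by have [h'|h'] := ltP (- r / 2) (x - y); [left; apply/andP; split|right; right; lra].
have [yr|yr] := ltP y (r / 2).
  rewrite (_ : _ `&` _ = `[0, y + r / 2[%classic `|` `]y + 1 - r / 2, 1[%classic).
    by rewrite lambdaU; [congr EFin; lra|lra|lra|lra].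
  apply/seteqP; split=> x /=; rewrite !in_itv/=.
    move=> [/key h /andP[x0 x1]]; case: h => [/andP[? ?]|[?|?]];
    by [left; apply/andP; split; lra|right; apply/andP; split; lra|lra].
  move=> [/andP[? ?]|/andP[? ?]]; split; try by apply/andP; split; lra.
    by apply/key; left; apply/andP; split; lra.
  by apply/key; right; left; lra.
have [yr1|yr1] := ltP 1 (y + r / 2).
  rewrite (_ : _ `&` _ = `[0, y - 1 + r / 2[%classic `|` `]y - r / 2, 1[%classic).
    by rewrite lambdaU; [congr EFin; lra|lra|lra|lra].
  apply/seteqP; split=> x /=; rewrite !in_itv/=.
    move=> [/key h /andP[x0 x1]]; case: h => [/andP[? ?]|[?|?]];
    by [right; apply/andP; split; lra|left; apply/andP; split; lra|lra].
  move=> [/andP[? ?]|/andP[? ?]]; split; try by apply/andP; split; lra.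
    by apply/key; right; right; lra.
  by apply/key; left; apply/andP; split; lra.
rewrite (_ : _ `&` _ = `]y - r / 2, y + r / 2[%classic).
  rewrite lebesgue_measure_itv/= lte_fin ltrD2l ifT; last by lra.
  by rewrite -EFinD; congr EFin; lra.
apply/seteqP; split=> x /=; rewrite !in_itv/=.
  by move=> [/key h /andP[x0 x1]]; case: h => [/andP[? ?]|[?|?]]; apply/andP; split; lra.
move=> /andP[? ?]; split; last by apply/andP; split; lra.
by apply/key; left; apply/andP; split; lra.
Qed.

Lemma ge0_integral_torus_measure (F : R -> \bar R) :
  measurable_fun setT F -> (forall x, 0 <= F x)%E ->
  (\int[torus_measure]_x F x = \int[lambda]_(x in `[0%R, 1%R[%classic) F x)%E.
Proof.
move=> mF F0.
rewrite (@ge0_negligible_integral _ _ R torus_measure setT (~` `[0%R, 1%R[%classic))//.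
- rewrite setTD setCK; apply: eq_measure_integral => A mA AD.
  by transitivity (lambda (A `&` `[0, 1[%classic)); last by rewrite setIidl.
- by apply: measurableC; exact: measurable_itv.
- by transitivity (lambda (~` `[0, 1[%classic `&` `[0, 1[%classic));
    last by rewrite setICl measure0.
Qed.

Lemma lebesgue_measure_scale (a : R) (A : set (measurableTypeR R)) :
  0 < a -> measurable A ->
  lambda A = (a%:E * lambda ((fun x => a * x)%R @^-1` A))%E.
Proof.
move=> a0; pose h : measurableTypeR R -> measurableTypeR R := fun x => a * x.
have mh : measurable_fun setT h by exact: mulrl_measurable.
pose m := image_measure lambda mh.
apply: (@lebesgue_measure_unique R (mscale (NngNum (ltW a0)) m)) => _ [[p q] _ <-].
transitivity (a%:E * lambda (h @^-1` `]p, q]%classic))%E; last by [].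
rewrite (_ : h @^-1` _ = `]p / a, q / a]%classic); last first.
  apply/seteqP; split=> x /=; rewrite !in_itv/= /h.
    by rewrite ltr_pdivrMr// ler_pdivlMr// mulrC.
  by rewrite ltr_pdivrMr// ler_pdivlMr// mulrC.
rewrite !lebesgue_measure_itv/= !lte_fin ltr_pM2r ?invr_gt0//.
case: ifP => _; last by rewrite mule0.
by rewrite -!EFinD -EFinM; congr EFin; field; rewrite gt_eqF.
Qed.

Lemma ge0_integral_scale (a b : R) (F : R -> \bar R) : 0 < a ->
  measurable_fun setT F -> (forall x, 0 <= F x)%E ->
  (\int[lambda]_(x in `[0%R, (a * b)%R[%classic) F x =
   a%:E * \int[lambda]_(x in `[0%R, b[%classic) F (a * x)%R)%E.
Proof.
move=> a0 mF F0; pose h : measurableTypeR R -> measurableTypeR R := fun x => a * x.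
have mh : measurable_fun setT h by exact: mulrl_measurable.
pose m := image_measure lambda mh.
have mI : measurable (`[0, a * b[%classic : set (measurableTypeR R)).
  exact: measurable_itv.
rewrite (@eq_measure_integral _ _ R _ (mscale (NngNum (ltW a0)) m)); last first.
  by move=> A mA _; exact: lebesgue_measure_scale.
rewrite ge0_integral_mscale//=; last exact: measurable_funTS.
congr (_ * _)%E; rewrite ge0_integral_pushforward//; last exact: measurable_funTS.
rewrite (_ : h @^-1` _ = `[0, b[%classic)//.
apply/seteqP; split=> x /=; rewrite !in_itv/= /h.
  by rewrite pmulr_rge0// ltr_pM2l.
by rewrite pmulr_rge0// ltr_pM2l.
Qed.

End laws_on_the_line.

Section profile.
Context (R : realType) (phi : R -> R).
Hypothesis phi_range : forall x : R, 0 <= x -> 0 <= phi x <= 1.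
Hypothesis phi_nonincreasing : forall x y : R, 0 <= x -> x <= y -> phi y <= phi x.
Hypothesis phi_integral :
  (\int[@lebesgue_measure R]_(x in `[0%R, +oo[) (phi x)%:E = (1 / 2)%:E)%E.
Local Notation lambda := (@lebesgue_measure R).

(** Extending [phi] to the negative numbers by its value at 0 makes it monotone,
    hence Borel, on the whole line. *)
Definition profile (x : R) : R := phi (Num.max 0 x).

Lemma profileE x : 0 <= x -> profile x = phi x.
Proof. by move=> x0; rewrite /profile max_r. Qed.

Lemma profile_ge0_le1 x : 0 <= profile x <= 1.
Proof. by apply: phi_range; rewrite le_max lexx. Qed.

Lemma profile_ge0 x : 0 <= profile x.
Proof. by have /andP[] := profile_ge0_le1 x. Qed.

Lemma profile_nonincreasing x y : x <= y -> profile y <= profile x.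
Proof.
move=> xy; apply: phi_nonincreasing; first by rewrite le_max lexx.
by rewrite ge_max !le_max lexx xy orbT.
Qed.

Lemma measurable_profile : measurable_fun setT profile.
Proof. by apply: nonincreasing_measurable => // x y; exact: profile_nonincreasing. Qed.

Lemma measurable_profile_comp d (T : measurableType d) (h : T -> R) :
  measurable_fun setT h -> measurable_fun setT (fun w => (profile (h w))%:E).
Proof.
move=> mh; apply/measurable_EFinP; exact: measurableT_comp measurable_profile mh.
Qed.

(** Twice the integral of the profile over [0, c/2]. Distances on the torus are at most
    1/2, so this is the part of the profile that acts, at time t, on a vertex of
    degree k, with c = t / f k. *)
Definition profile_mass (c : R) : R :=
  fine (2%:E * \int[lambda]_(x in `[0%R, (c / 2)%R[%classic) (profile x)%:E)%E.

Lemma profile_integral :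
  (\int[lambda]_(x in `[0%R, +oo[%classic) (profile x)%:E = (1 / 2)%:E)%E.
Proof.
rewrite -phi_integral; apply: eq_integral => x.
by rewrite inE/= in_itv/= andbT => x0; rewrite profileE.
Qed.

Let sub_integral (A B : set R) : measurable A -> measurable B -> A `<=` B ->
  (\int[lambda]_(x in A) (profile x)%:E <= \int[lambda]_(x in B) (profile x)%:E)%E.
Proof.
move=> mA mB AB; apply: ge0_subset_integral => //.
- by apply: measurable_funTS; exact: measurable_profile_comp.
- by move=> x _; rewrite lee_fin profile_ge0.
Qed.

Lemma profile_mass_fin c :
  (2%:E * \int[lambda]_(x in `[0%R, (c / 2)%R[%classic) (profile x)%:E)%E \is a fin_num.
Proof.
rewrite fin_numM//; apply/fin_numPlt.
rewrite (lt_le_trans _ (integral_ge0 _ _))//=; last first.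
  by move=> x _; rewrite lee_fin profile_ge0.
apply: (@le_lt_trans _ _ (1 / 2)%:E); last exact: ltry.
rewrite -profile_integral; apply: sub_integral; try exact: measurable_itv.
by move=> x /=; rewrite !in_itv/= => /andP[->].
Qed.

Lemma profile_mass_ge0 c : 0 <= profile_mass c.
Proof.
apply: fine_ge0; rewrite mule_ge0//; apply: integral_ge0 => x _.
by rewrite lee_fin profile_ge0.
Qed.

Lemma profile_mass_le1 c : profile_mass c <= 1.
Proof.
rewrite -lee_fin /profile_mass fineK ?profile_mass_fin//.
apply: (@le_trans _ _ (2%:E * (1 / 2)%:E)%E); last first.
  by rewrite -EFinM lee_fin mul1r divff.
rewrite lee_pmul2l// -profile_integral; apply: sub_integral; try exact: measurable_itv.
by move=> x /=; rewrite !in_itv/= => /andP[->].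
Qed.

Lemma profile_mass_nondecreasing c e : c <= e -> profile_mass c <= profile_mass e.
Proof.
move=> ce; rewrite -lee_fin /profile_mass !fineK ?profile_mass_fin//.
rewrite lee_pmul2l//; apply: sub_integral; try exact: measurable_itv.
move=> x /=; rewrite !in_itv/= => /andP[-> xc]/=; apply: lt_le_trans xc _.
by rewrite ler_pM2r.
Qed.

(** This is where the normalisation of the integral of [phi] enters: the expected
    number of edges to a vertex of degree k per unit of log-time is f k
    asymptotically. *)
Lemma profile_mass_cvg (eps : R) : 0 < eps ->
  exists2 A : R, 0 < A & forall c, A <= c -> 1 - eps <= profile_mass c.
Proof.
move=> e0.
have H : (\int[lambda]_(x in `[0%R, n%:R[%classic) (profile x)%:E @[n --> \oo] -->
    (1 / 2)%:E)%E.
  rewrite -profile_integral (_ : `[0%R, +oo[%classic = \bigcup_n `[0%R, n%:R[%classic).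
    apply: ge0_nondecreasing_set_cvg_integral => //.
    - move=> m n mn; apply/subsetPset => x /=; rewrite !in_itv/= => /andP[-> xm]/=.
      by rewrite (lt_le_trans xm)// ler_nat.
    - by move=> n; apply: measurable_funTS; exact: measurable_profile_comp.
    - by move=> n x _; rewrite lee_fin profile_ge0.
  apply/seteqP; split=> x /=; rewrite !in_itv/= ?andbT.
    move=> x0; exists (Num.bound x) => //=.
    by rewrite in_itv/= x0 archi_boundP.
  by case=> n _ /=; rewrite in_itv/= => /andP[].
have [n hn] : exists n, ((1 / 2 - eps / 2)%:E <
    \int[lambda]_(x in `[0%R, n%:R[%classic) (profile x)%:E)%E.
  apply: contrapT => /forallNP h.
  have : (limn (fun n => \int[lambda]_(x in `[0%R, n%:R[%classic) (profile x)%:E) <=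
     (1 / 2 - eps / 2)%:E)%E.
    apply: lime_le; first by apply/cvg_ex; eexists; exact: H.
    by apply: nearW => n; rewrite leNgt; exact/negP.
  by rewrite (cvg_lim _ H)// lee_fin; lra.
exists (2 * n%:R + 1) => [|c cn]; first by rewrite ltr_wpDl// mulr_ge0.
apply: (@le_trans _ _ (profile_mass (2 * n%:R))); last first.
  by apply: profile_mass_nondecreasing; lra.
rewrite -lee_fin /profile_mass fineK ?profile_mass_fin//.
rewrite (_ : 2 * n%:R / 2 = n%:R); last by field.
apply: (@le_trans _ _ (2%:E * (1 / 2 - eps / 2)%:E)%E).
  by rewrite -EFinM lee_fin; lra.
by rewrite lee_pmul2l// ltW.
Qed.

(** Twice the distance to a given point is uniform on [0, 1]; the change of variable
    u = c * x / 2 then gives the integral of the profile over [0, c / 2]. *)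
Lemma profile_mean (c y : R) : 0 < c -> 0 <= y < 1 ->
  (\int[torus_measure]_x (profile (c * torus_dist x y))%:E =
   (profile_mass c / c)%:E)%E.
Proof.
move=> c0 y01; have c20 : 0 < c / 2 by rewrite divr_gt0.
pose h (x : measurableTypeR R) : measurableTypeR R := 2 * torus_dist x y.
have mh : measurable_fun setT h.
  apply: measurable_funM => //; apply: measurable_torus_dist => //.
have mF (k : R) : measurable_fun setT (fun x => (profile (k * x))%:E).
  by apply: measurable_profile_comp; exact: mulrl_measurable.
pose m := image_measure torus_measure mh.
transitivity (\int[m]_x (profile (c / 2 * x))%:E)%E.
  rewrite ge0_integral_pushforward//.
  - apply: eq_integral => x _ /=; rewrite /h; congr ((profile _)%:E); by field.
  - exact: mF.
  - by move=> x _; rewrite lee_fin profile_ge0.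
transitivity (\int[torus_measure]_x (profile (c / 2 * x))%:E)%E.
  apply: eq_measure_integral => A mA _; apply: eq_measure_rays => // [|r].
    by rewrite /m/= /pushforward/= preimage_setT probability_setT ltry.
  exact: torus_dist_law.
rewrite ge0_integral_torus_measure//; last by move=> x; rewrite lee_fin profile_ge0.
have H := @ge0_integral_scale R (c / 2) 1 (fun x => (profile x)%:E) c20.
rewrite mulr1 in H.
have {}H := H (@measurable_profile_comp _ _ id (@measurable_id _ _ _))
  (fun x => profile_ge0 x).
rewrite EFinM /profile_mass fineK ?profile_mass_fin// H.
rewrite muleA -EFinM muleAC -EFinM (_ : 2 * (c / 2) / c = 1) ?mul1e//.
by field; rewrite gt_eqF.
Qed.

End profile.

(** * Expectations of bounded variables, and one vertex attaching *)

Section expectation_of_bounded.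
Context d (Omega : measurableType d) (R : realType) (P : probability Omega R).
Implicit Types X Y : Omega -> R.

(** Everything up to a fixed number of births is bounded, so expectations are kept
    real-valued. *)
Definition bounded_rv X := measurable_fun setT X /\ exists M, forall w, `|X w| <= M.

Definition Ex X : R := fine (\int[P]_w (X w)%:E)%E.

Lemma bounded_rv_cst c : bounded_rv (fun=> c).
Proof. by split=> //; exists `|c|. Qed.

Lemma bounded_rvD X Y : bounded_rv X -> bounded_rv Y ->
  bounded_rv (fun w => X w + Y w).
Proof.
move=> [mX [M bX]] [mY [N bY]]; split; first exact: measurable_funD.
by exists (M + N) => w; rewrite (le_trans (ler_normD _ _))// lerD.
Qed.

Lemma bounded_rvM X Y : bounded_rv X -> bounded_rv Y ->
  bounded_rv (fun w => X w * Y w).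
Proof.
move=> [mX [M bX]] [mY [N bY]]; split; first exact: measurable_funM.
by exists (M * N) => w; rewrite normrM ler_pM.
Qed.

Lemma bounded_rvZ c X : bounded_rv X -> bounded_rv (fun w => c * X w).
Proof. by move=> bX; apply: bounded_rvM => //; exact: bounded_rv_cst. Qed.

Lemma bounded_rvB X Y : bounded_rv X -> bounded_rv Y ->
  bounded_rv (fun w => X w - Y w).
Proof.
move=> bX bY; apply: bounded_rvD => //.
rewrite (_ : (fun w => - Y w) = (fun w => -1 * Y w)); first exact: bounded_rvZ.
by apply/funext => w; rewrite mulN1r.
Qed.

Lemma bounded_rvX X n : bounded_rv X -> bounded_rv (fun w => X w ^+ n).
Proof.
move=> bX; elim: n => [|n IH]; first exact: bounded_rv_cst.
by under eq_fun do rewrite exprS; exact: bounded_rvM.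
Qed.

Lemma bounded_rv_norm X : bounded_rv X -> bounded_rv (fun w => `|X w|).
Proof.
move=> [mX [M bX]]; split; first exact: measurableT_comp.
by exists M => w; rewrite normr_id.
Qed.

Lemma bounded_rv_sum (I : Type) (s : seq I) (Q : pred I) (X : I -> Omega -> R) :
  (forall i, Q i -> bounded_rv (X i)) -> bounded_rv (fun w => \sum_(i <- s | Q i) X i w).
Proof.
move=> bX; elim: s => [|i s IH].
  by under eq_fun do rewrite big_nil; exact: bounded_rv_cst.
under eq_fun do rewrite big_cons; case: (boolP (Q i)) => // Qi.
by apply: bounded_rvD => //; exact: bX.
Qed.

Lemma bounded_rv_prod (I : Type) (s : seq I) (Q : pred I) (X : I -> Omega -> R) :
  (forall i, Q i -> bounded_rv (X i)) -> bounded_rv (fun w => \prod_(i <- s | Q i) X i w).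
Proof.
move=> bX; elim: s => [|i s IH].
  by under eq_fun do rewrite big_nil; exact: bounded_rv_cst.
under eq_fun do rewrite big_cons; case: (boolP (Q i)) => // Qi.
by apply: bounded_rvM => //; exact: bX.
Qed.

Lemma bounded_rv_indic A : measurable A -> bounded_rv (\1_A).
Proof.
move=> mA; split; first exact: measurable_indic.
by exists 1 => w; rewrite indicE; case: (_ \in _); rewrite ?normr1 ?normr0.
Qed.

Lemma bounded_rv_bool (b : Omega -> bool) :
  measurable [set w | b w] -> bounded_rv (fun w => (b w)%:R).
Proof.
move=> mb; rewrite (_ : (fun w => _) = \1_[set w | b w]); first exact: bounded_rv_indic.
by apply/funext => w; rewrite indicE mem_setE.
Qed.

Lemma bounded_rv_integrable X : bounded_rv X -> P.-integrable setT (EFin \o X).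
Proof.
move=> [mX [M bX]]; apply: measurable_bounded_integrable => //.
  by rewrite -ge0_fin_numE// fin_num_measure.
exists M; split; first by rewrite num_real.
by move=> x Mx w _ /=; rewrite (le_trans (bX w))// ltW.
Qed.

Lemma Ex_EFin X : bounded_rv X -> ((Ex X)%:E = \int[P]_w (X w)%:E)%E.
Proof.
move=> /bounded_rv_integrable iX; rewrite /Ex fineK//.
exact: integrable_fin_num.
Qed.

Lemma eq_Ex X Y : X =1 Y -> Ex X = Ex Y.
Proof. by move=> XY; congr Ex; exact/funext. Qed.

Lemma ExD X Y : bounded_rv X -> bounded_rv Y -> Ex (fun w => X w + Y w) = Ex X + Ex Y.
Proof.
move=> bX bY; apply: EFin_inj.
rewrite EFinD !Ex_EFin//; last exact: bounded_rvD.
by rewrite -integralD//; exact: bounded_rv_integrable.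
Qed.

Lemma ExZ c X : bounded_rv X -> Ex (fun w => c * X w) = c * Ex X.
Proof.
move=> bX; apply: EFin_inj; rewrite EFinM !Ex_EFin//; last exact: bounded_rvZ.
by rewrite -integralZl//; exact: bounded_rv_integrable.
Qed.

Lemma Ex_cst c : Ex (fun=> c) = c.
Proof.
transitivity (fine (c%:E * P setT)%E); first by rewrite /Ex integral_cst.
by rewrite probability_setT mule1.
Qed.

Lemma Ex_sum (I : Type) (s : seq I) (X : I -> Omega -> R) :
  (forall i, bounded_rv (X i)) ->
  Ex (fun w => \sum_(i <- s) X i w) = \sum_(i <- s) Ex (X i).
Proof.
move=> bX; elim: s => [|i s IH].
  by rewrite big_nil; under eq_Ex do rewrite big_nil; rewrite Ex_cst.
rewrite big_cons; under eq_Ex do rewrite big_cons.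
by rewrite ExD ?IH//; apply: bounded_rv_sum.
Qed.

Lemma le_Ex X Y : bounded_rv X -> bounded_rv Y -> (forall w, X w <= Y w) ->
  Ex X <= Ex Y.
Proof.
move=> bX bY XY; rewrite -lee_fin !Ex_EFin//; apply: le_integral => //.
- exact: bounded_rv_integrable.
- exact: bounded_rv_integrable.
- by move=> w _; rewrite lee_fin.
Qed.

Lemma Ex_ge0 X : (forall w, 0 <= X w) -> 0 <= Ex X.
Proof. by move=> X0; apply: fine_ge0; apply: integral_ge0 => w _; rewrite lee_fin. Qed.

Lemma Ex_indic A : measurable A -> (Ex (\1_A))%:E = P A.
Proof.
by move=> mA; rewrite Ex_EFin ?integral_indic ?setIT//; exact: bounded_rv_indic.
Qed.

Lemma Ex_indicM A X : measurable A -> bounded_rv X ->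
  ((Ex (fun w => \1_A w * X w))%:E = \int[P]_(w in A) (X w)%:E)%E.
Proof.
move=> mA bX; rewrite Ex_EFin; last by apply: bounded_rvM => //; exact: bounded_rv_indic.
rewrite [RHS]integral_mkcond; apply: eq_integral => w _.
by rewrite patchE indicE; case: (w \in A); rewrite ?mul1r ?mul0r.
Qed.

Lemma markov_Ex X (c : R) : bounded_rv X -> (forall w, 0 <= X w) -> 0 < c ->
  (P [set w | (c <= X w)%R] <= (Ex X / c)%:E)%E.
Proof.
move=> bX X0 c0; have mA : measurable [set w | c <= X w].
  by apply: measurable_ler_set => //; case: bX.
rewrite -Ex_indic// lee_fin ler_pdivlMr// mulrC -ExZ; last exact: bounded_rv_indic.
apply: le_Ex => //; first exact/bounded_rvZ/bounded_rv_indic.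
move=> w; rewrite indicE; case: (boolP (w \in _)); last by rewrite mulr0.
by rewrite inE /= mulr1.
Qed.

End expectation_of_bounded.

(** Summing the weights of all the subsets of edges that contain [M] leaves the
    probability that the edges of [M] are present. *)
Lemma sum_bernoulli_weights (R : comNzRingType) n (M : {set 'I_n}) (q : 'I_n -> R) :
  \sum_(b : {ffun 'I_n -> bool} | [forall m in M, b m])
     \prod_(m < n) (if b m then q m else 1 - q m) = \prod_(m in M) q m.
Proof.
pose Q m : pred bool := fun c => (m \in M) ==> c.
rewrite (eq_bigl (fun b => b \in family Q)); last first.
  by move=> b; apply/idP/familyP => [/forallP h m|h]; [exact: h|apply/forallP].
rewrite -(bigA_distr_big_dep Q (fun m c => if c then q m else 1 - q m)).
rewrite [RHS]big_mkcond/=; apply: eq_bigr => m _.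
rewrite big_mkcond big_bool/= /Q /=.
by case: (m \in M) => /=; ring.
Qed.

Section attachment.
Context d (Omega : measurableType d) (R : realType) (P : probability Omega R).
Context (phi : R -> R) (f : nat -> R).
Context (V : nat -> Omega -> R * R) (E : nat -> nat -> Omega -> bool).
Hypothesis phi_range : forall x : R, 0 <= x -> 0 <= phi x <= 1.
Hypothesis phi_nonincreasing : forall x y : R, 0 <= x -> x <= y -> phi y <= phi x.
Hypothesis phi_integral :
  (\int[@lebesgue_measure R]_(x in `[0%R, +oo[) (phi x)%:E = (1 / 2)%:E)%E.
Hypothesis f_gt0 : forall k, 0 < f k.
Hypothesis model : is_spatial_pa P phi f V E.
Hypothesis V_lt : forall n w, (V n w).2 < (V n.+1 w).2.

Local Notation Ex := (Ex P).
Local Notation past n := (<<s past_gen V E n n >>).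

Let mV := spa_vertex_measurable model.
Let mE := spa_edge_measurable model.
Let V_gt0 n w : 0 < (V n w).2. Proof. by have [] := spa_vertex_domain model n w. Qed.

Lemma bounded_rv_edge_prob n m : bounded_rv (edge_prob phi f V E n m).
Proof.
split.
  by apply: measurable_edge_prob => //; exact: spa_vertex_domain model.
exists 1 => w; have /andP[q0 q1] := edge_prob_ge0_le1 phi_range f_gt0 E
  (spa_vertex_domain model) n m w.
by rewrite ger0_norm.
Qed.

Lemma history_measurable n A : history V E n A -> measurable A.
Proof.
apply: smallest_sub; first exact: sigma_algebra_measurable.
move=> B [[k [C [mC ->]]]|[i [j [jin ->]]]].
  by rewrite -[X in measurable X]setTI; exact: mV.
by apply: mE; case/andP: jin.
Qed.

(** The joint conditional law of the edges out of vertex n, marginalised to a set of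
    them. *)
Lemma Ex_edges n (M : {set 'I_n}) A : history V E n A ->
  Ex (fun w => \1_A w * \prod_(m in M) (E n m w)%:R) =
  Ex (fun w => \1_A w * \prod_(m in M) edge_prob phi f V E n m w).
Proof.
move=> hA; have mA := history_measurable hA.
pose row (b : {ffun 'I_n -> bool}) := [set w | forall m : 'I_n, E n m w = b m].
have mrow b : measurable (row b).
  rewrite (_ : row b = \bigcap_(m in [set: 'I_n]) [set w | E n m w = b m]).
    apply: fin_bigcap_measurable => // m _; case: (b m).
      by apply: mE.
    rewrite (_ : [set w | _] = ~` [set w | E n m w]).
      by apply: measurableC; apply: mE.
    by apply/seteqP; split=> w /=; [move=> ->|move=> /negP; exact: negbTE].
  by apply/seteqP; split=> w h m; [move=> _; exact: h|exact: h].
pose W (b : {ffun 'I_n -> bool}) w := \prod_(m < n)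
  (if b m then edge_prob phi f V E n m w else 1 - edge_prob phi f V E n m w).
have bW b : bounded_rv (W b).
  apply: bounded_rv_prod => m _; case: (b m); first exact: bounded_rv_edge_prob.
  by apply: bounded_rvB; [exact: bounded_rv_cst|exact: bounded_rv_edge_prob].
have rowE b : Ex (\1_(A `&` row b)) = Ex (fun w => \1_A w * W b w).
  apply: EFin_inj; rewrite Ex_indicM// Ex_indic; last exact: measurableI.
  exact: (spa_attachment model b hA).
transitivity (\sum_(b : {ffun 'I_n -> bool} | [forall m in M, b m]) Ex (\1_(A `&` row b))).
  rewrite -big_filter -Ex_sum; last first.
    by move=> b; apply: bounded_rv_indic; exact: measurableI.
  apply: eq_Ex => w; rewrite big_filter.
  pose b0 := [ffun m : 'I_n => E n m w].
  have rowb0 b : (w \in row b) = (b == b0).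
    apply/idP/eqP; rewrite inE.
      by move=> h; apply/ffunP => m; rewrite ffunE h.
    by move=> -> m; rewrite ffunE.
  rewrite (eq_bigr (fun b => \1_A w * (b == b0)%:R)); last first.
    by move=> b _; rewrite !indicE in_setI rowb0 -mulnb natrM.
  rewrite -mulr_sumr; congr (_ * _).
  rewrite (eq_bigr (fun b : {ffun 'I_n -> bool} => if b == b0 then 1 else 0)); last first.
    by move=> b _; case: eqP.
  rewrite -big_mkcondr/=.
  have [h|h] := boolP [forall m in M, b0 m].
    rewrite (big_pred1 b0); last first.
      by move=> b /=; apply/andP/eqP => [[_ /eqP]|->].
    rewrite big1// => m mM; move/forallP : h => /(_ m); rewrite mM/= ffunE.
    by move=> ->.
  rewrite [RHS]big_pred0; last first.
    by move=> b /=; case: (eqVneq b b0) => [->|]; rewrite ?andbF// (negbTE h).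
  move: h; rewrite negb_forall => /existsP[m]; rewrite negb_imply ffunE => /andP[mM Em].
  by rewrite (bigD1 m)//= (negbTE Em) mul0r.
rewrite (eq_bigr (fun b => Ex (fun w => \1_A w * W b w))); last by move=> b _.
rewrite -big_filter -Ex_sum; last first.
  by move=> b; apply: bounded_rvM => //; exact: bounded_rv_indic.
apply: eq_Ex => w; rewrite big_filter -mulr_sumr; congr (_ * _).
exact: sum_bernoulli_weights.
Qed.

Lemma past_sub_history n A : past n A -> history V E n A.
Proof.
move=> pA; have := @past_history _ _ _ V E n n A setT (leqnn n) measurableT pA.
by rewrite (_ : [set w | _] = setT) ?setIT//; apply/seteqP; split.
Qed.

Lemma past_degree_set n m k : past n [set w | degree E m n w = k].
Proof.
by have := @past_degree _ _ _ V E n n m n (leqnn n) measurableT [set k] I; rewrite setTI.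
Qed.

Lemma past_setI n A B : past n A -> past n B -> past n (A `&` B).
Proof. exact: (@measurableI _ (g_sigma_algebraType (past_gen V E n n))). Qed.

Lemma past_measurable_set n A : past n A -> measurable A.
Proof. by move=> pA; exact: (past_measurable model pA). Qed.

(** The probability that a vertex born at time t attaches to a given older vertex
    of degree k, averaged over its uniform position. *)
Definition attachment_rate (k : nat) (t : R) : R :=
  profile_mass phi (t / f k) / (t / f k).

Lemma attachment_rate_ge0 k t : 0 < t -> 0 <= attachment_rate k t.
Proof. by move=> t0; rewrite divr_ge0 ?profile_mass_ge0// divr_ge0// ltW. Qed.

Lemma attachment_rate_le k t : 0 < t -> attachment_rate k t <= f k / t.
Proof.
move=> t0; rewrite /attachment_rate invf_div ler_piMl//; last exact: profile_mass_le1.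
by rewrite divr_ge0// ltW.
Qed.

Lemma attachment_rate_le1 k t : 0 < t -> attachment_rate k t <= 1.
Proof.
move=> t0; have c0 : 0 < t / f k by rewrite divr_gt0.
have y01 : 0 <= (0 : R) < 1 by rewrite lexx ltr01.
have H := profile_mean phi_range phi_nonincreasing phi_integral c0 y01.
rewrite -lee_fin /attachment_rate -H.
apply: (@le_trans _ _ (\int[@torus_measure R]_x (cst 1%:E x))%E).
  apply: ge0_le_integral => //.
  - by move=> x _; rewrite lee_fin profile_ge0.
  - apply: measurable_profile_comp => //; apply: measurable_funM => //.
    by apply: measurable_torus_dist.
  - by move=> x _; rewrite lee_fin; have /andP[] := profile_ge0_le1 phi_range (t / f k * torus_dist x 0).
by rewrite integral_cst// mul1e; exact: probability_le1.
Qed.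

Lemma measurable_attachment_rate d' (T : measurableType d') k (t : T -> R) :
  measurable_fun setT t -> (forall w, 0 < t w) ->
  measurable_fun setT (fun w => attachment_rate k (t w)).
Proof.
move=> mt t0; rewrite /attachment_rate.
have mc : measurable_fun setT (fun w => t w / f k) by exact: measurable_funM.
apply: measurable_funM.
  apply: (@measurableT_comp _ _ _ _ _ _ (profile_mass phi)) => //.
  by apply: nondecreasing_measurable => // x y; exact: profile_mass_nondecreasing.
under eq_fun do rewrite -[X in X^-1]lnK ?posrE ?divr_gt0// -expRN.
apply: measurableT_comp; first exact: measurable_expR.
apply: measurableT_comp; first exact: oppr_measurable.
by apply: measurableT_comp mc; exact: measurable_ln.
Qed.

Lemma bounded_rv_attachment_rate k n :
  bounded_rv (fun w => attachment_rate k (V n w).2).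
Proof.
split.
  by apply: measurable_attachment_rate => //; exact: measurable_birth.
exists 1 => w; rewrite ger0_norm; first exact: attachment_rate_le1.
exact: attachment_rate_ge0.
Qed.

(** Given the past, the edge from n to m has probability the profile at the distance
    of their positions; the position of n is uniform and independent of the
    past, and integrating over it gives a rate that depends on the degree of m
    and on the birth time only. *)
Lemma Ex_edge n m k A : past n A -> (m < n)%N ->
  Ex (fun w => \1_A w * ((degree E m n w == k) && E n m w)%:R) =
  Ex (fun w => \1_A w * (degree E m n w == k)%:R * attachment_rate k (V n w).2).
Proof.
move=> pA mn; pose B := A `&` [set w | degree E m n w = k].
have pB : past n B by apply: past_setI => //; exact: past_degree_set.
have mB := past_measurable_set pB.
have indB w : \1_B w = \1_A w * (degree E m n w == k)%:R :> R.
  rewrite !indicE in_setI -mulnb natrM; congr (_ * (nat_of_bool _)%:R).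
  by apply/idP/eqP; rewrite inE.
have := Ex_edges [set Ordinal mn] (past_sub_history pB).
under eq_Ex do rewrite big_set1 indB -mulrA -natrM mulnb.
move=> ->; under [RHS]eq_Ex do rewrite -indB.
under eq_Ex do rewrite big_set1.
apply: EFin_inj.
have rate01 w : 0 <= attachment_rate k (V n w).2 by exact: attachment_rate_ge0.
pose H (z : g_sigma_algebraType (past_gen V E n n) * R) : \bar R :=
  ((\1_B z.1)%:E * (profile phi ((V n z.1).2 / f k * torus_dist z.2 (V m z.1).1))%:E)%E.
have mb : measurable_fun (setT : set (g_sigma_algebraType (past_gen V E n n)))
    (fun w => (V n w).2) by exact: past_birth.
have mp : measurable_fun (setT : set (g_sigma_algebraType (past_gen V E n n)))
    (fun w => (V m w).1) by exact: past_position.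
have mfst := @measurable_fst _ _ (g_sigma_algebraType (past_gen V E n n)) R.
have mH : measurable_fun setT H.
  apply: emeasurable_funM.
    apply/measurable_EFinP; apply: measurableT_comp mfst.
    exact: (@measurable_indic _ (g_sigma_algebraType (past_gen V E n n)) R setT B pB).
  apply: (@measurable_profile_comp _ phi phi_nonincreasing) => //.
  apply: measurable_funM.
    apply: measurable_funM => //.
    exact: (measurableT_comp mb mfst).
  apply: measurable_torus_dist; first exact: measurable_snd.
  exact: (measurableT_comp mp mfst).
  have H0 z : (0 <= H z)%E by rewrite mule_ge0// lee_fin ?profile_ge0.
have HE := past_integral model (fun I B mI pB' =>
  past_uniform phi_range phi_nonincreasing f_gt0 model V_lt (leqnn n) mI pB') mH H0.
have dom i w := spa_vertex_domain model i w.
rewrite Ex_EFin; last first.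
  by apply: bounded_rvM; [exact: bounded_rv_indic|exact: bounded_rv_edge_prob].
transitivity (\int[P]_w H (w, (V n w).1))%E.
  apply: eq_integral => w _; rewrite /H/= EFinM.
  have [wB|] := boolP (w \in B); last first.
    by rewrite indicE => /negbTE ->; rewrite !mul0e.
  congr (_ * _)%E; rewrite edge_probE// profileE.
    move: wB; rewrite inE => -[_ /= ->].
    by congr ((phi _)%:E); rewrite mulrAC.
  rewrite mulr_ge0//; first by rewrite divr_ge0// ltW.
  by apply: torus_dist_ge0; case: (dom n w) => //; case: (dom m w).
rewrite HE Ex_EFin.
  apply: eq_integral => w _; rewrite /H/= EFinM.
  rewrite ge0_integralZl//.
  - have [y01 _] := dom m w; rewrite (profile_mean phi_range)//.
    by rewrite divr_gt0.
  - apply: measurable_profile_comp => //; apply: measurable_funM => //.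
    by apply: measurable_torus_dist.
  - by move=> x _; rewrite lee_fin profile_ge0.
by apply: bounded_rvM; [exact: bounded_rv_indic|exact: bounded_rv_attachment_rate].
Qed.

Lemma torus_dist_sym (x y : R) : torus_dist x y = torus_dist y x.
Proof. by rewrite /torus_dist distrC. Qed.

(** The distances of vertex n to two older vertices are independent: given the
    position of n, those of m and m' are independent and uniform, and the law of
    the distance of a uniform point to the position of n does not depend on it. *)
Lemma uniform_pair n m m' c : (m < m')%N -> (m' < n)%N -> 0 < c ->
  (\int[P]_w (profile phi (c * torus_dist (V n w).1 (V m w).1) *
              profile phi (c * torus_dist (V n w).1 (V m' w).1))%:E =
   ((profile_mass phi c / c) ^+ 2)%:E)%E.
Proof.
move=> mm' m'n c0; have mn := ltn_trans mm' m'n.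
have dom i w := spa_vertex_domain model i w.
have unif i := fun I B mI pB =>
  @past_uniform _ _ _ P phi f V E phi_range phi_nonincreasing f_gt0 model V_lt i i I B (leqnn i) mI pB.
have mprof d' (T : measurableType d') (a b : T -> R) :
    measurable_fun setT a -> measurable_fun setT b ->
    measurable_fun setT (fun w => (profile phi (c * torus_dist (a w) (b w)))%:E).
  move=> ma mb; apply: measurable_profile_comp => //.
  by apply: measurable_funM => //; exact: measurable_torus_dist.
have mpos i j : (i < j)%N -> measurable_fun (setT : set (g_sigma_algebraType (past_gen V E j j)))
    (fun w => (V i w).1) by exact: past_position.
pose H1 (z : g_sigma_algebraType (past_gen V E n n) * R) : \bar R :=
  ((profile phi (c * torus_dist z.2 (V m z.1).1))%:E *
   (profile phi (c * torus_dist z.2 (V m' z.1).1))%:E)%E.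
have mfst j := @measurable_fst _ _ (g_sigma_algebraType (past_gen V E j j)) R.
have msnd j := @measurable_snd _ _ (g_sigma_algebraType (past_gen V E j j)) R.
have mH1 : measurable_fun setT H1.
  apply: emeasurable_funM; apply: mprof => //.
    exact: (measurableT_comp (mpos _ _ mn) (mfst n)).
  exact: (measurableT_comp (mpos _ _ m'n) (mfst n)).
have H10 z : (0 <= H1 z)%E by rewrite mule_ge0// lee_fin ?profile_ge0.
transitivity (\int[P]_w H1 (w, (V n w).1))%E; first by apply: eq_integral.
rewrite (past_integral model (unif n) mH1 H10).
pose F (z : (R * R) * R) : \bar R :=
  ((profile phi (c * torus_dist z.2 z.1.1))%:E * (profile phi (c * torus_dist z.2 z.1.2))%:E)%E.
have mF : measurable_fun setT F.
  by apply: emeasurable_funM; apply: mprof => //; apply: measurableT_comp => //.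
have F0 z : (0 <= F z)%E by rewrite mule_ge0// lee_fin ?profile_ge0.
pose K := fubini_F (@torus_measure R) F.
have mK : measurable_fun setT K by exact: measurable_fun_fubini_tonelli_F.
have K0 a : (0 <= K a)%E by apply: integral_ge0.
pose H2 (z : g_sigma_algebraType (past_gen V E m' m') * R) : \bar R :=
  K ((V m z.1).1, z.2).
have mH2 : measurable_fun setT H2.
  apply: (measurableT_comp mK); apply: measurable_fun_pair => //.
  exact: (measurableT_comp (mpos _ _ mm') (mfst m')).
transitivity (\int[P]_w H2 (w, (V m' w).1))%E; first by apply: eq_integral.
rewrite (past_integral model (unif m') mH2 (fun z => K0 _)).
transitivity (\int[P]_w (((profile_mass phi c / c) ^+ 2)%:E))%E; last first.
  by rewrite integral_cst//; rewrite [X in (_ * X)%E](@probability_setT _ _ _ P) mule1.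
apply: eq_integral => w _; rewrite /H2/=; set a := (V m w).1.
have [a01 _] := dom m w; rewrite -/a in a01.
have ma : measurable_fun setT (fun z : R * R => F ((a, z.1), z.2)).
  by apply: (measurableT_comp mF); apply: measurable_fun_pair => //; apply: measurable_fun_pair.
transitivity (\int[@torus_measure R]_y \int[@torus_measure R]_x F ((a, y), x))%E; first by [].
rewrite (@fubini_tonelli _ _ _ _ _ torus_measure torus_measure (fun z : R * R => F ((a, z.1), z.2)))//=.
have mG := @measurable_fun_fubini_tonelli_G _ _ _ _ _ (@torus_measure R)
  (fun z : R * R => F ((a, z.1), z.2)) ma (fun=> F0 _).
have ma' : measurable_fun setT (fun x => (profile phi (c * torus_dist x a))%:E) by exact: mprof.
rewrite ge0_integral_torus_measure//; last by move=> x; exact: integral_ge0.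
transitivity (\int[lebesgue_measure]_(x in `[0%R, 1%R[%classic)
    ((profile phi (c * torus_dist x a))%:E * (profile_mass phi c / c)%:E))%E.
  apply: eq_integral => x; rewrite inE/= in_itv/= => x01.
  rewrite /F/= ge0_integralZl//.
  - congr (_ * _)%E; rewrite -(profile_mean phi_range phi_nonincreasing phi_integral c0 x01).
    by apply: eq_integral => y _; rewrite torus_dist_sym.
  - exact: mprof.
  - by move=> y _; rewrite lee_fin profile_ge0.
  - by rewrite lee_fin profile_ge0.
rewrite -ge0_integral_torus_measure//; last 2 first.
- exact: emeasurable_funM.
- move=> x; rewrite mule_ge0// lee_fin ?profile_ge0//.
  by rewrite divr_ge0 ?profile_mass_ge0// ltW.
rewrite ge0_integralZr//; last 2 first.
- by move=> x _; rewrite lee_fin profile_ge0.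
- by rewrite lee_fin divr_ge0 ?profile_mass_ge0// ltW.
by rewrite (profile_mean phi_range).
Qed.

End attachment.

(** * Evolution of the tail counts in one step *)

Section tail_counts.
Context (Omega : Type) (E : nat -> nat -> Omega -> bool).

Definition tail_count k n (w : Omega) : nat := \sum_(m < n) (k <= degree E m n w)%N.

(** The number of vertices whose degree passes from k to k+1 at the arrival of
    vertex n. *)
Definition new_edges k n (w : Omega) : nat :=
  \sum_(m < n) ((degree E m n w == k) && E n m w).

Lemma degreeS m n w : (m < n)%N -> degree E m n.+1 w = (degree E m n w + E n m w)%N.
Proof. by move=> mn; rewrite /degree big_nat_recr. Qed.

Lemma degree_new n w : degree E n n.+1 w = 0%N.
Proof. by rewrite /degree big_geq. Qed.

Lemma degree_le m n w : (degree E m n w <= n)%N.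
Proof.
rewrite /degree; apply: (@leq_trans (\sum_(m.+1 <= i < n) 1)).
  by apply: leq_sum => i _; case: (E i m w).
by rewrite sum_nat_const_nat muln1 leq_subr.
Qed.

Lemma tail_count0 n w : tail_count 0 n w = n.
Proof. by rewrite /tail_count sum_nat_const card_ord muln1. Qed.

Lemma tail_countS k n w :
  tail_count k.+1 n.+1 w = (tail_count k.+1 n w + new_edges k n w)%N.
Proof.
rewrite /tail_count /new_edges big_ord_recr/= degree_new addn0 -big_split/=.
apply: eq_bigr => m _; rewrite degreeS//.
by case: (E n m w); case: (ltngtP (degree E m n w) k) => /= h; lia.
Qed.

Lemma tail_count_le k n w : (tail_count k n w <= n)%N.
Proof.
rewrite /tail_count; apply: (@leq_trans (\sum_(m < n) 1)).
  by apply: leq_sum => i _; exact: leq_b1.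
by rewrite sum_nat_const card_ord muln1.
Qed.

Lemma tail_count_nonincreasing k n w : (tail_count k.+1 n w <= tail_count k n w)%N.
Proof.
by apply: leq_sum => m _; case: leqP => // h; rewrite (ltnW h).
Qed.

Lemma tail_count_eq0 k n w : (n < k)%N -> tail_count k n w = 0%N.
Proof.
move=> nk; rewrite /tail_count big1// => m _.
by rewrite leqNgt (leq_ltn_trans (degree_le m n w) nk).
Qed.

Lemma tail_count_mono k n w : (tail_count k n w <= tail_count k n.+1 w)%N.
Proof. by case: k => [|k]; rewrite ?tail_count0// tail_countS leq_addr. Qed.

Lemma degree_count (R : numDomainType) k n w :
  \sum_(m < n) (degree E m n w == k)%:R =
  (tail_count k n w)%:R - (tail_count k.+1 n w)%:R :> R.
Proof.
apply/eqP; rewrite eq_sym subr_eq -natr_sum -natrD -big_split/= eqr_nat.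
apply/eqP; apply: eq_bigr => m _.
by case: (ltngtP (degree E m n w) k).
Qed.

End tail_counts.

(** Young's inequality, with weights chosen so that the factors 1 + 1/n multiply
    to order n over n steps. *)
Lemma sqrD_le (R : realFieldType) (a b n : R) : 0 < n ->
  (a + b) ^+ 2 <= (1 + n^-1) * a ^+ 2 + (1 + n) * b ^+ 2.
Proof.
move=> n0; rewrite -subr_ge0 (_ : _ - _ = n^-1 * (a - n * b) ^+ 2).
  by rewrite mulr_ge0 ?sqr_ge0// invr_ge0 ltW.
by field; rewrite gt_eqF.
Qed.

Section one_step.
Context d (Omega : measurableType d) (R : realType) (P : probability Omega R).
Context (phi : R -> R) (f : nat -> R).
Context (V : nat -> Omega -> R * R) (E : nat -> nat -> Omega -> bool).
Hypothesis phi_range : forall x : R, 0 <= x -> 0 <= phi x <= 1.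
Hypothesis phi_nonincreasing : forall x y : R, 0 <= x -> x <= y -> phi y <= phi x.
Hypothesis phi_integral :
  (\int[@lebesgue_measure R]_(x in `[0%R, +oo[) (phi x)%:E = (1 / 2)%:E)%E.
Hypothesis f_gt0 : forall k, 0 < f k.
Hypothesis model : is_spatial_pa P phi f V E.
Hypothesis V_lt : forall n w, (V n w).2 < (V n.+1 w).2.

Local Notation Ex := (Ex P).
Local Notation past n := (<<s past_gen V E n n >>).
Local Notation Past n := (g_sigma_algebraType (past_gen V E n n)).
Local Notation rate := (attachment_rate phi f).
Local Notation S k n w := ((tail_count E k n w)%:R : R).
Local Notation J k n w := ((new_edges E k n w)%:R : R).

Let V_gt0 n w : 0 < (V n w).2. Proof. by have [] := spa_vertex_domain model n w. Qed.

Let brate k n := bounded_rv_attachment_rate phi_range phi_nonincreasing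
  phi_integral f_gt0 model k n.

Lemma past_tail_count k n : measurable_fun (setT : set (Past n)) (tail_count E k n).
Proof.
have H p : measurable_fun (setT : set (Past n))
    (fun w => \sum_(m < p) (k <= degree E m n w)%N)%N.
  elim: p => [|p IH].
    by under eq_fun do rewrite big_ord0; exact: measurable_cst.
  under eq_fun do rewrite big_ord_recr/=.
  apply: measurable_fun_addn => //; apply: measurable_bool_nat.
  apply: measurable_fun_leq; first exact: measurable_cst.
  exact: past_degree.
exact: (H n).
Qed.

Lemma past_tail_count_set k n j : past n [set w | tail_count E k n w = j].
Proof.
by have := @past_tail_count k n measurableT [set j] I; rewrite setTI.
Qed.

Let mset A n : past n A -> measurable A.
Proof. exact: (past_measurable_set model). Qed.

Let mdeg n m k : measurable [set w | degree E m n w == k].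
Proof.
rewrite (_ : [set w | _] = [set w | degree E m n w = k]); first by
  have h : past n [set w | degree E m n w = k] by [exact: past_degree_set]; exact: (mset h).
by apply/seteqP; split=> w /eqP.
Qed.

Lemma bounded_rv_new_edge n m k : (m < n)%N ->
  bounded_rv (fun w => ((degree E m n w == k) && E n m w)%:R : R).
Proof.
move=> mn; apply: bounded_rv_bool.
rewrite (_ : [set w | _] = [set w | degree E m n w == k] `&` [set w | E n m w]).
  by apply: measurableI => //; apply: (spa_edge_measurable model).
by apply/seteqP; split=> w /= => [/andP[]|[-> ->]].
Qed.

Lemma bounded_rv_new_edges k n : bounded_rv (fun w => J k n w).
Proof.
rewrite /new_edges; under eq_fun do rewrite natr_sum.
by apply: bounded_rv_sum => m _; exact: bounded_rv_new_edge.
Qed.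

Lemma bounded_rv_tail_count k n : bounded_rv (fun w => S k n w).
Proof.
rewrite /tail_count; under eq_fun do rewrite natr_sum.
apply: bounded_rv_sum => m _; apply: bounded_rv_bool.
rewrite (_ : [set w | _] = ~` \bigcup_(j in `I_k) [set w | degree E m n w == j]).
  apply: measurableC; apply: bigcup_measurable => j _; exact: mdeg.
apply/seteqP; split=> w /=.
  by move=> kd [j /= jk /eqP dj]; move: kd; rewrite dj leqNgt jk.
by move=> h; rewrite leqNgt; apply/negP => dk; apply: h; exists (degree E m n w) => /=.
Qed.

(** Summing [Ex_edge] over the vertices of degree k; the factor [h] is a function of
    the past, which is split according to the value of the tail count. *)
Lemma Ex_new_edges k n (h : nat -> R) A : past n A ->
  Ex (fun w => \1_A w * h (tail_count E k.+1 n w) * J k n w) =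
  Ex (fun w => \1_A w * h (tail_count E k.+1 n w) *
               (rate k (V n w).2 * (S k n w - S k.+1 n w))).
Proof.
move=> pA.
pose B (j : 'I_n.+1) := A `&` [set w | tail_count E k.+1 n w = j].
have pB j : past n (B j) by apply: past_setI => //; exact: past_tail_count_set.
have bB j : bounded_rv (\1_(B j) : Omega -> R) by apply: bounded_rv_indic; exact: mset (pB j).
have hE w : \1_A w * h (tail_count E k.+1 n w) = \sum_(j < n.+1) h j * \1_(B j) w.
  have BE j : \1_(B j) w = \1_A w * (tail_count E k.+1 n w == j)%:R :> R.
    rewrite !indicE in_setI -mulnb natrM; congr (_ * (nat_of_bool _)%:R).
    by apply/idP/eqP; rewrite inE.
  have tn : (tail_count E k.+1 n w < n.+1)%N by rewrite ltnS tail_count_le.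
  rewrite (bigD1 (Ordinal tn))//= big1 ?addr0 => [|j jne].
    by rewrite BE eqxx mulr1 mulrC.
  rewrite BE [_ == _](_ : _ = false) ?mulr0//; apply/negbTE.
  by apply: contra jne => /eqP Ej; apply/eqP/val_inj.
have bdeg (m : 'I_n) : bounded_rv (fun w => (degree E m n w == k)%:R : R).
  exact: bounded_rv_bool.
under eq_Ex do rewrite hE mulr_suml.
under [RHS]eq_Ex do rewrite hE mulr_suml.
rewrite !Ex_sum; first last.
- move=> j; apply: bounded_rvM; last exact: bounded_rv_new_edges.
  exact: bounded_rvZ.
- move=> j; apply: bounded_rvM; first exact: bounded_rvZ.
  by apply: bounded_rvM => //; apply: bounded_rvB; exact: bounded_rv_tail_count.
apply: eq_bigr => j _.
transitivity (Ex (fun w => \sum_(m < n) h j *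
    (\1_(B j) w * ((degree E m n w == k) && E n m w)%:R))).
  by apply: eq_Ex => w; rewrite /new_edges natr_sum mulr_sumr; apply: eq_bigr => m _; rewrite mulrA.
transitivity (Ex (fun w => \sum_(m < n) h j *
    (\1_(B j) w * (degree E m n w == k)%:R * rate k (V n w).2))); last first.
  apply: eq_Ex => w; rewrite -degree_count !mulr_sumr.
  by apply: eq_bigr => m _; ring.
rewrite !Ex_sum; first last.
- by move=> m; apply: bounded_rvZ; apply: bounded_rvM => //; exact: bounded_rv_new_edge.
- by move=> m; apply: bounded_rvZ; apply: bounded_rvM => //; apply: bounded_rvM.
apply: eq_bigr => m _; rewrite !ExZ.
- by congr (_ * _); apply: Ex_edge.
- by apply: bounded_rvM => //; apply: bounded_rvM.
- by apply: bounded_rvM => //; exact: bounded_rv_new_edge.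
Qed.

Lemma Ex_new_edge_le n m k A t0 : past n A -> (m < n)%N -> 0 < t0 ->
  (forall w, A w -> t0 <= (V n w).2) ->
  Ex (fun w => \1_A w * ((degree E m n w == k) && E n m w)%:R) <= f k / t0.
Proof.
move=> pA mn t00 At0; rewrite (Ex_edge phi_range phi_nonincreasing phi_integral f_gt0 model V_lt k pA mn).
have bA : bounded_rv (\1_A : Omega -> R) by apply: bounded_rv_indic; exact: mset pA.
rewrite -[leRHS](Ex_cst P); apply: le_Ex; [|exact: bounded_rv_cst|].
  apply: bounded_rvM; last exact: brate.
  by apply: bounded_rvM => //; exact: bounded_rv_bool.
move=> w; have r0 : 0 <= f k / t0 by rewrite divr_ge0// ltW.
rewrite indicE; have [|_] := boolP (w \in A); last by rewrite !mul0r.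
rewrite inE => Aw; rewrite mul1r; case: eqP => _; last by rewrite mul0r.
rewrite mul1r (le_trans (attachment_rate_le phi_range phi_nonincreasing phi_integral _ _ _))//.
by rewrite ler_pM2l// lef_pV2 ?posrE// At0.
Qed.

(** Given the points and the older edges, the two edges are independent, but their
    probabilities both depend on the position of vertex n. They are bounded by replacing the degrees
    and the birth time by constants, and dropping the restriction to [A] and to the
    degrees; then only three independent uniform positions are left. *)
Lemma Ex_new_edge_pair_le n m m' k A t0 : past n A -> (m < m')%N -> (m' < n)%N ->
  0 < t0 -> (forall w, A w -> t0 <= (V n w).2) ->
  Ex (fun w => \1_A w * (((degree E m n w == k) && E n m w)%:R *
                         ((degree E m' n w == k) && E n m' w)%:R)) <= (f k / t0) ^+ 2.
Proof.
move=> pA mm' m'n t00 At0; have mn := ltn_trans mm' m'n.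
pose B := A `&` [set w | degree E m n w = k] `&` [set w | degree E m' n w = k].
have pB : past n B by do 2 (apply: past_setI; last exact: past_degree_set).
pose i : 'I_n := Ordinal mn; pose i' : 'I_n := Ordinal m'n.
have ii' : i != i' by rewrite -val_eqE/= neq_ltn mm'.
have bE j (jn : (j < n)%N) := bounded_rv_edge_prob phi_range phi_nonincreasing f_gt0 model n j.
have bA (C : set Omega) : past n C -> bounded_rv (\1_C : Omega -> R).
  by move=> pC; apply: bounded_rv_indic; exact: (mset pC).
have prodE (a : 'I_n -> R) : \prod_(j in [set i; i']%SET) a j = a i * a i'.
  by rewrite big_setU1 ?big_set1//= inE.
have -> : Ex (fun w => \1_A w * (((degree E m n w == k) && E n m w)%:R *
                         ((degree E m' n w == k) && E n m' w)%:R)) =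
    Ex (fun w => \1_B w * \prod_(j in [set i; i']%SET) (E n j w)%:R).
  apply: eq_Ex => w; rewrite prodE/= !indicE !in_setI.
  have eqE (j : nat) : (w \in [set w | degree E j n w = k]) = (degree E j n w == k).
    by apply/idP/eqP; rewrite inE.
  rewrite !eqE -!natrM !mulnb; congr (nat_of_bool _)%:R.
  by rewrite -!andbA; do !bool_congr.
rewrite (Ex_edges phi_range phi_nonincreasing f_gt0 model _ (past_sub_history pB)).
pose c := t0 / f k; have c0 : 0 < c by rewrite divr_gt0.
pose psi (j : nat) w := profile phi (c * torus_dist (V n w).1 (V j w).1).
have bpsi j : bounded_rv (psi j).
  split.
    apply/measurable_EFinP; apply: measurable_profile_comp => //.
    apply: measurable_funM => //; apply: measurable_torus_dist;
      exact: (measurable_position (spa_vertex_measurable model)).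
  exists 1 => w; have /andP[p0 p1] := profile_ge0_le1 phi_range
    (c * torus_dist (V n w).1 (V j w).1).
  by rewrite ger0_norm.
apply: (@le_trans _ _ (Ex (fun w => psi m w * psi m' w))).
  apply: le_Ex.
  - apply: bounded_rvM; first exact: bA.
    by apply: bounded_rv_prod => j _; exact: bE.
  - exact: bounded_rvM.
  move=> w; rewrite prodE/= indicE; have [|_] := boolP (w \in B); last first.
    by rewrite mul0r mulr_ge0// profile_ge0.
  rewrite inE mul1r => -[[Aw /= dm] dm'].
  have dom j := spa_vertex_domain model j w.
  have edge_le j : degree E j n w = k -> edge_prob phi f V E n j w <= psi j w.
    move=> dj; have [xn _] := dom n; have [xj _] := dom j.
    have td := torus_dist_ge0 xn xj.
    rewrite edge_probE// dj /psi profileE; last by rewrite mulr_ge0// ltW.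
    apply: phi_nonincreasing; first by rewrite mulr_ge0// ltW.
    by rewrite /c [leRHS]mulrAC ler_wpM2r// ler_pM2r ?invr_gt0// At0.
  have e0 j : 0 <= edge_prob phi f V E n j w.
    by have /andP[] := edge_prob_ge0_le1 phi_range f_gt0 E (spa_vertex_domain model) n j w.
  by apply: ler_pM => //; exact: edge_le.
have -> : Ex (fun w => psi m w * psi m' w) = (profile_mass phi c / c) ^+ 2.
  apply: EFin_inj; rewrite Ex_EFin; last exact: bounded_rvM.
  exact: (uniform_pair phi_range phi_nonincreasing phi_integral f_gt0 model V_lt mm' m'n c0).
have rk := attachment_rate_le phi_range phi_nonincreasing phi_integral f_gt0 k t00.
rewrite lerXn2r// ?nnegrE ?divr_ge0 ?profile_mass_ge0// ltW//.
Qed.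

(** Expanding the square, the diagonal gives the first term and the pairs of distinct
    vertices the second one. *)
Lemma Ex_new_edges_sqr k n A t0 : past n A -> 0 < t0 ->
  (forall w, A w -> t0 <= (V n w).2) ->
  Ex (fun w => \1_A w * J k n w ^+ 2) <= n%:R * (f k / t0) + (n%:R * (f k / t0)) ^+ 2.
Proof.
move=> pA t00 At0; set q := f k / t0.
have q0 : 0 <= q by rewrite divr_ge0// ltW.
have bA : bounded_rv (\1_A : Omega -> R) by apply: bounded_rv_indic; exact: (mset pA).
pose a (m : 'I_n) w : R := ((degree E m n w == k) && E n m w)%:R.
have ba m : bounded_rv (a m) by exact: bounded_rv_new_edge.
have aa (m : 'I_n) w : a m w * a m w = a m w.
  by rewrite /a; case: (_ && _); rewrite ?mulr1 ?mulr0.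
have pairE m m' : Ex (fun w => \1_A w * (a m w * a m' w)) <= (m == m')%:R * q + q ^+ 2.
  case: (ltngtP m m') => [mm'|mm'|/val_inj<-].
  - apply: (le_trans (Ex_new_edge_pair_le k pA mm' (ltn_ord m') t00 At0)).
    by rewrite lerDr mulr_ge0.
  - under eq_Ex do rewrite (mulrC (a m _)).
    apply: (le_trans (Ex_new_edge_pair_le k pA mm' (ltn_ord m) t00 At0)).
    by rewrite lerDr mulr_ge0.
  - under eq_Ex do rewrite aa; rewrite eqxx mul1r.
    apply: (le_trans (Ex_new_edge_le k pA (ltn_ord m) t00 At0)).
    by rewrite lerDl sqr_ge0.
have -> : Ex (fun w => \1_A w * J k n w ^+ 2) =
    \sum_(m < n) \sum_(m' < n) Ex (fun w => \1_A w * (a m w * a m' w)).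
  transitivity (Ex (fun w => \sum_(m < n) \sum_(m' < n) \1_A w * (a m w * a m' w))).
    apply: eq_Ex => w; rewrite /new_edges natr_sum expr2 mulr_suml mulr_sumr.
    by apply: eq_bigr => m _; rewrite mulr_sumr mulr_sumr.
  rewrite Ex_sum; last first.
    by move=> m; apply: bounded_rv_sum => m' _; apply: bounded_rvM => //; exact: bounded_rvM.
  apply: eq_bigr => m _; rewrite Ex_sum// => m'.
  by apply: bounded_rvM => //; exact: bounded_rvM.
apply: (@le_trans _ _ (\sum_(m < n) \sum_(m' < n) ((m == m')%:R * q + q ^+ 2))).
  by apply: ler_sum => m _; apply: ler_sum => m' _.
rewrite (eq_bigr (fun=> q + n%:R * q ^+ 2)).
  rewrite sumr_const card_ord -[X in X <= _]mulr_natl le_eqVlt; apply/orP; left.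
  by apply/eqP; ring.
move=> m _; rewrite big_split/= sumr_const card_ord mulr_natl; congr (_ + _).
rewrite (bigD1 m)//= eqxx mul1r big1 ?addr0// => m' m'm.
by rewrite eq_sym (negbTE m'm) mul0r.
Qed.

(** On [A] each vertex of degree k gets an edge with probability at most
    min(1, f k / t0), and there are S_k - S_(k+1) of them. The upper bound is a
    convex combination of S_(k+1) and S_k, hence monotone in both. *)
Lemma Ex_tail_count_step k n A t0 : past n A -> 0 < t0 ->
  (forall w, A w -> t0 <= (V n w).2) ->
  Ex (fun w => \1_A w * S k.+1 n.+1 w) <=
  (1 - Num.min 1 (f k / t0)) * Ex (fun w => \1_A w * S k.+1 n w) +
  Num.min 1 (f k / t0) * Ex (fun w => \1_A w * S k n w).
Proof.
move=> pA t00 At0; set q := Num.min _ _.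
have bA : bounded_rv (\1_A : Omega -> R) by apply: bounded_rv_indic; exact: (mset pA).
have bS i := bounded_rv_tail_count i n.
have bAS i : bounded_rv (fun w => \1_A w * S i n w) by exact: bounded_rvM.
have bp : bounded_rv (fun w => \1_A w * 1 * (rate k (V n w).2 * (S k n w - S k.+1 n w))).
  apply: bounded_rvM; first by apply: bounded_rvM => //; exact: bounded_rv_cst.
  by apply: bounded_rvM => //; exact: bounded_rvB.
rewrite -!ExZ// -ExD; [|exact: bounded_rvZ|exact: bounded_rvZ].
have -> : Ex (fun w => \1_A w * S k.+1 n.+1 w) = Ex (fun w => \1_A w * S k.+1 n w +
     \1_A w * 1 * (rate k (V n w).2 * (S k n w - S k.+1 n w))).
  rewrite ExD// -(Ex_new_edges k (fun=> 1) pA) -ExD//.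
    by apply: eq_Ex => w; rewrite tail_countS natrD mulrDr mulr1.
  apply: bounded_rvM; last exact: bounded_rv_new_edges.
  by apply: bounded_rvM => //; exact: bounded_rv_cst.
apply: le_Ex.
- exact: bounded_rvD.
- by apply: bounded_rvD; exact: bounded_rvZ.
move=> w; rewrite indicE; have [|_] := boolP (w \in A); last by rewrite !mul0r !mulr0 addr0.
rewrite inE !mul1r => Aw.
have pq : rate k (V n w).2 <= q.
  rewrite le_min (attachment_rate_le1 phi_range phi_nonincreasing phi_integral)//=.
  apply: (le_trans (attachment_rate_le phi_range phi_nonincreasing phi_integral f_gt0 k (V_gt0 n w))).
  by rewrite ler_pM2l// lef_pV2 ?posrE// At0.
have S0 : 0 <= S k n w - S k.+1 n w.
  by rewrite subr_ge0 ler_nat tail_count_nonincreasing.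
by have := ler_wpM2r S0 pq; lra.
Qed.

(** Write D_k = S_k(n) - n * s0 and D_(k+1) = S_(k+1)(n) - n * s1. By the balance
    f k * (s0 - s1) = s1, these are deviations from an equilibrium of the mean
    evolution, so that conditionally on the past D_(k+1) evolves to (1 - r) * D_(k+1) + r * D_k + s1 * g, where r is the attachment
    rate and g its relative error. The drift pulls D_(k+1) back, the other two
    terms are small, and the fluctuation is controlled by the second moment of the
    number of new edges. *)
Lemma Ex_square_step (s0 s1 : R) k n A t0 eta : past n A -> (0 < n)%N -> 0 < t0 ->
  f k * (s0 - s1) = s1 -> 0 <= s1 <= 1 ->
  (forall w, A w -> t0 <= (V n w).2) ->
  (forall w, A w -> `|n%:R * rate k (V n w).2 / f k - 1| <= eta) ->
  Ex (fun w => \1_A w * (S k.+1 n.+1 w - n.+1%:R * s1) ^+ 2) <=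
  (1 + n%:R^-1) * Ex (fun w => \1_A w * (S k.+1 n w - n%:R * s1) ^+ 2) +
  (1 + n%:R) * (2 * (f k / t0) ^+ 2 * Ex (fun w => \1_A w * (S k n w - n%:R * s0) ^+ 2) +
                2 * eta ^+ 2) +
  (n%:R * (f k / t0) + (n%:R * (f k / t0)) ^+ 2).
Proof.
move=> pA n0 t00 fs /andP[s10 s11] At0 Aeta; set q := f k / t0.
have bA : bounded_rv (\1_A : Omega -> R) by apply: bounded_rv_indic; exact: (mset pA).
have bS i := bounded_rv_tail_count i n.
have bD i c : bounded_rv (fun w => S i n w - c).
  by apply: bounded_rvB => //; exact: bounded_rv_cst.
have bAD i c : bounded_rv (fun w => \1_A w * (S i n w - c) ^+ 2).
  by apply: bounded_rvM => //; exact: bounded_rvX.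
have bJ := bounded_rv_new_edges k n.
pose h (j : nat) : R := 2 * (j%:R - n.+1%:R * s1).
pose p w := rate k (V n w).2 * (S k n w - S k.+1 n w).
have bp : bounded_rv p by apply: bounded_rvM => //; exact: bounded_rvB.
have bh : bounded_rv (fun w => \1_A w * h (tail_count E k.+1 n w)).
  by apply: bounded_rvM => //; exact: bounded_rvZ.
have bhJ : bounded_rv (fun w => \1_A w * h (tail_count E k.+1 n w) * J k n w).
  exact: bounded_rvM.
have bhp : bounded_rv (fun w => \1_A w * h (tail_count E k.+1 n w) * p w).
  exact: bounded_rvM.
have -> : Ex (fun w => \1_A w * (S k.+1 n.+1 w - n.+1%:R * s1) ^+ 2) =
  Ex (fun w => \1_A w * (S k.+1 n w - n.+1%:R * s1) ^+ 2 +
      \1_A w * h (tail_count E k.+1 n w) * p w) + Ex (fun w => \1_A w * J k n w ^+ 2).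
  rewrite ExD// -(Ex_new_edges k h pA) -ExD// -ExD; first last.
  - by apply: bounded_rvM => //; exact: bounded_rvX.
  - by apply: bounded_rvD.
  by apply: eq_Ex => w; rewrite tail_countS natrD /h; ring.
apply: lerD; last exact: Ex_new_edges_sqr.
have e2 : 0 <= eta ^+ 2 by exact: sqr_ge0.
have nR : (0 : R) < n%:R by rewrite ltr0n.
have bR : bounded_rv (fun w => (1 + n%:R^-1) * (\1_A w * (S k.+1 n w - n%:R * s1) ^+ 2) +
    ((1 + n%:R) * (2 * q ^+ 2)) * (\1_A w * (S k n w - n%:R * s0) ^+ 2) +
    (1 + n%:R) * (2 * eta ^+ 2) * \1_A w).
  by do 2 (apply: bounded_rvD; last exact: bounded_rvZ); exact: bounded_rvZ.
apply: (@le_trans _ _ (Ex (fun w => (1 + n%:R^-1) * (\1_A w * (S k.+1 n w - n%:R * s1) ^+ 2) +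
    ((1 + n%:R) * (2 * q ^+ 2)) * (\1_A w * (S k n w - n%:R * s0) ^+ 2) +
    (1 + n%:R) * (2 * eta ^+ 2) * \1_A w))); last first.
  rewrite ExD; [|by apply: bounded_rvD; exact: bounded_rvZ|exact: bounded_rvZ].
  rewrite ExD; [|exact: bounded_rvZ|exact: bounded_rvZ].
  rewrite !ExZ//.
  have e1 : Ex (\1_A : Omega -> R) <= 1.
    by rewrite -[leRHS](Ex_cst P); apply: le_Ex => //; exact: bounded_rv_cst.
  have c0 : 0 <= (1 + n%:R) * (2 * eta ^+ 2) by rewrite mulr_ge0 ?addr_ge0// mulr_ge0.
  by have := ler_wpM2l c0 e1; lra.
apply: le_Ex => //; first by apply: bounded_rvD.
move=> w; rewrite indicE; have [|_] := boolP (w \in A); last by rewrite !mul0r !mulr0 !addr0.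
rewrite inE !mul1r mulr1 => Aw.
pose r := rate k (V n w).2.
have r0 : 0 <= r by exact: attachment_rate_ge0.
have r1 : r <= 1 by exact: (attachment_rate_le1 phi_range phi_nonincreasing phi_integral).
have rq : r <= q.
  apply: (le_trans (attachment_rate_le phi_range phi_nonincreasing phi_integral f_gt0 k (V_gt0 n w))).
  by rewrite ler_pM2l// lef_pV2 ?posrE// At0.
have := Aeta w Aw; rewrite -/r; set g := _ - 1 => geta.
have gE : n%:R * r * (s0 - s1) - s1 = s1 * g.
  have -> : s0 - s1 = s1 / f k by rewrite -[in RHS]fs mulrC mulKf// gt_eqF.
  by rewrite /g; ring.
clearbody g; rewrite /h /p -/r.
set x := S k.+1 n w; set y := S k n w.
pose D1 := x - n%:R * s1; pose D0 := y - n%:R * s0.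
pose b := r * D0 + s1 * g.
(* The conditional mean of the square without the quadratic term of the jump: the
   square of the mean evolution, minus a square. *)
have -> : (x - n.+1%:R * s1) ^+ 2 + 2 * (x - n.+1%:R * s1) * (r * (y - x)) =
    ((1 - r) * D1 + b) ^+ 2 - (r * (y - x)) ^+ 2.
  by rewrite /b -gE /D1 /D0 -natr1; ring.
apply: (@le_trans _ _ (((1 - r) * D1 + b) ^+ 2)).
  by rewrite lerBlDr lerDl sqr_ge0.
apply: (le_trans (sqrD_le _ _ nR)).
have D1le : ((1 - r) * D1) ^+ 2 <= D1 ^+ 2.
  rewrite exprMn ler_piMl ?sqr_ge0// expr_le1 ?subr_ge0//; lra.
have ble : b ^+ 2 <= 2 * q ^+ 2 * D0 ^+ 2 + 2 * eta ^+ 2.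
  have h1 : b ^+ 2 <= 2 * (r * D0) ^+ 2 + 2 * (s1 * g) ^+ 2.
    by rewrite -subr_ge0 /b (_ : _ - _ = (r * D0 - s1 * g) ^+ 2) ?sqr_ge0//; ring.
  have u1 : (r * D0) ^+ 2 <= q ^+ 2 * D0 ^+ 2.
    by rewrite exprMn ler_wpM2r ?sqr_ge0// lerXn2r// nnegrE (le_trans r0).
  have u2 : (s1 * g) ^+ 2 <= eta ^+ 2.
    rewrite exprMn (@le_trans _ _ (g ^+ 2))//.
      by rewrite ler_piMl ?sqr_ge0// expr_le1.
    by rewrite -[X in X <= _]real_normK ?num_real// lerXn2r// nnegrE (le_trans _ geta).
  by apply: (le_trans h1); lra.
have n1 : 0 <= 1 + n%:R^-1 :> R by rewrite addr_ge0// invr_ge0 ltW.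
have n2 : 0 <= 1 + n%:R :> R by rewrite addr_ge0.
have l1 := ler_wpM2l n1 D1le; have l2 := ler_wpM2l n2 ble.
rewrite -/D1 -/D0; clearbody b D1 D0; lra.
Qed.

End one_step.

(** * Deterministic recursions and the limit law *)

Section growth_lemmas.
Context (R : realType).
Implicit Types (y b : nat -> R).

(** Dividing by n, the factor 1 + 1/n cancels and the increments of y n / n are
    bounded by a sequence that tends to 0, so that y n / n is o(n). *)
Lemma quadratic_growth y b (C : R) N : (0 < N)%N -> (forall n, 0 <= y n) -> 0 <= C ->
  (forall n, (N <= n)%N ->
    y n.+1 <= (1 + n%:R^-1) * y n + (1 + n%:R) * b n + C) ->
  (forall eps, 0 < eps -> exists M, forall n, (M <= n)%N -> b n <= eps) ->
  forall eps, 0 < eps -> exists M, forall n, (M <= n)%N -> y n <= eps * n%:R ^+ 2.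
Proof.
move=> N0 y0 C0 rec b0 eps e0.
have e4 : 0 < eps / 4 by rewrite divr_gt0.
have [M1 hM1] := b0 _ e4.
pose M2 := Num.bound (C / (eps / 4)).
pose M := maxn N (maxn M1 M2).
have NM : (N <= M)%N by exact: leq_maxl.
have M0 : (0 < M)%N by exact: leq_trans N0 NM.
have step n : (M <= n)%N -> y n.+1 / n.+1%:R <= y n / n%:R + eps / 2.
  move=> Mn; have Nn := leq_trans NM Mn; have n0 : (0 < n)%N by exact: leq_trans Nn.
  have nR : (0 : R) < n%:R by rewrite ltr0n.
  have sR : (0 : R) < n.+1%:R by rewrite ltr0n.
  rewrite ler_pdivrMr//; apply: (le_trans (rec n Nn)).
  have hb := hM1 n (leq_trans (leq_trans (leq_maxl _ _) (leq_maxr _ _)) Mn).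
  have hC : C <= eps / 4 * n.+1%:R.
    rewrite mulrC -ler_pdivrMr//; apply: ltW.
    apply: (lt_le_trans (archi_boundP _)); first by rewrite divr_ge0// ltW.
    by rewrite ler_nat (leq_trans _ (leqnSn n))// (leq_trans _ Mn)// !leq_max leqnn !orbT.
  have hb' : (1 + n%:R) * b n <= (1 + n%:R) * (eps / 4).
    by apply: ler_wpM2l => //; rewrite addr_ge0// ltW.
  have -> : (1 + n%:R^-1) * y n = y n / n%:R * n.+1%:R.
    by rewrite -[n.+1%:R]natr1; field; rewrite gt_eqF.
  have sE : n.+1%:R = n%:R + 1 :> R by rewrite natr1.
  by rewrite sE in hC *; lra.
have lin n : y (M + n)%N / (M + n)%:R <= y M / M%:R + eps / 2 * n%:R.
  elim: n => [|n IH]; first by rewrite addn0 mulr0 addr0.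
  rewrite addnS; apply: (le_trans (step _ (leq_addr _ _))).
  by rewrite -[n.+1%:R]natr1; lra.
pose M3 := Num.bound ((y M / M%:R) / (eps / 2)).
exists (maxn M M3) => n; rewrite geq_max => /andP[Mn M3n].
have n0 : (0 < n)%N by exact: leq_trans Mn.
have nR : (0 : R) < n%:R by rewrite ltr0n.
have := lin (n - M)%N; rewrite subnKC// => h.
have h3 : y M / M%:R <= eps / 2 * n%:R.
  rewrite [leRHS]mulrC -ler_pdivrMr ?divr_gt0//; apply: ltW.
  apply: (lt_le_trans (archi_boundP _)); last by rewrite ler_nat.
  by rewrite !divr_ge0// ltW.
have h4 : eps / 2 * (n - M)%:R <= eps / 2 * n%:R.
  by rewrite ler_pM2l ?divr_gt0// ler_nat leq_subr.
rewrite expr2 mulrA -ler_pdivrMr//; lra.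
Qed.

(** The relative errors of the birth times will be of order 1 / root4 n. *)
Definition root4 (n : nat) : R := Num.sqrt (Num.sqrt n%:R).

Lemma root4X n : root4 n ^+ 4 = n%:R.
Proof. by rewrite (exprM _ 2 2) !sqr_sqrtr// sqrtr_ge0. Qed.

Lemma root4_ge1 n : (0 < n)%N -> 1 <= root4 n.
Proof.
move=> n0; have h : 1 <= Num.sqrt n%:R :> R by rewrite -[X in X <= _]sqrtr1 ler_wsqrtr// ler1n.
by rewrite -[X in X <= _]sqrtr1 ler_wsqrtr.
Qed.

Lemma root4_le n : root4 n <= root4 n.+1.
Proof. by do 2 apply: ler_wsqrtr; rewrite ler_nat. Qed.

Lemma root4_diff n : (0 < n)%N ->
  (4 * root4 n * n.+1%:R)^-1 <= (root4 n)^-1 - (root4 n.+1)^-1.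
Proof.
move=> n0; rewrite -(root4X n.+1).
have := root4_ge1 n0; have := root4_le n; have := root4X n; have := root4X n.+1.
set x := root4 n; set y := root4 n.+1 => yE xE xy x1.
have x0 : 0 < x by lra.
have y0 : 0 < y by lra.
have e : (y - x) * ((y + x) * (y ^+ 2 + x ^+ 2)) = 1.
  rewrite (_ : _ * _ = y ^+ 4 - x ^+ 4); last by ring.
  by rewrite yE xE -[n.+1%:R]natr1; ring.
have h : (y + x) * (y ^+ 2 + x ^+ 2) <= 4 * y ^+ 3.
  rewrite (_ : 4 * y ^+ 3 = (y + y) * (y ^+ 2 + y ^+ 2)); last by ring.
  have x2 : x ^+ 2 <= y ^+ 2 by rewrite lerXn2r// nnegrE ltW.
  apply: ler_pM; rewrite ?addr_ge0 ?sqr_ge0 ?(ltW x0) ?(ltW y0)//; lra.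
have d0 : 0 <= y - x by lra.
rewrite (_ : x^-1 - y^-1 = (y - x) / (x * y)); last by field; rewrite !gt_eqF.
rewrite ler_pdivlMr ?mulr_gt0// (_ : _^-1 * _ = (4 * y ^+ 3)^-1); last first.
  by field; rewrite !gt_eqF.
rewrite -[leLHS]mul1r ler_pdivrMr; last by rewrite mulr_gt0// exprn_gt0.
by rewrite -[leLHS]e ler_wpM2l.
Qed.

(** A supersolution of the worst-case growth x -> x * (1 + 1 / lo n). The relative
    errors 69 / n^(1/4) accumulate to the sum of 69 * n^(-5/4), which the
    exponential compensates; 276 = 4 * 69 because n^(-5/4) is about four times the
    decrement of n^(-1/4). *)
Definition damped (n : nat) : R := n%:R * expR (- (276 / root4 n)).

Lemma damped_ge0 n : 0 <= damped n.
Proof. by rewrite mulr_ge0// expR_ge0. Qed.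

Lemma damped_le n : damped n <= n%:R.
Proof.
rewrite /damped ler_piMr// expR_le1 oppr_le0 divr_ge0// sqrtr_ge0//.
Qed.

Lemma damped_ge n : (0 < n)%N -> n%:R <= expR 276 * damped n.
Proof.
move=> n0; rewrite /damped mulrCA ler_peMr// -expRD.
rewrite (le_trans _ (expR_ge1Dx _))// lerDl subr_ge0 ler_pdivrMr; last by rewrite (lt_le_trans _ (root4_ge1 n0)).
by rewrite ler_peMr// root4_ge1.
Qed.

Lemma damped_step n (lo : R) : (0 < n)%N -> 0 < lo ->
  n%:R / lo <= 1 + 69 / root4 n -> damped n * (1 + lo^-1) <= damped n.+1.
Proof.
move=> n0 lo0 hlo.
have x1 := root4_ge1 n0; have x0 : 0 < root4 n by lra.
have sR : (0 : R) < n.+1%:R by rewrite ltr0n.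
rewrite /damped; set x := root4 n in hlo x1 x0 *; set y := root4 n.+1.
rewrite (_ : - (276 / y) = - (276 / x) + 276 * (x^-1 - y^-1)); last by ring.
rewrite expRD mulrAC [leRHS]mulrA [leRHS]mulrAC ler_wpM2r ?expR_ge0//.
have h1 : 1 + 276 * (x^-1 - y^-1) <= expR (276 * (x^-1 - y^-1)) by exact: expR_ge1Dx.
have h2 := root4_diff n0; rewrite -/x -/y in h2.
have h3 : 1 + 69 / (x * n.+1%:R) <= expR (276 * (x^-1 - y^-1)).
  apply: le_trans h1; rewrite lerD2l.
  have -> : 69 / (x * n.+1%:R) = 276 * (4 * x * n.+1%:R)^-1.
    by field; rewrite !gt_eqF.
  by rewrite ler_pM2l.
apply: (@le_trans _ _ (n.+1%:R * (1 + 69 / (x * n.+1%:R)))); last by rewrite ler_pM2l.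
rewrite mulrDr mulr1 mulrDr mulr1 (_ : n.+1%:R * (69 / (x * n.+1%:R)) = 69 / x); last first.
  by field; rewrite !gt_eqF.
by rewrite -[n.+1%:R]natr1; lra.
Qed.

End growth_lemmas.

Section limit_law.
Context (R : realType) (f : nat -> R).
Hypothesis f_gt0 : forall k, 0 < f k.

(** The mass that the limit law gives to the integers at least k. *)
Definition limit_tail (k : nat) : R := \prod_(l < k) (f l / (1 + f l)).

Let f1 k : 0 < 1 + f k. Proof. by rewrite addr_gt0. Qed.

Lemma limit_tail0 : limit_tail 0 = 1. Proof. by rewrite /limit_tail big_ord0. Qed.

Lemma limit_tailS k : limit_tail k.+1 = limit_tail k * (f k / (1 + f k)).
Proof. by rewrite /limit_tail big_ord_recr. Qed.

Lemma limit_tail_gt0 k : 0 < limit_tail k.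
Proof. by apply: prodr_gt0 => l _; rewrite divr_gt0. Qed.

Lemma limit_tail_nonincreasing k : limit_tail k.+1 <= limit_tail k.
Proof.
by rewrite limit_tailS ler_piMr ?(ltW (limit_tail_gt0 k))// ler_pdivrMr// mul1r lerDr.
Qed.

Lemma limit_tail_homo : {homo limit_tail : i j / (i <= j)%N >-> j <= i}.
Proof.
move=> i j ij.
exact: (Order.NatMonotonyTheory.nonincnP limit_tail_nonincreasing _ _ ij).
Qed.

Lemma limit_tail_le1 k : limit_tail k <= 1.
Proof. by rewrite -limit_tail0; exact: limit_tail_homo. Qed.

(** The equilibrium of the mean evolution of the tail counts: the growth of
    S_(k+1), which is proportional to f k times the number of vertices of degree
    k, has to match its size. *)
Lemma limit_tail_balance k : f k * (limit_tail k - limit_tail k.+1) = limit_tail k.+1.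
Proof. by rewrite limit_tailS; field; rewrite gt_eqF. Qed.

Lemma limit_indegreeE k : limit_indegree f k = limit_tail k - limit_tail k.+1.
Proof. by rewrite /limit_indegree -/(limit_tail k) limit_tailS; field; rewrite gt_eqF. Qed.

(** The sequence A * limit_tail k * damped n dominates r by induction on n: with
    coefficient f k / lo n, the gain f k * (limit_tail k - limit_tail k.+1) / lo n
    is limit_tail k.+1 / lo n by the balance equation, and [damped_step] absorbs
    it. The constant is uniform in k, which is what unbounded functions of the
    degree require. *)
Lemma tail_recursion (r : nat -> nat -> R) (lo : nat -> R) N : (0 < N)%N ->
  (forall n, (N <= n)%N -> 0 < lo n /\ n%:R / lo n <= 1 + 69 / root4 R n) ->
  (forall n, r 0%N n <= n%:R) -> (forall k, r k N <= N%:R) ->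
  (forall k, (N < k)%N -> r k N <= 0) ->
  (forall k n, (N <= n)%N -> r k.+1 n.+1 <=
    (1 - Num.min 1 (f k / lo n)) * r k.+1 n + Num.min 1 (f k / lo n) * r k n) ->
  exists A : R, 0 <= A /\ forall k n, (N <= n)%N -> r k n <= A * limit_tail k * n%:R.
Proof.
move=> N0 hlo r0 rN rN0 rec.
(* The factor limit_tail N makes the bound hold at n = N, where k <= N. *)
pose A := expR 276 / limit_tail N.
have A0 : 0 <= A by rewrite divr_ge0 ?expR_ge0// ltW// limit_tail_gt0.
exists A; split=> // k n Nn.
suff H : forall j k, r k (N + j)%N <= A * limit_tail k * damped R (N + j).
  have := H (n - N)%N k; rewrite subnKC// => h; apply: (le_trans h).
  by rewrite ler_wpM2l ?damped_le// mulr_ge0// ltW// limit_tail_gt0.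
elim=> [|j IH] {}k.
  rewrite addn0; have [kN|Nk] := leqP k N; last first.
    apply: (le_trans (rN0 k Nk)); rewrite mulr_ge0 ?damped_ge0//.
    by rewrite mulr_ge0// ltW// limit_tail_gt0.
  apply: (le_trans (rN k)); apply: (le_trans (damped_ge R N0)).
  rewrite ler_wpM2r ?damped_ge0// /A mulrAC ler_pdivlMr ?limit_tail_gt0//.
  by rewrite ler_wpM2l ?expR_ge0// limit_tail_homo.
have Nj : (N <= N + j)%N by exact: leq_addr.
have nj0 : (0 < N + j)%N by exact: leq_trans Nj.
case: k => [|k].
  apply: (le_trans (r0 _)); rewrite limit_tail0 mulr1.
  apply: (le_trans (damped_ge R _)); first by rewrite addnS.
  rewrite ler_wpM2r ?damped_ge0// /A ler_pdivlMr ?limit_tail_gt0//.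
  by rewrite ler_piMr ?expR_ge0// limit_tail_le1.
rewrite addnS; apply: (le_trans (rec k _ Nj)).
have [lo0 hlon] := hlo _ Nj; set q := Num.min _ _.
have q0 : 0 <= q by rewrite le_min ler01 divr_ge0// ltW.
have q1 : q <= 1 by rewrite ge_min lexx.
have h1 : (1 - q) * r k.+1 (N + j)%N <=
    (1 - q) * (A * limit_tail k.+1 * damped R (N + j)).
  by rewrite ler_wpM2l// subr_ge0.
have h2 : q * r k (N + j)%N <= q * (A * limit_tail k * damped R (N + j)).
  by rewrite ler_wpM2l.
have h3 : q * (limit_tail k - limit_tail k.+1) <= limit_tail k.+1 / lo (N + j)%N.
  rewrite -[X in _ <= X / _](limit_tail_balance k) [leRHS]mulrAC ler_wpM2r//.
    by rewrite subr_ge0 limit_tail_nonincreasing.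
  by rewrite ge_min lexx orbT.
have h4 := damped_step nj0 lo0 hlon.
have AD : 0 <= A * damped R (N + j) by rewrite mulr_ge0// damped_ge0.
have h5 := ler_wpM2l AD h3.
have At : 0 <= A * limit_tail k.+1 by rewrite mulr_ge0// ltW// limit_tail_gt0.
have h6 := ler_wpM2l At h4.
lra.
Qed.

(** The bound f l <= l makes l * limit_tail l nonincreasing from L on. *)
Lemma limit_tail_cvg0 L : (forall l, (L <= l)%N -> f l <= l%:R) -> (0 < L)%N ->
  limit_tail n @[n --> \oo] --> (0 : R).
Proof.
move=> fL L0.
have bd n : (L <= n)%N -> limit_tail n * n%:R <= limit_tail L * L%:R.
  move=> /subnKC <-; elim: (n - L)%N => [|j IH]; first by rewrite addn0.
  rewrite addnS; apply: le_trans IH; rewrite limit_tailS -mulrA.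
  rewrite ler_wpM2l ?(ltW (limit_tail_gt0 _))// mulrAC ler_pdivrMr//.
  rewrite -[(L + j).+1%:R]natr1; have := fL (L + j)%N (leq_addr _ _); lra.
apply/cvgrPdist_le => e e0; near=> n.
have Ln : (L <= n)%N by near: n; exact: nbhs_infty_ge.
have n0 : (0 : R) < n%:R by rewrite ltr0n (leq_trans L0).
rewrite sub0r normrN ger0_norm ?(ltW (limit_tail_gt0 _))//.
have : limit_tail n <= (limit_tail L * L%:R) / n%:R by rewrite ler_pdivlMr// bd.
move=> h; apply: (le_trans h); rewrite ler_pdivrMr// [leRHS]mulrC -ler_pdivrMr//.
apply: ltW; apply: (lt_le_trans (archi_boundP _)).
  by rewrite divr_ge0 ?mulr_ge0// ltW// limit_tail_gt0.
by rewrite ler_nat; near: n; exact: nbhs_infty_ge.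
Unshelve. all: by end_near. Qed.

(** The increments of g, with which g(d) is a sum over all k <= d, so that sums of g
    over the degrees become combinations of the tail counts. *)
Definition increment (g : nat -> R) (k : nat) : R :=
  if k is l.+1 then g l.+1 - g l else g 0%N.

Lemma abel_sum (g : nat -> R) (s : nat -> R) K :
  \sum_(k < K.+1) increment g k * s k =
  \sum_(k < K.+1) (s k - s k.+1) * g k + s K.+1 * g K.
Proof.
elim: K => [|K IH]; first by rewrite !big_ord_recr !big_ord0/=; ring.
by rewrite big_ord_recr/= IH [in RHS]big_ord_recr/=; ring.
Qed.

End limit_law.

(** * Concentration of the birth times *)

Section poisson_tails.
Context (R : realType) (t : R).
Hypothesis t0 : 0 < t.
Local Notation a k := (poisson_pmf t k).

Lemma poisson_pmfS k : k.+1%:R * a k.+1 = t * a k.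
Proof.
rewrite /poisson_pmf t0 factS natrM exprS invfM.
by field; rewrite !pnatr_eq0 -?lt0n ?fact_gt0// gt_eqF.
Qed.

(** A closed form of the truncated variance, by which the second moment of the
    Poisson law needs no series manipulation. *)
Lemma poisson_variance_partial K :
  \sum_(k < K.+2) (k%:R - t) ^+ 2 * a k =
  t * \sum_(k < K.+1) a k + t ^+ 2 * (a K.+1 - a K).
Proof.
elim: K => [|K IH].
  rewrite !big_ord_recr !big_ord0/=; have := poisson_pmfS 0; rewrite mul1r => ->.
  by ring.
rewrite big_ord_recr/= IH [in RHS]big_ord_recr/=.
have e1 := poisson_pmfS K; have e2 := poisson_pmfS K.+1.
have -> : (K.+2%:R - t) ^+ 2 * a K.+2 =
    K.+2%:R * (K.+2%:R * a K.+2) - 2 * t * (K.+2%:R * a K.+2) + t ^+ 2 * a K.+2.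
  by ring.
rewrite e2 -[K.+2%:R]natr1.
have -> : (K.+1%:R + 1) * (t * a K.+1) = t * (K.+1%:R * a K.+1) + t * a K.+1 by ring.
by rewrite e1; ring.
Qed.

Lemma poisson_sum_cvg : \sum_(k < n) a k @[n --> \oo] --> (1 : R).
Proof.
have -> : (fun n => \sum_(k < n) a k) = (fun n => series (exp_coeff t) n * expR (- t)).
  apply/funext => n; rewrite /series/= big_mkord mulr_suml; apply: eq_bigr => k _.
  by rewrite /poisson_pmf t0 /exp_coeff/=.
rewrite -[X in _ --> X](_ : expR t * expR (- t) = 1); last by rewrite -expRD subrr expR0.
by apply: cvgMl; exact: is_cvg_series_exp_coeff.
Qed.

Let nd : nondecreasing_seq (fun n => \sum_(k < n) a k).
Proof.
apply/nondecreasing_seqP => n; rewrite big_ord_recr/= lerDl.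
exact: poisson_pmf_ge0.
Qed.

Lemma poisson_sum_le1 n : \sum_(k < n) a k <= 1.
Proof.
have := nondecreasing_cvgn_le nd (cvgP _ poisson_sum_cvg) n.
by rewrite (cvg_lim _ poisson_sum_cvg).
Qed.

Lemma poisson_variance_le n : \sum_(k < n) (k%:R - t) ^+ 2 * a k <= t.
Proof.
pose K := maxn n (Num.bound t).
apply: (@le_trans _ _ (\sum_(k < K.+2) (k%:R - t) ^+ 2 * a k)).
  have nK : (n <= K.+2)%N by do 2 apply: leqW; exact: leq_maxl.
  rewrite -!(big_mkord xpredT (fun k => (k%:R - t) ^+ 2 * a k)).
  rewrite [leRHS](big_cat_nat _ nK)//= lerDl sumr_ge0// => k _.
  by rewrite mulr_ge0 ?sqr_ge0// poisson_pmf_ge0.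
rewrite poisson_variance_partial.
have aK : a K.+1 <= a K.
  have tK : t <= K.+1%:R.
    apply/ltW/(lt_le_trans (archi_boundP (ltW t0))); rewrite ler_nat.
    by apply: leqW; exact: leq_maxr.
  by rewrite -(ler_pM2l t0) -(poisson_pmfS K) ler_wpM2r// poisson_pmf_ge0.
have := poisson_sum_le1 K.+1 => h.
have h1 : t * \sum_(k < K.+1) a k <= t * 1 by rewrite ler_pM2l.
have h2 : t ^+ 2 * (a K.+1 - a K) <= 0.
  by rewrite -[leRHS](mulr0 (t ^+ 2)) ler_wpM2l ?sqr_ge0 ?subr_le0.
lra.
Qed.

(** Chebyshev's inequality, on each side separately. *)
Lemma poisson_lower_tail i : i%:R <= t ->
  (t - i%:R) ^+ 2 * \sum_(k < i.+1) a k <= t.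
Proof.
move=> it; apply: le_trans (poisson_variance_le i.+1); rewrite mulr_sumr.
apply: ler_sum => k _; apply: ler_wpM2r; first exact: poisson_pmf_ge0.
rewrite -[leRHS]sqrrN opprB lerXn2r ?nnegrE ?subr_ge0//.
  by rewrite (le_trans _ it)// ler_nat -ltnS.
by rewrite lerD2l lerN2 ler_nat -ltnS.
Qed.

Lemma poisson_upper_tail i : t <= i.+1%:R ->
  (i.+1%:R - t) ^+ 2 * (1 - \sum_(k < i.+1) a k) <= t.
Proof.
move=> ti; set c := (_ - t) ^+ 2; set F := \sum_(k < i.+1) a k.
have c0 : 0 <= c by exact: sqr_ge0.
have H n : (i.+1 <= n)%N -> c * (\sum_(k < n) a k - F) <= t.
  move=> iln; apply: le_trans (poisson_variance_le n).
  rewrite /F -!(big_mkord xpredT (fun k => a k)).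
  rewrite -(big_mkord xpredT (fun k => (k%:R - t) ^+ 2 * a k)).
  rewrite [X in X - _](big_cat_nat _ iln)//= addrAC subrr add0r.
  rewrite [leRHS](big_cat_nat _ iln)//= -[leLHS]add0r lerD//.
    by apply: sumr_ge0 => k _; rewrite mulr_ge0 ?sqr_ge0// poisson_pmf_ge0.
  rewrite mulr_sumr; apply: ler_sum_nat => k /andP[ik _]; apply: ler_wpM2r; first exact: poisson_pmf_ge0.
  have ik' : i.+1%:R <= k%:R :> R by rewrite ler_nat.
  rewrite lerXn2r ?nnegrE ?subr_ge0//; first exact: le_trans ik'.
  by rewrite lerD2r.
have cv : c * (\sum_(k < n) a k - F) @[n --> \oo] --> c * (1 - F).
  by apply: cvgMr; apply: cvgB; [exact: poisson_sum_cvg|exact: cvg_cst].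
rewrite -(cvg_lim _ cv)//; apply: limr_le; first exact: cvgP cv.
by near=> n; apply: H; near: n; exact: nbhs_infty_ge.
Unshelve. all: by end_near. Qed.

End poisson_tails.

Section birth_times.
Context d (Omega : measurableType d) (R : realType) (P : probability Omega R).
Context (V : nat -> Omega -> R * R).
Hypothesis mV : forall n, measurable_fun setT (V n).
Hypothesis poisson : is_poisson_process P (fun w => range (V ^~ w))
                                   (@torus_time_intensity R).
Hypothesis V_gt0 : forall n w, 0 < (V n w).2.
Hypothesis V_lt : forall n w, (V n w).2 < (V n.+1 w).2.

Let V_mono w : {mono (fun i => (V i w).2) : i j / (i <= j)%N >-> i <= j}.
Proof. exact/Order.NatMonotonyTheory.incnP. Qed.

Lemma born_set_initial (t : R) k w :
  [set i | (V i w).2 <= t] #= `I_k -> forall i, (V i w).2 <= t <-> (i < k)%N.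
Proof.
move=> Dk i.
have down j l : (j <= l)%N -> (V l w).2 <= t -> (V j w).2 <= t.
  by move=> jl; apply: le_trans; rewrite V_mono.
split.
  move=> it; rewrite -card_le_II -(card_le_eqr Dk); apply: subset_card_le => j /= ji.
  exact: down it.
move=> ik; rewrite leNgt; apply/negP => ti.
have : `I_k #<= `I_i.
  rewrite -(card_le_eql Dk); apply: subset_card_le => j /= jt.
  by rewrite ltnNge; apply/negP => ij; have := down _ _ ij jt; rewrite leNgt ti.
by rewrite card_le_II leqNgt ik.
Qed.

(** The points born by t are those of the strip of times up to t, which has
    intensity t. *)
Lemma probability_born (t : R) k : 0 < t ->
  P [set w | forall i, (V i w).2 <= t <-> (i < k)%N] = (poisson_pmf t k)%:E.
Proof.
move=> t0; pose S : set (R * R) := setT `*` `]0, t]%classic.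
have mS : measurable S by apply: measurableX => //; exact: measurable_itv.
have ST : torus_time_intensity S = t%:E.
  by rewrite torus_time_intensityT ?lexx ?ltW// subr0.
have H := @poisson_finType _ _ _ P V poisson unit (fun=> S) (fun=> k).
rewrite [LHS](_ : _ = P [set w | forall j : unit, range (V ^~ w) `&` S #= `I_k]).
  rewrite H//.
  - rewrite big_const card_unit/= ST mule1 /poisson_prob t0 esum_set1//.
    by rewrite lee_fin poisson_pmf_ge0.
  - by move=> _; rewrite ST ltry.
  - by apply/trivIsetP => -[] [].
congr (P _); apply/seteqP; split=> w /=.
  move=> h _; have -> : range (V ^~ w) `&` S = (V ^~ w) @` `I_k.
    apply/seteqP; split=> x /=.
      by case=> -[i _ <-] [_]; rewrite /= in_itv/= V_gt0 => /h ik; exists i.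
    by case=> i /= /h it <-; split; [exists i|split => //=; rewrite in_itv/= V_gt0].
  apply: inj_card_eq => i j _ _ ij; apply/eqP.
  by rewrite eqn_leq -!(V_mono w) ij lexx.
move=> /(_ tt) h; apply: born_set_initial; apply: card_eq_trans h.
rewrite card_eq_sym (_ : range (V ^~ w) `&` S = (V ^~ w) @` [set i | (V i w).2 <= t]).
  apply: inj_card_eq => i j _ _ ij; apply/eqP.
  by rewrite eqn_leq -!(V_mono w) ij lexx.
apply/seteqP; split=> x /=.
  by case=> -[i _ <-] [_]; rewrite /= in_itv/= V_gt0 => it; exists i.
by case=> i /= it <-; split; [exists i|split => //=; rewrite in_itv/= V_gt0].
Qed.

Let mT n : measurable_fun setT (fun w => (V n w).2).
Proof. exact: measurable_birth mV n. Qed.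

(** Vertex i is born after t when at most i points are born by t. *)
Lemma birth_tail (t : R) i : 0 < t ->
  P [set w | t < (V i w).2] = (\sum_(k < i.+1) poisson_pmf t k)%:E.
Proof.
move=> t0.
have key k : [set w | forall i, (V i w).2 <= t <-> (i < k)%N] =
    (if k is j.+1 then [set w | (V j w).2 <= t] else setT) `&` [set w | t < (V k w).2].
  apply/seteqP; split=> w /=.
    move=> h; split; last by rewrite ltNge; apply/negP => /h; rewrite ltnn.
    by case: k h => // k h; apply/h.
  move=> [h1 h2] j; split.
    move=> jt; rewrite ltnNge; apply/negP => kj.
    have kj' : (V k w).2 <= (V j w).2 by rewrite V_mono.
    by move: (lt_le_trans h2 (le_trans kj' jt)); rewrite ltxx.
  case: k h1 h2 => // k h1 h2 jk; apply: le_trans h1; by rewrite V_mono.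
elim: i => [|i IH].
  by rewrite big_ord_recr big_ord0/= add0r -probability_born// key setTI.
rewrite big_ord_recr/= EFinD -IH -probability_born// key.
rewrite -measureU//; last 3 first.
- exact: measurable_ltr_set.
- by apply: measurableI; [exact: measurable_ler_set|exact: measurable_ltr_set].
- apply/seteqP; split=> w //= [h [h' _]].
  by move: (lt_le_trans h h'); rewrite ltxx.
congr (P _); apply/seteqP; split=> w /=.
  by move=> h; have [|] := ltP t (V i w).2; [left|right].
by case=> [h|[_ //]]; exact: lt_trans (V_lt i w).
Qed.

(** By t already i+1 points are born, although only t are expected. *)
Lemma birth_early (t : R) i : 0 < t -> t < i.+1%:R ->
  (P [set w | ((V i w).2 <= t)%R] <= (t / (i.+1%:R - t) ^+ 2)%:E)%E.
Proof.
move=> t0 ti.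
have -> : [set w | (V i w).2 <= t] = ~` [set w | t < (V i w).2].
  by apply/seteqP; split=> w /=; [move/le_gtF => h; rewrite h|move=> /negP; rewrite -leNgt].
rewrite probability_setC; last exact: measurable_ltr_set.
rewrite birth_tail// -EFinB lee_fin ler_pdivlMr ?exprn_gt0 ?subr_gt0// mulrC.
by apply: poisson_upper_tail => //; exact: ltW.
Qed.

Lemma birth_late (t : R) i : 0 < t -> i%:R < t ->
  (P [set w | (t < (V i w).2)%R] <= (t / (t - i%:R) ^+ 2)%:E)%E.
Proof.
move=> t0 it; rewrite birth_tail// lee_fin ler_pdivlMr ?exprn_gt0 ?subr_gt0// mulrC.
by apply: poisson_lower_tail => //; exact: ltW.
Qed.

(** With x = l+1, the birth times of vertices x^4 + x^3 and x^4 - x^3 lie on either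
    side of x^4. The deviation x^3 is large compared with the standard deviation x^2,
    and small compared with x^4. *)
Definition window (l : nat) : set Omega :=
  [set w | l.+1%:R ^+ 4 < (V (l.+1 ^ 3 * l.+2)%N w).2 /\
           (V (l.+1 ^ 3 * l)%N w).2 <= l.+1%:R ^+ 4].

Lemma measurable_window l : measurable (window l).
Proof.
by apply: measurableI; [exact: measurable_ltr_set|exact: measurable_ler_set].
Qed.

Lemma probability_window l :
  (P (~` window l) <= (2 / l.+1%:R ^+ 2)%:E)%E.
Proof.
set t : R := l.+1%:R ^+ 4; have t0 : 0 < t by rewrite exprn_gt0// ltr0Sn.
set x : R := l.+1%:R; have x0 : 0 < x by rewrite ltr0Sn.
pose A := [set w | (V (l.+1 ^ 3 * l.+2)%N w).2 <= t].
pose B := [set w | t < (V (l.+1 ^ 3 * l)%N w).2].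
have mA : measurable A by exact: measurable_ler_set.
have mB : measurable B by exact: measurable_ltr_set.
have sub : ~` window l `<=` A `|` B.
  move=> w /= h; have [|tA] := leP (V (l.+1 ^ 3 * l.+2)%N w).2 t; first by left.
  by right; rewrite /B/= ltNge; apply/negP => Bt; apply: h.
apply: (le_trans (le_measure P _ _ sub)); rewrite ?inE//.
- by apply: measurableC; exact: measurable_window.
- exact: measurableU.
apply: (le_trans (measureU2 _ mA mB)).
have e1 : (l.+1 ^ 3 * l.+2)%:R = x ^+ 4 + x ^+ 3 :> R.
  by rewrite natrM natrX -/x -[l.+2%:R]natr1 -/x; ring.
have e2 : (l.+1 ^ 3 * l)%:R = x ^+ 4 - x ^+ 3 :> R.
  by rewrite natrM natrX -/x (_ : l%:R = x - 1); [ring|rewrite /x -natr1 addrK].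
have x3 : 0 < x ^+ 3 by rewrite exprn_gt0.
have -> : 2 / x ^+ 2 = t / (x ^+ 3) ^+ 2 + t / (x ^+ 3) ^+ 2.
  by rewrite /t -/x; field; rewrite gt_eqF.
rewrite EFinD leeD//.
  apply: (le_trans (birth_early t0 _)).
    by rewrite -natr1 e1 /t -/x; lra.
  rewrite lee_fin ler_pM2l// lef_pV2 ?posrE ?exprn_gt0//; last first.
    by rewrite -natr1 e1 /t -/x; lra.
  rewrite lerXn2r ?nnegrE// ?ltW//; rewrite -natr1 e1 /t -/x; lra.
apply: (le_trans (birth_late t0 _)).
  by rewrite e2 /t -/x; lra.
by rewrite e2 /t -/x opprB addrC subrK.
Qed.

(** Between two consecutive windows the birth times are bracketed by monotonicity;
    the constants 69 and 240 absorb the lower order terms, using that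
    i^(1/4) <= 3 * (l+1). *)
Lemma window_bounds l i w : window l w -> window l.+2 w ->
  (l.+1 ^ 3 * l.+2 <= i < l.+2 ^ 3 * l.+3)%N ->
  i%:R / (1 + 69 / root4 R i) <= (V i w).2 <= i%:R * (1 + 240 / root4 R i).
Proof.
move=> [h1 _] [_ h2] /andP[li il].
have i0 : (0 < i)%N by rewrite (leq_trans _ li)// muln_gt0 expn_gt0.
set r := root4 R i; have r1 : 1 <= r by exact: root4_ge1.
have r4 : r ^+ 4 = i%:R by exact: root4X.
set x : R := l.+1%:R; have x1 : 1 <= x by rewrite ler1n.
have ex2 : l.+2%:R = x + 1 by rewrite -[l.+2%:R]natr1.
have ex3 : l.+3%:R = x + 2 by rewrite -[l.+3%:R]natr1 ex2; ring.
have lo : x ^+ 4 + x ^+ 3 <= i%:R.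
  move: li; rewrite -(ler_nat R) natrM natrX ex2 -/x.
  by apply: le_trans; rewrite mulrDr mulr1 -exprSr.
have hi : i%:R <= (x + 1) ^+ 3 * (x + 2).
  by move: il; rewrite -(ltr_nat R) natrM natrX ex2 ex3 => /ltW.
have Ti : x ^+ 4 <= (V i w).2.
  by apply/ltW/(lt_le_trans h1); rewrite V_mono.
have Ts : (V i w).2 <= (x + 2) ^+ 4.
  rewrite -ex3; apply: le_trans h2; rewrite V_mono.
  apply: (leq_trans (ltnW il)).
  by move=> {Ti lo hi li il}; rewrite !expnS !expn0; nia.
have rx : r <= 3 * x.
  rewrite -(@ler_pXn2r _ 4) ?nnegrE//; last 2 first.
    lra.
    lra.
  rewrite r4; apply: (le_trans hi).
  apply: (@le_trans _ _ ((3 * x) ^+ 3 * (3 * x))); last by rewrite -exprSr.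
  apply: ler_pM; try lra.
    by apply: exprn_ge0; lra.
  by rewrite lerXn2r ?nnegrE; lra.
have r0 : 0 < r by lra.
have x0 : 0 < x by lra.
have xr : x^-1 <= 3 / r by rewrite ler_pdivlMr// mulrC ler_pdivrMr.
have x2 : x <= x ^+ 2 by rewrite -[leLHS]expr1 ler_weXn2l.
have x3 : x ^+ 2 <= x ^+ 3 by rewrite ler_weXn2l.
have xE n : x ^+ n = x ^+ n.+1 * x^-1 by rewrite exprSr mulfK// gt_eqF.
have pos n : 0 <= x ^+ n by rewrite exprn_ge0// ltW.
apply/andP; split.
  have d0 : 0 < 1 + 69 / r by rewrite ltr_pwDl// divr_ge0// ltW.
  rewrite ler_pdivrMr//; apply: (@le_trans _ _ (x ^+ 4 * (1 + 69 / r))); last first.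
    by rewrite ler_pM2r.
  have h : x ^+ 3 <= x ^+ 4 * (3 / r) by rewrite (xE 3) ler_wpM2l.
  have -> : x ^+ 4 * (1 + 69 / r) = x ^+ 4 + 23 * (x ^+ 4 * (3 / r)) by ring.
  apply: (le_trans hi); have -> : (x + 1) ^+ 3 * (x + 2) =
    x ^+ 4 + 5 * x ^+ 3 + 9 * x ^+ 2 + 7 * x + 2 by ring.
  lra.
apply: (le_trans Ts).
have h : x ^+ 3 <= i%:R * (3 / r).
  rewrite (xE 3); apply: ler_pM => //; first by rewrite invr_ge0 ltW.
  by have := pos 3%N; lra.
have -> : i%:R * (1 + 240 / r) = i%:R + 80 * (i%:R * (3 / r)) by ring.
have -> : (x + 2) ^+ 4 = x ^+ 4 + 8 * x ^+ 3 + 24 * x ^+ 2 + 32 * x + 16 by ring.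
lra.
Qed.

(** The event that from vertex N to vertex n the birth times are of the order of
    their indices, with relative error of order i^(-1/4). It is determined by the
    past of vertex n. *)
Definition controlled (N n : nat) : set Omega :=
  [set w | forall i, (N <= i <= n)%N ->
     i%:R / (1 + 69 / root4 R i) <= (V i w).2 <= i%:R * (1 + 240 / root4 R i)].

Lemma block_exists L i : (L.+1 ^ 3 * L.+2 <= i)%N ->
  exists2 l, (L <= l <= i)%N & (l.+1 ^ 3 * l.+2 <= i < l.+2 ^ 3 * l.+3)%N.
Proof.
move=> Li; pose Q l := (l.+1 ^ 3 * l.+2 <= i)%N.
have Qb l : Q l -> (l <= i)%N.
  apply: leq_trans; apply: (@leq_trans l.+2); first by do 2 apply: leqW.
  by rewrite leq_pmull// expn_gt0.
have [l Ql lmax] := ex_maxnP (ex_intro Q L Li) Qb.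
exists l; first by rewrite (lmax _ Li) (Qb _ Ql).
by rewrite -/(Q l) Ql ltnNge; apply/negP => /lmax; rewrite ltnn.
Qed.

Lemma sum_inv_sqr L M : (0 < L)%N ->
  \sum_(i < M) ((L + i).+1%:R ^+ 2)^-1 <= L%:R^-1 :> R.
Proof.
move=> L0; suff : \sum_(i < M) ((L + i).+1%:R ^+ 2)^-1 <= L%:R^-1 - (L + M)%:R^-1 :> R.
  by move/le_trans; apply; rewrite gerBl invr_ge0.
elim: M => [|M IH]; first by rewrite big_ord0 addn0 subrr.
rewrite big_ord_recr/=; apply: (le_trans (lerD IH (lexx _))).
rewrite addnS -[(L + M).+1%:R]natr1; set y : R := (L + M)%:R.
have y0 : 0 < y by rewrite ltr0n addn_gt0 L0.
suff : ((y + 1) ^+ 2)^-1 <= y^-1 - (y + 1)^-1 by lra.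
have -> : y^-1 - (y + 1)^-1 = (y * (y + 1))^-1 by field; rewrite !gt_eqF//; lra.
by rewrite lef_pV2 ?posrE ?mulr_gt0 ?exprn_gt0; nra.
Qed.

Lemma measurable_controlled N n : measurable (controlled N n).
Proof.
have -> : controlled N n = \bigcap_(i in [set i | (N <= i <= n)%N])
   ([set w | i%:R / (1 + 69 / root4 R i) <= (V i w).2] `&`
    [set w | (V i w).2 <= i%:R * (1 + 240 / root4 R i)]).
  apply/seteqP; split=> w /= h i /= iN; first by have /andP[] := h i iN.
  by have [/= -> ->] := h i iN.
apply: bigcap_measurableType => i _.
by apply: measurableI; exact: measurable_ler_set.
Qed.

(** The probabilities of the complements of the windows are summable, so only the
    beginning of the sequence has to be discarded. *)
Lemma probability_controlled (delta : R) : 0 < delta ->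
  exists2 N, (0 < N)%N & forall n, (P (~` controlled N n) <= delta%:E)%E.
Proof.
move=> d0; pose L := (Num.bound (2 / delta)).+1.
have Ld : 2 / L%:R <= delta.
  have L0 : 0 < L%:R :> R by rewrite ltr0n.
  rewrite ler_pdivrMr// mulrC -ler_pdivrMr//.
  apply/ltW/(lt_le_trans (archi_boundP _)); first by rewrite divr_ge0// ltW.
  by rewrite ler_nat.
exists (L.+1 ^ 3 * L.+2)%N; first by rewrite muln_gt0 expn_gt0.
move=> n; pose F i := ~` window (L + i).
have mF i : measurable (F i) by apply: measurableC; exact: measurable_window.
apply: (@le_trans _ _ (P (\big[setU/set0]_(i < n.+3) F i))).
  apply: le_measure; rewrite ?inE.
  - by apply: measurableC; exact: measurable_controlled.
  - by apply: bigsetU_measurable.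
  rewrite -bigcup_mkord => w; apply: contra_notP => h /= i /andP[iN iln].
  have hw l : (L <= l)%N -> (l < L + n.+3)%N -> window l w.
    move=> Ll ll; apply: contra_notP h => h; exists (l - L)%N => /=.
      by rewrite ltn_subLR.
    by rewrite /F subnKC.
  have [l /andP[Ll li] hl] := block_exists iN.
  have ln := leq_trans li iln.
  apply: (window_bounds _ _ hl); apply: hw => //.
  - by clear -ln; lia.
  - by rewrite !leqW.
  - by clear -ln; lia.
have boole : (P (\big[setU/set0]_(i < n.+3) F i) <= \sum_(i < n.+3) P (F i))%E.
  by apply: Boole_inequality.
apply: (le_trans boole).
apply: (@le_trans _ _ (\sum_(i < n.+3) (2 / (L + i).+1%:R ^+ 2)%:E)%E).
  by apply: lee_sum => i _; exact: probability_window.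
rewrite sumEFin lee_fin -mulr_sumr; apply: le_trans Ld.
by rewrite ler_pM2l// sum_inv_sqr.
Qed.

End birth_times.

(** * Concentration of the tail counts *)

Section vanishing.
Context (R : realType).

Lemma root4_unbounded (c : R) : exists M, forall n, (M <= n)%N -> c <= root4 R n.
Proof.
pose b := Num.bound `|c|; exists (b ^ 4)%N => n bn.
have cb : c <= b%:R.
  by apply: (le_trans (ler_norm c)); apply/ltW/archi_boundP; exact: normr_ge0.
apply: (le_trans cb); rewrite -(@ler_pXn2r _ 4)// ?nnegrE ?ler0n ?sqrtr_ge0//.
by rewrite root4X -natrX ler_nat.
Qed.

Lemma div_root4_vanishing (c eps : R) : 0 <= c -> 0 < eps ->
  exists M, forall n, (M <= n)%N -> c / root4 R n <= eps.
Proof.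
move=> c0 e0; have [M HM] := root4_unbounded (c / eps).
exists (maxn M 1) => n; rewrite geq_max => /andP[Mn n1].
have r0 : 0 < root4 R n by rewrite (lt_le_trans ltr01)// root4_ge1.
by rewrite ler_pdivrMr// mulrC -ler_pdivrMr// HM.
Qed.

Lemma common_threshold (Q : nat -> nat -> Prop) K :
  (forall k, exists M, forall n, (M <= n)%N -> Q k n) ->
  exists M, forall k n, (k < K)%N -> (M <= n)%N -> Q k n.
Proof.
move=> QM; elim: K => [|K [M HM]]; first by exists 0%N.
have [M' HM'] := QM K; exists (maxn M M') => k n kK.
rewrite geq_max => /andP[Mn M'n]; move: kK; rewrite ltnS leq_eqVlt.
by move=> /predU1P[->|kK]; [exact: HM'|exact: HM].
Qed.

End vanishing.

Section concentration.
Context d (Omega : measurableType d) (R : realType) (P : probability Omega R).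
Context (phi : R -> R) (f : nat -> R).
Context (V : nat -> Omega -> R * R) (E : nat -> nat -> Omega -> bool).
Hypothesis phi_range : forall x : R, 0 <= x -> 0 <= phi x <= 1.
Hypothesis phi_nonincreasing : forall x y : R, 0 <= x -> x <= y -> phi y <= phi x.
Hypothesis phi_integral :
  (\int[@lebesgue_measure R]_(x in `[0%R, +oo[) (phi x)%:E = (1 / 2)%:E)%E.
Hypothesis f_gt0 : forall k, 0 < f k.
Hypothesis model : is_spatial_pa P phi f V E.
Hypothesis V_lt : forall n w, (V n w).2 < (V n.+1 w).2.
Context (N : nat).
Hypothesis N_gt0 : (0 < N)%N.

Local Notation Ex := (Ex P).
Local Notation rate := (attachment_rate phi f).
Local Notation S k n w := ((tail_count E k n w)%:R : R).
Local Notation sigma := (limit_tail f).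
Local Notation B n := (controlled V N n).
Local Notation early n := (1 + 69 / root4 R n).
Local Notation late n := (1 + 240 / root4 R n).

Let mV := spa_vertex_measurable model.
Let mB n : measurable (B n). Proof. exact: measurable_controlled. Qed.

Lemma past_controlled n : <<s past_gen V E n n >> (B n).
Proof.
have mT i : (i <= n)%N -> measurable_fun
    (setT : set (g_sigma_algebraType (past_gen V E n n))) (fun w => (V i w).2).
  by move=> iln; exact: past_birth.
suff : measurable (B n : set (g_sigma_algebraType (past_gen V E n n))) by [].
rewrite (_ : B n = \bigcap_(i in [set i | (N <= i <= n)%N])
   ([set w | i%:R / early i <= (V i w).2] `&` [set w | (V i w).2 <= i%:R * late i])).
  apply: bigcap_measurableType => i /= /andP[_ iln].
  by apply: measurableI; apply: measurable_ler_set => //; exact: mT.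
apply/seteqP; split=> w /= h i /= iN; first by have /andP[] := h i iN.
by have [/= -> ->] := h i iN.
Qed.

Lemma controlled_nonincreasing n m : (n <= m)%N -> B m `<=` B n.
Proof.
by move=> nm w h i /andP[Ni iln]; apply: h; rewrite Ni (leq_trans iln).
Qed.

Lemma indic_controlledS n w : \1_(B n.+1) w <= \1_(B n) w :> R.
Proof.
rewrite !indicE ler_nat; case: (boolP (w \in B n.+1)) => // /set_mem h.
by rewrite mem_set//; exact: (controlled_nonincreasing (leqnSn n)).
Qed.

Let r1 n : (N <= n)%N -> 1 <= root4 R n.
Proof. by move=> Nn; rewrite root4_ge1// (leq_trans N_gt0). Qed.

Let n0 n : (N <= n)%N -> 0 < n%:R :> R.
Proof. by move=> Nn; rewrite ltr0n (leq_trans N_gt0). Qed.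

Let early_bounds n : (N <= n)%N -> 1 <= early n <= 70.
Proof.
move=> /r1 r1n; have r0 : 0 < root4 R n by lra.
rewrite lerDl divr_ge0 ?(ltW r0)//=.
have : 69 / root4 R n <= 69 by rewrite ler_pdivrMr//; nra.
lra.
Qed.

(** A deterministic bound, on [controlled], for the relative deviation of the
    attachment rate at step n from f k / n; the 70 is the value of the factor
    1 + 69 / n^(1/4) at its largest. *)
Definition rate_error k n : R :=
  69 / root4 R n + (1 - profile_mass phi (n%:R / 70 / f k) / late n).

Lemma rate_error_ge k n w : (N <= n)%N -> B n w ->
  `|n%:R * rate k (V n w).2 / f k - 1| <= rate_error k n.
Proof.
move=> Nn Bw; have /andP[lo hi] : n%:R / early n <= (V n w).2 <= n%:R * late n.
  by apply: Bw; rewrite Nn leqnn.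
have /andP[e1 e70] := early_bounds Nn.
set T := (V n w).2 in lo hi *; have nn0 := n0 Nn; have rn1 := r1 Nn.
have r0 : 0 < root4 R n by lra.
have e0 : 0 < early n by lra.
have q0 : 0 <= 240 / root4 R n by rewrite divr_ge0// ltW.
have l0 : 0 < late n by lra.
have T0 : 0 < T by apply: lt_le_trans lo; rewrite divr_gt0.
have fk := f_gt0 k.
set c := profile_mass phi (T / f k).
have c0 : 0 <= c by exact: profile_mass_ge0.
have c1 : c <= 1 by exact: profile_mass_le1.
have -> : n%:R * rate k T / f k = n%:R / T * c.
  by rewrite /attachment_rate -/c; field; rewrite !gt_eqF.
have up : n%:R / T <= early n.
  by rewrite ler_pdivrMr// mulrC -ler_pdivrMr.
have dn : (late n)^-1 <= n%:R / T.
  by rewrite ler_pdivlMr// mulrC ler_pdivrMr.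
have cc : profile_mass phi (n%:R / 70 / f k) <= c.
  apply: profile_mass_nondecreasing => //.
  rewrite ler_pM2r ?invr_gt0//; apply: le_trans lo.
  by rewrite ler_pM2l// lef_pV2 ?posrE//; lra.
set c' := profile_mass phi _ in cc.
have c'0 : 0 <= c' by exact: profile_mass_ge0.
have li0 : 0 < (late n)^-1 by rewrite invr_gt0.
have li1 : (late n)^-1 <= 1 by rewrite invf_le1//; lra.
have h1 : c' / late n <= n%:R / T * c.
  rewrite mulrC; apply: ler_pM => //; lra.
have h2 : n%:R / T * c <= early n * 1.
  by apply: ler_pM => //; rewrite divr_ge0// ltW.
have h3 : c' / late n <= 1 * 1 by apply: ler_pM => //; lra.
rewrite /rate_error -/c'.
have q : 0 <= 69 / root4 R n by rewrite divr_ge0// ltW.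
rewrite ler_norml; apply/andP; split; lra.
Qed.

Lemma rate_error_vanishing k (eps : R) : 0 < eps ->
  exists M, forall n, (M <= n)%N -> `|rate_error k n| <= eps.
Proof.
move=> e0; pose e := Num.min 1 (eps / 3).
have e'0 : 0 < e by rewrite lt_min ltr01/= divr_gt0.
have [M1 H1] := @div_root4_vanishing R 69 e (ltW (ltr0Sn _ _)) e'0.
have [M2 H2] := @div_root4_vanishing R 240 e (ltW (ltr0Sn _ _)) e'0.
have [a a0 Ha] := profile_mass_cvg phi_range phi_nonincreasing phi_integral e'0.
pose M3 := Num.bound (a * f k * 70).
exists (maxn N (maxn M1 (maxn M2 M3))) => n.
rewrite !geq_max => /and4P[Nn M1n M2n M3n].
have := H1 n M1n; have := H2 n M2n; have nn0 := n0 Nn; have rn1 := r1 Nn.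
have r0 : 0 < root4 R n by lra.
have q0 : 0 <= 240 / root4 R n by rewrite divr_ge0// ltW.
have q : 0 <= 69 / root4 R n by rewrite divr_ge0// ltW.
have fk := f_gt0 k.
have : 1 - e <= profile_mass phi (n%:R / 70 / f k).
  apply: Ha; rewrite ler_pdivlMr// ler_pdivlMr//.
  apply/ltW/(@lt_le_trans _ _ M3%:R); last by rewrite ler_nat.
  by apply: archi_boundP; rewrite !mulr_ge0// ltW.
have : profile_mass phi (n%:R / 70 / f k) <= 1 by exact: profile_mass_le1.
have : 0 <= profile_mass phi (n%:R / 70 / f k) by exact: profile_mass_ge0.
have e1 : e <= 1 by rewrite /e ge_min lexx.
have e3 : e <= eps / 3 by rewrite /e ge_min lexx orbT.
rewrite /rate_error; set c := profile_mass _ _; set x := 240 / _ in q0 *; set y := 69 / _ in q *.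
clearbody e c x y => c0 c1 ce xe ye.
have l0 : 0 < 1 + x by lra.
have h1 : c / (1 + x) <= 1 by rewrite ler_pdivrMr//; lra.
have h2 : 1 - 2 * e <= c / (1 + x).
  by rewrite ler_pdivlMr//; nra.
by rewrite ler_norml; apply/andP; split; lra.
Qed.

(** The event restricts the expectation instead of conditioning it: the events
    [controlled V N n] decrease with n and belong to the past, so one-step
    estimates chain. *)
Definition mean_square k n : R :=
  Ex (fun w => \1_(B n) w * (S k n w - n%:R * sigma k) ^+ 2).

Let bS k n := bounded_rv_tail_count model k n.

Let bD k n (c : R) : bounded_rv (fun w => \1_(B n) w * (S k n w - c) ^+ 2).
Proof.
apply: bounded_rvM; first exact: bounded_rv_indic.
by apply: bounded_rvX; apply: bounded_rvB => //; exact: bounded_rv_cst.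
Qed.

Lemma mean_square_ge0 k n : 0 <= mean_square k n.
Proof.
by apply: Ex_ge0 => w; rewrite mulr_ge0 ?sqr_ge0// indicE ler0n.
Qed.

(** Induction on k: the error of the k-th tail count feeds the recursion of the next
    one through [Ex_square_step], and [quadratic_growth] applies since both this
    error and the rate error vanish. For k = 0 the tail count is n. *)
Lemma mean_square_vanishing k (eps : R) : 0 < eps ->
  exists M, forall n, (M <= n)%N -> mean_square k n <= eps * n%:R ^+ 2.
Proof.
elim: k eps => [|k IH] eps e0.
  exists 0%N => n _; rewrite /mean_square.
  rewrite (@eq_Ex _ _ _ _ _ (fun=> 0)); last first.
    by move=> w; rewrite tail_count0 limit_tail0 mulr1 subrr expr0n mulr0.
  by rewrite Ex_cst mulr_ge0 ?sqr_ge0// ltW.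
have fk := f_gt0 k.
pose a : R := 70 * f k.
have a0 : 0 <= a by rewrite mulr_ge0// ltW.
pose b n : R := 2 * (a / n%:R) ^+ 2 * mean_square k n + 2 * rate_error k n ^+ 2.
apply: (@quadratic_growth R (mean_square k.+1) b (a + a ^+ 2) N) e0 => //.
- exact: mean_square_ge0.
- by rewrite addr_ge0 ?sqr_ge0.
- move=> n Nn; have nn0 := n0 Nn.
  have /andP[e1 e70] := early_bounds Nn.
  (* A crude lower bound for the birth time, so that f k / t0 is exactly a / n. *)
  pose t0 : R := n%:R / 70.
  have t00 : 0 < t0 by rewrite divr_gt0.
  have fa : f k / t0 = a / n%:R by rewrite /t0 /a; field; rewrite !gt_eqF.
  have s1 : 0 <= sigma k.+1 <= 1.
    by rewrite limit_tail_le1// andbT; exact/ltW/limit_tail_gt0.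
  have step := Ex_square_step phi_range phi_nonincreasing phi_integral f_gt0 model
    V_lt (@past_controlled n) (leq_trans N_gt0 Nn) t00 (limit_tail_balance f_gt0 k) s1.
  have /step {}step : forall w, B n w -> t0 <= (V n w).2.
    move=> w Bw; have /andP[lo _] : n%:R / early n <= (V n w).2 <= n%:R * late n.
      by apply: Bw; rewrite Nn leqnn.
    apply: le_trans lo; rewrite ler_pM2l// lef_pV2 ?posrE//; lra.
  have {}step := step (rate_error k n) (fun w => @rate_error_ge k n w Nn).
  rewrite fa in step; have na : n%:R * (a / n%:R) = a by field; rewrite gt_eqF.
  rewrite na in step; apply: le_trans step; apply: le_Ex.
  + exact: bD.
  + apply: bounded_rvM; first exact: bounded_rv_indic.
    by apply: bounded_rvX; apply: bounded_rvB => //; exact: bounded_rv_cst.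
  + by move=> w; rewrite ler_wpM2r ?sqr_ge0// indic_controlledS.
- move=> eps' e'0.
  pose e1 := eps' / (4 * (a ^+ 2 + 1)).
  have a21 : 0 < a ^+ 2 + 1 by rewrite ltr_wpDl ?sqr_ge0.
  have e10 : 0 < e1 by rewrite divr_gt0// mulr_gt0.
  pose e2 := Num.min 1 (eps' / 4).
  have e20 : 0 < e2 by rewrite lt_min ltr01/= divr_gt0.
  have [M1 H1] := IH _ e10; have [M2 H2] := rate_error_vanishing k e20.
  exists (maxn N (maxn M1 M2)) => n; rewrite !geq_max => /and3P[Nn M1n M2n].
  have nn0 := n0 Nn.
  have h1 : 2 * (a / n%:R) ^+ 2 * mean_square k n <= eps' / 2.
    have -> : 2 * (a / n%:R) ^+ 2 * mean_square k n =
        2 * a ^+ 2 * (mean_square k n / n%:R ^+ 2) by field; rewrite gt_eqF.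
    have hd : mean_square k n / n%:R ^+ 2 <= e1.
      by rewrite ler_pdivrMr ?exprn_gt0// H1.
    apply: (@le_trans _ _ (2 * (a ^+ 2 + 1) * e1)).
      apply: ler_pM => //.
      - by rewrite mulr_ge0 ?sqr_ge0.
      - by rewrite divr_ge0 ?mean_square_ge0 ?sqr_ge0.
      - lra.
    rewrite /e1 le_eqVlt; apply/orP; left; apply/eqP; field.
    by rewrite gt_eqF.
  have h2 : rate_error k n ^+ 2 <= eps' / 4.
    rewrite -(real_normK (num_real _)) expr2.
    apply: (@le_trans _ _ (1 * (eps' / 4))); last by rewrite mul1r.
    have e21 : e2 <= 1 by rewrite /e2 ge_min lexx.
    have e24 : e2 <= eps' / 4 by rewrite /e2 ge_min lexx orbT.
    have := H2 n M2n => h'.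
    by apply: ler_pM => //; rewrite (le_trans h').
  by rewrite /b; lra.
Qed.

(** The means of the tail counts satisfy the hypotheses of [tail_recursion] with the
    lower bound of [controlled] on the birth times. *)
Lemma Ex_tail_count_le : exists A : R, 0 <= A /\ forall k n, (N <= n)%N ->
  Ex (fun w => \1_(B n) w * S k n w) <= A * sigma k * n%:R.
Proof.
have bI k n m : bounded_rv (fun w => \1_(B m) w * S k n w).
  by apply: bounded_rvM => //; exact: bounded_rv_indic.
have le1 n w : \1_(B n) w <= 1 :> R by rewrite indicE; case: (_ \in _).
apply: (@tail_recursion R f f_gt0 (fun k n => Ex (fun w => \1_(B n) w * S k n w))
  (fun n => n%:R / early n) N) => //.
- move=> n Nn; have /andP[e1 _] := early_bounds Nn; have nn0 := n0 Nn.
  have e0 : 0 < early n by lra.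
  split; first by rewrite divr_gt0.
  by rewrite invf_div mulrC divfK// gt_eqF.
- move=> n; rewrite -[leRHS](Ex_cst P); apply: le_Ex => //; first exact: bounded_rv_cst.
  by move=> w; rewrite tail_count0 -[leRHS]mul1r ler_wpM2r.
- move=> k; rewrite -[leRHS](Ex_cst P); apply: le_Ex => //; first exact: bounded_rv_cst.
  move=> w; rewrite -[leRHS]mul1r; apply: ler_pM => //.
  by rewrite ler_nat tail_count_le.
- move=> k Nk; rewrite (@eq_Ex _ _ _ _ _ (fun=> 0)) ?Ex_cst//.
  by move=> w; rewrite tail_count_eq0// mulr0.
- move=> k n Nn; have /andP[e1 _] := early_bounds Nn; have nn0 := n0 Nn.
  have e0 : 0 < early n by lra.
  apply: (@le_trans _ _ (Ex (fun w => \1_(B n) w * S k.+1 n.+1 w))).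
    by apply: le_Ex => // w; rewrite ler_wpM2r// indic_controlledS.
  apply: (Ex_tail_count_step phi_range phi_nonincreasing phi_integral f_gt0 model
    V_lt _ (@past_controlled n)); first by rewrite divr_gt0.
  move=> w Bw.
  have /andP[] : n%:R / early n <= (V n w).2 <= n%:R * late n; last by [].
  by apply: Bw; rewrite Nn leqnn.
Qed.

End concentration.

(** * Unbounded functions of the degree *)

Section pairings.
Context (R : realType).
Implicit Types lam g : nat -> R.

Lemma pairing_cvg lam g (l : R) :
  \sum_(k < n) lam k * g k @[n --> \oo] --> l -> pairing lam g = l%:E.
Proof.
move=> h; rewrite /pairing; apply/cvg_lim => //.
have -> : (fun n => (\sum_(0 <= k < n) (lam k * g k)%:E)%E) =
    EFin \o (fun n => \sum_(k < n) lam k * g k).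
  by apply/funext => n /=; rewrite sumEFin big_mkord.
by apply: cvg_EFin => //; near=> n.
Unshelve. all: by end_near. Qed.

Lemma partial_sum_le_pairing lam g : (forall k, 0 <= lam k * g k) ->
  (pairing lam g < +oo)%E ->
  exists M : R, forall n, \sum_(k < n) lam k * g k <= M.
Proof.
move=> h0 hoo; have p0 : (0 <= pairing lam g)%E.
  by apply: nneseries_ge0 => k _ _; rewrite lee_fin.
have pf : pairing lam g \is a fin_num by rewrite ge0_fin_numE.
exists (fine (pairing lam g)) => n; rewrite -lee_fin fineK// -sumEFin -(big_mkord xpredT
  (fun k => (lam k * g k)%:E)).
by apply: nneseries_lim_ge => k _ _; rewrite lee_fin.
Qed.

End pairings.

Section weighted_tail.
Context (R : realType) (s g : nat -> R) (l : R).
Hypothesis s_ge0 : forall k, 0 <= s k.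
Hypothesis s_nonincreasing : forall k, s k.+1 <= s k.
Hypothesis s_cvg0 : s n @[n --> \oo] --> (0 : R).
Hypothesis g_ge0 : forall k, 0 <= g k.
Hypothesis g_nondecreasing : forall i j, (i <= j)%N -> g i <= g j.
Hypothesis g_mean : \sum_(k < n) (s k - s k.+1) * g k @[n --> \oo] --> l.

Lemma increment_ge0 k : 0 <= increment g k.
Proof. by case: k => [|k] /=; rewrite ?subr_ge0 ?g_nondecreasing. Qed.

Lemma sum_increment d : \sum_(k < d.+1) increment g k = g d.
Proof.
elim: d => [|d IH]; first by rewrite big_ord1.
by rewrite big_ord_recr/= IH addrC subrK.
Qed.

Let term0 k : 0 <= (s k - s k.+1) * g k.
Proof. by rewrite mulr_ge0// subr_ge0. Qed.

Let partial_le n : \sum_(k < n) (s k - s k.+1) * g k <= l.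
Proof.
rewrite -(cvg_lim _ g_mean)//; apply: nondecreasing_cvgn_le; last exact: cvgP g_mean.
by apply/nondecreasing_seqP => i; rewrite big_ord_recr/= lerDl.
Qed.

(** Abel's summation adds the boundary term s K.+1 * g K to the partial sum; by
    monotonicity of g it is at most the remainder of the series. *)
Lemma weighted_tail_le K : \sum_(k < K.+1) increment g k * s k <= l.
Proof.
rewrite abel_sum; set p := \sum_(k < _) _.
have key M : p + (s K.+1 - s (K.+1 + M)%N) * g K <= l.
  apply: (@le_trans _ _ (\sum_(k < K.+1 + M) (s k - s k.+1) * g k)); last exact: partial_le.
  elim: M => [|M IH]; first by rewrite addn0 subrr mul0r addr0.
  rewrite addnS big_ord_recr/=; apply: le_trans (lerD IH (lexx _)).
  have h : (s (K.+1 + M)%N - s (K.+1 + M).+1) * g K <=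
           (s (K.+1 + M)%N - s (K.+1 + M).+1) * g (K.+1 + M)%N.
    by rewrite ler_wpM2l ?subr_ge0// g_nondecreasing// (leq_trans (leqnSn K)) // leq_addr.
  lra.
have cv : p + (s K.+1 - s (K.+1 + M)%N) * g K @[M --> \oo] --> p + (s K.+1 - 0) * g K.
  apply: cvgD; first exact: cvg_cst.
  apply: cvgMl; apply: cvgB; first exact: cvg_cst.
  under eq_fun do rewrite addnC.
  by have := s_cvg0; rewrite -(cvg_shiftn K.+1).
rewrite subr0 in cv; rewrite -(cvg_lim _ cv)//; apply: limr_le; first exact: cvgP cv.
by near=> n; exact: key.
Unshelve. all: by end_near. Qed.

Lemma weighted_tail_ge (eps : R) : 0 < eps ->
  exists K, l - eps <= \sum_(k < K.+1) increment g k * s k.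
Proof.
move=> e0; have /cvgrPdist_le/(_ _ e0)[K _ HK] := g_mean.
exists K; rewrite abel_sum; have := HK K.+1 (leqnSn _) => /=.
rewrite ler_norml => /andP[_ h].
have : 0 <= s K.+1 * g K by rewrite mulr_ge0.
lra.
Qed.

End weighted_tail.

Section mean_convergence.
Context d (Omega : measurableType d) (R : realType) (P : probability Omega R).
Context (phi : R -> R) (f : nat -> R).
Context (V : nat -> Omega -> R * R) (E : nat -> nat -> Omega -> bool).
Hypothesis phi_range : forall x : R, 0 <= x -> 0 <= phi x <= 1.
Hypothesis phi_nonincreasing : forall x y : R, 0 <= x -> x <= y -> phi y <= phi x.
Hypothesis phi_integral :
  (\int[@lebesgue_measure R]_(x in `[0%R, +oo[) (phi x)%:E = (1 / 2)%:E)%E.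
Hypothesis f_gt0 : forall k, 0 < f k.
Hypothesis model : is_spatial_pa P phi f V E.
Hypothesis V_lt : forall n w, (V n w).2 < (V n.+1 w).2.
Context (N : nat).
Hypothesis N_gt0 : (0 < N)%N.
Context (g : nat -> R) (l : R).
Hypothesis g_ge0 : forall k, 0 <= g k.
Hypothesis g_nondecreasing : forall i j, (i <= j)%N -> g i <= g j.

Local Notation Ex := (Ex P).
Local Notation S k n w := ((tail_count E k n w)%:R : R).
Local Notation sigma := (limit_tail f).
Local Notation B n := (controlled V N n).
Local Notation W K := (\sum_(k < K.+1) increment g k * sigma k).

Hypothesis W_le : forall K, W K <= l.
Hypothesis W_ge : forall eps, 0 < eps -> exists K, l - eps <= W K.

(** The unnormalised empirical mean of g over the n oldest vertices. *)
Definition degree_sum n w : R := \sum_(m < n) g (degree E m n w).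

Lemma degree_sumE n w : degree_sum n w = \sum_(k < n.+1) increment g k * S k n w.
Proof.
rewrite /degree_sum.
under eq_bigr => m _.
  have -> : g (degree E m n w) =
      \sum_(k < n.+1) increment g k * (k <= degree E m n w)%N%:R.
    rewrite -sum_increment (big_ord_widen n.+1 (increment g)); last first.
      by rewrite ltnS degree_le.
    rewrite big_mkcond; apply: eq_bigr => k _; rewrite ltnS.
    by case: leqP; rewrite ?mulr1 ?mulr0.
  over.
rewrite exchange_big/=; apply: eq_bigr => k _.
by rewrite -mulr_sumr /tail_count natr_sum.
Qed.

Let inc0 k : 0 <= increment g k. Proof. exact: increment_ge0. Qed.

Lemma degree_sum_mono n m w : (n <= m)%N -> degree_sum n w <= degree_sum m w.
Proof.
move: n m; apply/(@nondecreasing_seqP _ R (fun n => degree_sum n w)) => n.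
rewrite !degree_sumE [leRHS]big_ord_recr/= -[leLHS]addr0; apply: lerD; last first.
  by rewrite mulr_ge0 ?subr_ge0 ?g_nondecreasing.
by apply: ler_sum => k _; rewrite ler_wpM2l// ler_nat tail_count_mono.
Qed.

Let mB n : measurable (B n).
Proof. exact: measurable_controlled (spa_vertex_measurable model) _ _. Qed.

Let bS k n := bounded_rv_tail_count model k n.

Lemma bounded_rv_degree_sum n : bounded_rv (fun w => degree_sum n w).
Proof.
under eq_fun do rewrite degree_sumE.
by apply: bounded_rv_sum => k _; apply: bounded_rvZ.
Qed.

Lemma norm_le_square (x c : R) : 0 < c -> `|x| <= c + c^-1 * x ^+ 2.
Proof.
move=> c0; rewrite -[x ^+ 2]real_normK ?num_real//; set y := `|x|.
rewrite -(ler_pM2l c0) mulrDr mulrA divff ?gt_eqF// mul1r.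
have : 0 <= (c - y) ^+ 2 + c * y by rewrite addr_ge0 ?sqr_ge0// mulr_ge0 ?(ltW c0) ?normr_ge0.
by nra.
Qed.

(** The sum over the degrees is a combination of tail counts with nonnegative
    coefficients. Up to a fixed K, concentration in mean square handles each of
    them; beyond K, the uniform bound on the means of the tail counts leaves a
    multiple of the remainder of the series of the limit mean. *)
Lemma mean_abs_vanishing (eps : R) : 0 < eps -> exists M, forall n, (M <= n)%N ->
  Ex (fun w => \1_(B n) w * `|degree_sum n w - n%:R * l|) <= eps * n%:R.
Proof.
move=> e0; have [A [A0 HA]] := Ex_tail_count_le phi_range phi_nonincreasing
  phi_integral f_gt0 model V_lt N_gt0.
have A1 : 0 < A + 1 by rewrite ltr_wpDl.
have [K HK] := W_ge (divr_gt0 e0 (mulr_gt0 (ltr0Sn R 1) A1)).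
have gK1 : 0 < g K + 1 by rewrite ltr_wpDl.
pose theta := eps / (4 * (g K + 1)).
have th0 : 0 < theta by rewrite divr_gt0// mulr_gt0.
have th20 : 0 < theta ^+ 2 by rewrite exprn_gt0.
have [M HM] := @common_threshold
  (fun k n => mean_square P f V E N k n <= theta ^+ 2 * n%:R ^+ 2) K.+1
  (fun k => mean_square_vanishing phi_range phi_nonincreasing phi_integral
     f_gt0 model V_lt N_gt0 k th20).
exists (maxn M (maxn N K.+1)) => n; rewrite !geq_max => /and3P[Mn Nn Kn].
have n0 : 0 < n%:R :> R by rewrite ltr0n (leq_trans N_gt0).
have c0 : 0 < theta * n%:R by rewrite mulr_gt0.
set c := theta * n%:R in c0.
have i1 w : \1_(B n) w <= 1 :> R by rewrite indicE; case: (_ \in _).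
have i0 w : 0 <= \1_(B n) w :> R by rewrite indicE.
(* |x| <= c + x^2 / c with c = theta * n turns the mean square bound into a bound of
   order theta * n. *)
pose Y k w : R := c + c^-1 * (\1_(B n) w * (S k n w - n%:R * sigma k) ^+ 2).
pose Z k w : R := \1_(B n) w * S k n w.
have bD k : bounded_rv (fun w => \1_(B n) w * (S k n w - n%:R * sigma k) ^+ 2).
  apply: bounded_rvM; first exact: bounded_rv_indic.
  by apply: bounded_rvX; apply: bounded_rvB => //; exact: bounded_rv_cst.
have bY k : bounded_rv (Y k).
  by apply: bounded_rvD; [exact: bounded_rv_cst|exact: bounded_rvZ].
have bZ k : bounded_rv (Z k).
  by apply: bounded_rvM => //; exact: bounded_rv_indic.
have EY k : (k < K.+1)%N -> Ex (Y k) <= 2 * c.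
  move=> kK; rewrite ExD; [|exact: bounded_rv_cst|exact: bounded_rvZ].
  rewrite Ex_cst ExZ//; have := HM k n kK Mn; rewrite /mean_square => h.
  have : c^-1 * Ex (fun w => \1_(B n) w * (S k n w - n%:R * sigma k) ^+ 2) <= c.
    by rewrite mulrC ler_pdivrMr// -expr2 /c exprMn.
  by lra.
pose U w := \sum_(0 <= k < K.+1) increment g k * Y k w +
  \sum_(K.+1 <= k < n.+1) increment g k * Z k w + n%:R * (l - W K).
have bU1 : bounded_rv (fun w => \sum_(0 <= k < K.+1) increment g k * Y k w).
  by apply: bounded_rv_sum => k _; exact: bounded_rvZ.
have bU2 : bounded_rv (fun w => \sum_(K.+1 <= k < n.+1) increment g k * Z k w).
  by apply: bounded_rv_sum => k _; exact: bounded_rvZ.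
have bU : bounded_rv U.
  by apply: bounded_rvD; [exact: bounded_rvD|exact: bounded_rv_cst].
have KN : (K.+1 <= n.+1)%N by exact: leqW.
have split_at (F : nat -> R) : \sum_(k < n.+1) F k =
    \sum_(0 <= k < K.+1) F k + \sum_(K.+1 <= k < n.+1) F k.
  by rewrite -(big_mkord xpredT F) (big_cat_nat _ KN).
apply: (@le_trans _ _ (Ex U)).
  apply: le_Ex => //.
    apply: bounded_rvM; first exact: bounded_rv_indic.
    apply: bounded_rv_norm; apply: bounded_rvB; last exact: bounded_rv_cst.
    exact: bounded_rv_degree_sum.
  move=> w; rewrite degree_sumE (split_at (fun k => increment g k * S k n w)).
  have -> : n%:R * l = \sum_(0 <= k < K.+1) increment g k * (n%:R * sigma k) +
      n%:R * (l - W K).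
    rewrite -(big_mkord xpredT (fun k => increment g k * sigma k)) mulrBr mulr_sumr.
    rewrite addrCA (eq_bigr (fun k => n%:R * (increment g k * sigma k))).
      by rewrite subrr addr0.
    by move=> k _; rewrite mulrCA.
  set a := \sum_(0 <= k < K.+1) _; set a' := \sum_(0 <= k < K.+1) _.
  set b := \sum_(K.+1 <= k < n.+1) _; set q := n%:R * _.
  have b0 : 0 <= b by apply: sumr_ge0 => k _; rewrite mulr_ge0.
  have q0 : 0 <= q by rewrite mulr_ge0 ?subr_ge0 ?W_le ?(ltW n0).
  have h : `|a + b - (a' + q)| <= `|a - a'| + b + q.
    have -> : a + b - (a' + q) = (a - a') + (b - q) by ring.
    rewrite (le_trans (ler_normD _ _))// -addrA lerD2l ler_norml; lra.
  apply: (le_trans (ler_wpM2l (i0 w) h)); rewrite !mulrDr /U -/q.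
  apply: lerD; last by rewrite ler_piMl.
  apply: lerD.
    rewrite /a /a' -sumrB; apply: (@le_trans _ _
      (\1_(B n) w * \sum_(0 <= k < K.+1) increment g k * `|S k n w - n%:R * sigma k|)).
      apply: ler_wpM2l => //; apply: (le_trans (ler_norm_sum _ _ _)).
      by apply: ler_sum => k _; rewrite -mulrBr normrM (ger0_norm (inc0 k)).
    rewrite mulr_sumr; apply: ler_sum => k _; rewrite mulrCA ler_wpM2l// /Y.
    apply: (le_trans (ler_wpM2l (i0 w) (norm_le_square _ c0))).
    rewrite mulrDr lerD//; first by rewrite ler_piMl// ltW.
    by rewrite mulrCA.
  rewrite /b mulr_sumr; apply: ler_sum => k _.
  by rewrite /Z mulrCA.
rewrite ExD//; last exact: bounded_rv_cst; first last.
  exact: bounded_rvD.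
rewrite ExD// Ex_cst !Ex_sum; last first.
- by move=> k; exact: bounded_rvZ.
- by move=> k; exact: bounded_rvZ.
have h1 : \sum_(0 <= k < K.+1) Ex (fun w => increment g k * Y k w) <= g K * (2 * c).
  rewrite -(sum_increment g) -(big_mkord xpredT (increment g)) mulr_suml.
  by apply: ler_sum_nat => k /andP[_ kK]; rewrite ExZ// ler_wpM2l// EY.
have h2 : \sum_(K.+1 <= k < n.+1) Ex (fun w => increment g k * Z k w) <=
    A * n%:R * (l - W K).
  apply: (@le_trans _ _ (A * n%:R * \sum_(K.+1 <= k < n.+1) increment g k * sigma k)).
    rewrite mulr_sumr; apply: ler_sum => k _; rewrite ExZ//.
    apply: (le_trans (ler_wpM2l (inc0 k) (HA k n Nn))).
    by rewrite le_eqVlt; apply/orP; left; apply/eqP; ring.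
  apply: ler_wpM2l; first by rewrite mulr_ge0// ltW.
  have := W_le n; rewrite (split_at (fun k => increment g k * sigma k)).
  by rewrite -(big_mkord xpredT (fun k => increment g k * sigma k)); lra.
have h3 : g K * (2 * c) <= eps / 2 * n%:R.
  have -> : g K * (2 * c) = (g K / (g K + 1)) * (eps / 2 * n%:R).
    by rewrite /c /theta; field; rewrite gt_eqF.
  apply: ler_piMl; first by rewrite mulr_ge0// ?divr_ge0// ltW.
  by rewrite ler_pdivrMr// mul1r lerDl.
have h4 : (A + 1) * n%:R * (l - W K) <= eps / 2 * n%:R.
  have : l - W K <= eps / (2 * (A + 1)) by lra.
  have An : 0 <= (A + 1) * n%:R by rewrite mulr_ge0// ltW.
  move=> /(ler_wpM2l An) /le_trans; apply.
  rewrite le_eqVlt; apply/orP; left; apply/eqP; field.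
  by rewrite gt_eqF.
have -> : eps * n%:R = eps / 2 * n%:R + eps / 2 * n%:R by field.
have -> : n%:R * (l - W K) = (A + 1) * n%:R * (l - W K) - A * n%:R * (l - W K) by ring.
by lra.
Qed.

End mean_convergence.

(** * The empirical indegree distribution as a random variable *)

Section empirical.
Context d (Omega : measurableType d) (R : realType).
Context (V : nat -> Omega -> R * R) (E : nat -> nat -> Omega -> bool).

Lemma empirical_indegree_ge0 (t : R) w k : 0 <= empirical_indegree V E t w k.
Proof.
rewrite /empirical_indegree; case: ifP => _; first exact: ler0n.
rewrite mulr_ge0 ?invr_ge0 ?ler0n//.
by apply: fsumr_ge0 => n _; exact: ler0n.
Qed.

Section measurability.
Hypothesis mV : forall n, measurable_fun setT (V n).
Hypothesis mE : forall n m, (m < n)%N -> measurable [set w | E n m w].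

Let mT n (t : R) : measurable [set w | (V n w).2 <= t].
Proof. by apply: measurable_ler_set => //; exact: measurable_birth. Qed.

Lemma measurable_indegree (n : nat) (t : R) k :
  measurable [set w | indegree V E n t w = k].
Proof.
pose S w := [set i | [/\ (n < i)%N, (V i w).2 <= t & E i n w]].
apply: (@measurable_fset_set _ _ S [set K | #|` K|%fset = k]) => i.
have [ni|ni] := ltnP n i; last first.
  rewrite (_ : [set w | _] = set0)//; apply/seteqP; split=> w //= -[].
  by rewrite ltnNge ni.
rewrite (_ : [set w | _] = [set w | (V i w).2 <= t] `&` [set w | E i n w]).
  by apply: measurableI => //; exact: mE.
by apply/seteqP; split=> w //= -[].
Qed.

Lemma measurable_empirical_indegree (t : R) k :
  measurable_fun setT (fun w => empirical_indegree V E t w k).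
Proof.
pose F (K : {fset nat}) w : R := #|` K|%fset%:R^-1 *
  \sum_(n <- K) (indegree V E n t w == k)%:R.
have -> : (fun w => empirical_indegree V E t w k) = (fun w =>
    if `[< vertices_at V t w = set0 >] then (k == 0%N)%:R
    else F (fset_set (vertices_at V t w)) w).
  apply/funext => w; rewrite /empirical_indegree; case: asboolP => [->|/eqP/negPf ->].
    by rewrite eqxx.
  rewrite /F; have [fin|inf] := pselect (finite_set (vertices_at V t w)).
    by rewrite fsbig_finite.
  have -> : fset_set (vertices_at V t w) = fset0.
    by rewrite /fset_set; case: pselect.
  by rewrite cardfs0 invr0 !mul0r.
apply: measurable_fun_ifT => //.
  apply: measurable_fun_of_set.
  rewrite (_ : [set w | _] = \bigcap_n ~` [set w | (V n w).2 <= t]).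
    by apply: bigcapT_measurable => n; exact: measurableC.
  apply/seteqP; split=> w /=.
    by move=> /asboolP h n _ /= nt; have : vertices_at V t w n by []; rewrite h.
  move=> h; apply/asboolP/seteqP; split=> n //= nt; exact: (h n).
apply: (@measurable_fset_set_fun _ _ _ _ (vertices_at V t) F) => K; first exact: mT.
rewrite /F; apply: measurable_funM => //; apply: measurable_sum => n.
have := @measurable_indegree n t k => m.
rewrite (_ : (fun w => _) = \1_[set w | indegree V E n t w = k]).
  exact: measurable_indic.
apply/funext => w; rewrite indicE.
by have -> : (indegree V E n t w == k) = (w \in [set w | indegree V E n t w = k])
  by apply/eqP/idP => [/mem_set|/set_mem].
Qed.

(** The empirical distribution is a function of the finite set of vertices present;
    its weights vanish in the case of an infinite set. *)
Lemma measurable_deviation (t : R) (g : nat -> R) (l eps : R) :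
  (forall k, 0 <= g k) ->
  measurable [set w | (eps%:E < `|pairing (empirical_indegree V E t w) g - l%:E|)%E].
Proof.
move=> g0; rewrite -[X in measurable X]setTI; apply: emeasurable_fun_o_infty => //.
apply: measurableT_comp => //; apply: emeasurable_funB => //.
apply: ge0_emeasurable_sum => k.
  by move=> w _ _; rewrite lee_fin mulr_ge0// empirical_indegree_ge0.
move=> _; apply/measurable_EFinP; apply: measurable_funM => //.
exact: measurable_empirical_indegree.
Qed.

End measurability.

Lemma vertices_at_initial (t : R) w n : (forall n, (V n w).2 < (V n.+1 w).2) ->
  t < (V n w).2 ->
  exists2 nu, (nu <= n)%N & forall i, (V i w).2 <= t <-> (i < nu)%N.
Proof.
move=> V_lt tn.
have mono : {mono (fun i => (V i w).2) : i j / (i <= j)%N >-> i <= j}.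
  exact/Order.NatMonotonyTheory.incnP.
have [nu tnu numin] := ex_minnP (ex_intro (fun i => t < (V i w).2) n tn).
exists nu; first exact: numin.
move=> i; split; last first.
  by move=> inu; rewrite leNgt; apply/negP => /numin; rewrite leqNgt inu.
move=> it; rewrite ltnNge; apply/negP => nui.
have : (V nu w).2 <= (V i w).2 by rewrite mono.
by move=> h; move: (lt_le_trans tnu (le_trans h it)); rewrite ltxx.
Qed.

Lemma pairing_empirical (g : nat -> R) (t : R) w nu : (0 < nu)%N ->
  (forall i, (V i w).2 <= t <-> (i < nu)%N) ->
  pairing (empirical_indegree V E t w) g = (degree_sum E g nu w / nu%:R)%:E.
Proof.
move=> nu0 h; have vE : vertices_at V t w = `I_nu by apply/seteqP; split=> i /= /h.
have indE m : indegree V E m t w = degree E m nu w.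
  apply: card_fset_degree => i /=; split.
    by case=> mi /h inu Em.
  by case=> mi /h inu Em.
have empE k : empirical_indegree V E t w k =
    nu%:R^-1 * \sum_(m < nu) (degree E m nu w == k)%:R.
  rewrite /empirical_indegree ifF.
    rewrite {1}vE (@card_fset_set _ `I_nu nu (card_eqxx _)).
    rewrite vE -(fsbig_ord _ _ (fun n => (indegree V E n t w == k)%:R)).
    by congr (_ * _); apply: eq_bigr => m _; rewrite indE.
  by apply/negbTE/eqP => v0; have : `I_nu 0%N by []; rewrite -vE v0.
apply: pairing_cvg; apply: cvg_near_cst; exists nu.+1 => // n /= nun.
rewrite /degree_sum mulrC mulr_sumr.
transitivity (\sum_(k < n) \sum_(m < nu)
    nu%:R^-1 * ((degree E m nu w == k)%:R * g k)).
  by apply: eq_bigr => k _; rewrite empE -mulrA mulr_suml mulr_sumr.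
rewrite exchange_big/=; apply: eq_bigr => m _; rewrite -mulr_sumr; congr (_ * _).
have dn : (degree E m nu w < n)%N by rewrite (leq_ltn_trans (degree_le _ _ _ _)).
rewrite (bigD1 (Ordinal dn))//= eqxx mul1r big1 ?addr0// => k kd.
case: eqP => [e|_]; last by rewrite mul0r.
by case/eqP: kd; apply: val_inj.
Qed.

End empirical.

(** If a nondecreasing sequence divided by its index is close to l at two indices
    whose ratio is close to 1, then it is so at any index in between. *)
Lemma ratio_close (R : realFieldType) (l eps rho nm nu np Gm G Gp : R) :
  0 <= l -> 0 < eps -> 0 < rho <= 1 -> rho * l <= eps / 4 ->
  0 < nm -> nm <= nu -> nu <= np -> np <= (1 + rho) * nm -> Gm <= G -> G <= Gp ->
  `|Gm - nm * l| <= eps / 4 * nm -> `|Gp - np * l| <= eps / 4 * np ->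
  `|G / nu - l| <= eps.
Proof.
move=> l0 e0 /andP[r0 r1] rl nm0 nmu nup npm GmG GGp.
rewrite !ler_norml => /andP[h1 _] /andP[_ h2].
have nu0 : 0 < nu by lra.
have p1 : np * (l + eps / 4) <= (1 + rho) * nm * (l + eps / 4) by rewrite ler_wpM2r; lra.
have p2 : nm * ((1 + rho) * (l + eps / 4)) <= nu * ((1 + rho) * (l + eps / 4)).
  by rewrite ler_wpM2r// mulr_ge0; lra.
have p3 : (1 + rho) * (l + eps / 4) <= l + eps by nra.
have p4 : nu * ((1 + rho) * (l + eps / 4)) <= nu * (l + eps) by rewrite ler_wpM2l// ltW.
have q : nu * (l - eps) <= nm * (l - eps / 4).
  have [le|le] := leP 0 (l - eps).
    have q1 : nu * (l - eps) <= (1 + rho) * nm * (l - eps) by rewrite ler_wpM2r//; lra.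
    have q2 : nm * ((1 + rho) * (l - eps)) <= nm * (l - eps / 4).
      by rewrite ler_wpM2l ?ltW//; nra.
    lra.
  have q1 : nu * (l - eps) <= nm * (l - eps) by nra.
  have q2 : nm * (l - eps) <= nm * (l - eps / 4) by rewrite ler_wpM2l ?ltW//; lra.
  lra.
apply/andP; split.
  by rewrite lerBrDl ler_pdivlMr//; lra.
by rewrite lerBlDl ler_pdivrMr//; lra.
Qed.

(** * Convergence in probability *)

Section strictly_ordered.
Context d (Omega : measurableType d) (R : realType) (P : probability Omega R).
Context (phi : R -> R) (f : nat -> R).
Context (V : nat -> Omega -> R * R) (E : nat -> nat -> Omega -> bool).
Hypothesis phi_range : forall x : R, 0 <= x -> 0 <= phi x <= 1.
Hypothesis phi_nonincreasing : forall x y : R, 0 <= x -> x <= y -> phi y <= phi x.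
Hypothesis phi_integral :
  (\int[@lebesgue_measure R]_(x in `[0%R, +oo[) (phi x)%:E = (1 / 2)%:E)%E.
Hypothesis f_gt0 : forall k, 0 < f k.
Hypothesis model : is_spatial_pa P phi f V E.
Hypothesis V_lt : forall n w, (V n w).2 < (V n.+1 w).2.
Context (g : nat -> R) (l : R).
Hypothesis g_ge0 : forall k, 0 <= g k.
Hypothesis g_nondecreasing : forall i j, (i <= j)%N -> g i <= g j.
Local Notation W K := (\sum_(k < K.+1) increment g k * limit_tail f k).
Hypothesis W_le : forall K, W K <= l.
Hypothesis W_ge : forall eps, 0 < eps -> exists K, l - eps <= W K.

Local Notation deviation N n := (fun w => \1_(controlled V N n) w *
  `|degree_sum E g n w - n%:R * l|).

Let mV := spa_vertex_measurable model.
Let V_gt0 n w : 0 < (V n w).2. Proof. by have [] := spa_vertex_domain model n w. Qed.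

Lemma bounded_rv_deviation N n : bounded_rv (deviation N n).
Proof.
apply: bounded_rvM; first by apply: bounded_rv_indic; exact: measurable_controlled.
apply: bounded_rv_norm; apply: bounded_rvB; last exact: bounded_rv_cst.
exact: (bounded_rv_degree_sum model).
Qed.

Lemma probability_deviation N (c delta : R) : (0 < N)%N -> 0 < c -> 0 < delta ->
  exists M, forall n, (M <= n)%N ->
  (P [set w | (c * n%:R <= deviation N n w)%R] <= delta%:E)%E.
Proof.
move=> N0 c0 d0; have cd0 : 0 < c * delta by rewrite mulr_gt0.
have [M HM] := mean_abs_vanishing phi_range phi_nonincreasing phi_integral f_gt0
  model V_lt N0 g_ge0 g_nondecreasing W_le W_ge cd0.
exists (maxn M 1) => n; rewrite geq_max => /andP[Mn n1].
have n0 : 0 < n%:R :> R by rewrite ltr0n.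
have cn0 : 0 < c * n%:R by rewrite mulr_gt0.
have dev0 w : 0 <= deviation N n w by rewrite mulr_ge0// indicE.
have key := markov_Ex P (bounded_rv_deviation N n) dev0 cn0.
apply: (le_trans key).
rewrite lee_fin ler_pdivrMr//; apply: (le_trans (HM n Mn)).
by rewrite le_eqVlt; apply/orP; left; apply/eqP; ring.
Qed.

(** The birth times of vertices nm and np bracket t, so the number of vertices at
    time t is between nm and np, and the unnormalised sums are monotone. *)
Lemma degree_sum_sandwich N (t rho eps : R) nm np w :
  0 < eps -> 0 < rho <= 1 -> rho * l <= eps / 4 -> 0 <= l ->
  (0 < N)%N -> (0 < nm)%N -> (N <= nm)%N -> (nm <= np)%N ->
  np%:R <= (1 + rho) * nm%:R ->
  t < np%:R / (1 + 69 / root4 R np) -> nm%:R * (1 + 240 / root4 R nm) <= t ->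
  controlled V N np w ->
  `|degree_sum E g nm w - nm%:R * l| <= eps / 4 * nm%:R ->
  `|degree_sum E g np w - np%:R * l| <= eps / 4 * np%:R ->
  (`|pairing (empirical_indegree V E t w) g - l%:E| <= eps%:E)%E.
Proof.
move=> e0 r01 rl l0 N0 nm0 Nnm nmp npr tnp tnm Bw hm hp.
have /andP[lo _] : np%:R / (1 + 69 / root4 R np) <= (V np w).2 <=
    np%:R * (1 + 240 / root4 R np) by apply: Bw; rewrite leqnn (leq_trans Nnm).
have /andP[_ hi] : nm%:R / (1 + 69 / root4 R nm) <= (V nm w).2 <=
    nm%:R * (1 + 240 / root4 R nm) by apply: Bw; rewrite Nnm.
have [nu nup h] := vertices_at_initial (V_lt^~ w) (lt_le_trans tnp lo).
have nmu : (nm < nu)%N by apply/h; exact: le_trans tnm.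
have nu0 : (0 < nu)%N by exact: leq_ltn_trans nmu.
rewrite (pairing_empirical E g nu0 h) -EFinB lee_fin.
apply: (@ratio_close R l eps rho nm%:R nu%:R np%:R (degree_sum E g nm w) _
  (degree_sum E g np w)) => //.
- by rewrite ltr0n.
- by rewrite ler_nat ltnW.
- by rewrite ler_nat.
- by apply: degree_sum_mono => //; exact: ltnW.
- exact: degree_sum_mono.
Qed.

(** The exceptional event does not depend on the graph at time t itself but only on
    the two deterministic indices t * (1 - 2 * theta) and t * (1 + 2 * theta). *)
Lemma deviation_event (eps delta : R) : 0 <= l -> 0 < eps -> 0 < delta ->
  exists t0 : R, forall t, t0 <= t -> exists2 C, measurable C /\ (P C <= delta%:E)%E &
    forall w, ~ C w -> (`|pairing (empirical_indegree V E t w) g - l%:E| <= eps%:E)%E.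
Proof.
move=> l0 e0 d0; have d30 : 0 < delta / 3 by rewrite divr_gt0.
have [N N0 HN] := probability_controlled mV (spa_poisson model) V_gt0 V_lt d30.
have e40 : 0 < eps / 4 by rewrite divr_gt0.
have [M HM] := probability_deviation N0 e40 d30.
pose rho := Num.min 1 (eps / (4 * (l + 1))).
have l1 : 0 < l + 1 by rewrite ltr_wpDl.
have r0 : 0 < rho by rewrite lt_min ltr01 divr_gt0// mulr_gt0.
have r1 : rho <= 1 by rewrite ge_min lexx.
have rl : rho * l <= eps / 4.
  have : rho <= eps / (4 * (l + 1)) by rewrite ge_min lexx orbT.
  rewrite ler_pdivlMr ?mulr_gt0// => h.
  have : rho * l <= rho * (l + 1) by rewrite ler_wpM2l ?lerDl// ltW.
  lra.
(* The ratio (1 + 3 * theta) / (1 - 3 * theta) of the two indices is at most 1 + rho. *)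
pose theta := rho / 12; have th0 : 0 < theta by rewrite divr_gt0.
have th1 : theta <= 1 / 12 by rewrite ler_pM2r.
have rth : rho = 12 * theta by rewrite /theta; field.
have [M1 H1] := @div_root4_vanishing R 69 _ (ltW (ltr0Sn _ _)) th0.
have [M2 H2] := @div_root4_vanishing R 240 _ (ltW (ltr0Sn _ _)) th0.
pose Q := maxn N (maxn M (maxn M1 M2)).
exists (2 * (Q%:R + 2) + theta^-1) => t tQ.
have ti0 : 0 < theta^-1 by rewrite invr_gt0.
have Q0 : 0 <= Q%:R :> R by [].
have t1 : 1 <= theta * t by rewrite -ler_pdivrMl// mulr1; lra.
have t0 : 0 < t by lra.
have tm0 : 0 <= t * (1 - 2 * theta) by rewrite mulr_ge0//; lra.
have tp0 : 0 <= t * (1 + 2 * theta) by rewrite mulr_ge0//; lra.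
pose nm := Num.truncn (t * (1 - 2 * theta)).
pose np := (Num.truncn (t * (1 + 2 * theta))).+1.
have /andP[nm1 nm2] := truncn_itv tm0.
have /andP[np1 np2] := truncn_itv tp0.
rewrite -/nm -[nm.+1%:R]natr1 in nm1 nm2.
rewrite -/np in np2.
have np3 : np%:R <= t * (1 + 2 * theta) + 1 by rewrite /np -[_.+1%:R]natr1 lerD2r.
have tth : t * theta <= t * (1 / 12) by rewrite ler_pM2l.
have Qnm : (Q < nm)%N.
  rewrite -(ltr_nat R); have : Q%:R + 1 <= t * (1 - 2 * theta) - 1 by lra.
  lra.
move: (Qnm); rewrite /Q !gtn_max => /and4P[Nnm Mnm M1nm M2nm].
have nmp : (nm <= np)%N.
  rewrite -(ler_nat R); have : t * (1 - 2 * theta) <= t * (1 + 2 * theta).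
    by rewrite ler_pM2l//; lra.
  lra.
pose B n := controlled V N n.
pose F n := [set w | eps / 4 * n%:R <= deviation N n w].
have mB n : measurable (B n) by exact: measurable_controlled.
have mF n : measurable (F n).
  by apply: measurable_ler_set => //; exact: (bounded_rv_deviation N n).1.
exists (~` B np `|` (F nm `|` F np)).
  split; first by apply: measurableU; [exact: measurableC|exact: measurableU].
  apply: (le_trans (measureU2 _ (measurableC (mB _)) (measurableU _ _ (mF _) (mF _)))).
  have -> : delta = delta / 3 + (delta / 3 + delta / 3) by field.
  rewrite 2!EFinD leeD//; first exact: HN.
  apply: (le_trans (measureU2 _ (mF _) (mF _))); rewrite leeD//; apply: HM.
    exact: ltnW.
  by rewrite (leq_trans (ltnW Mnm)).
move=> w; rewrite /setU/= => nC.
have Bw : B np w by apply: contrapT => h; apply: nC; left.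
have Bm : B nm w by exact: controlled_nonincreasing Bw.
have FC n : B n w -> ~ F n w -> `|degree_sum E g n w - n%:R * l| <= eps / 4 * n%:R.
  by move=> Bn /negP; rewrite /F/= -ltNge indicE mem_set// mul1r => /ltW.
apply: (@degree_sum_sandwich N t rho eps nm np w) => //.
- by rewrite r0.
- exact: leq_ltn_trans Nnm.
- exact: ltnW.
- apply: (le_trans np3); apply: (@le_trans _ _ ((1 + rho) * (t * (1 - 2 * theta) - 1))).
    rewrite rth; have : theta * (theta * t) <= theta * t / 12.
      by rewrite mulrC ler_pM2l; lra.
    nra.
  by rewrite ler_pM2l; lra.
- have h := H1 np (leq_trans (ltnW M1nm) nmp).
  have r40 : 0 <= 69 / root4 R np by rewrite divr_ge0 ?sqrtr_ge0.
  rewrite ltr_pdivlMr; last lra.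
  apply: le_lt_trans np2; rewrite ler_pM2l//; lra.
- have h := H2 nm (ltnW M2nm).
  apply: (@le_trans _ _ (t * (1 - 2 * theta) * (1 + theta))).
    apply: ler_pM => //; last by lra.
    have r40 : 0 <= 240 / root4 R nm by rewrite divr_ge0 ?sqrtr_ge0.
    lra.
  by rewrite -mulrA ler_piMr ?ltW//; nra.
- by apply: FC => // Fw; apply: nC; right; left.
- by apply: FC => // Fw; apply: nC; right; right.
Qed.

End strictly_ordered.

Section limit_mean.
Context (R : realType) (f : nat -> R) (g : nat -> R) (gamma : R).
Hypothesis f_gt0 : forall k, 0 < f k.
Hypothesis f_slope : f k / k%:R @[k --> \oo] --> gamma.
Hypothesis gamma_lt1 : gamma < 1.
Hypothesis g_ge0 : forall k, 0 <= g k.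
Hypothesis g_moment : exists p : R, 1 < p /\
  (pairing (limit_indegree f) (fun k => g k `^ p)%R < +oo)%E.

(** A slope less than 1 gives f l <= l eventually. *)
Lemma limit_tail_vanishes : limit_tail f n @[n --> \oo] --> (0 : R).
Proof.
have [L _ HL] : \forall k \near \oo, f k / k%:R <= 1.
  have : \forall k \near \oo, f k / k%:R < 1 by exact: cvgr_lt f_slope _ gamma_lt1.
  by apply: filterS => k /ltW.
apply: (@limit_tail_cvg0 _ _ f_gt0 L.+1) => // k Lk.
have k0 : 0 < k%:R :> R by rewrite ltr0n (leq_trans _ Lk).
by have := HL k (ltnW Lk); rewrite /= ler_pdivrMr// mul1r.
Qed.

Lemma limit_indegree_ge0 k : 0 <= limit_indegree f k.
Proof. by rewrite limit_indegreeE// subr_ge0 limit_tail_nonincreasing. Qed.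

(** Since g <= 1 + g^p, the moment condition makes the series converge. *)
Lemma limit_mean_exists : exists2 l : R, 0 <= l &
  \sum_(k < n) limit_indegree f k * g k @[n --> \oo] --> l.
Proof.
have [p [p1 hp]] := g_moment.
have t0 k : 0 <= limit_indegree f k * g k by rewrite mulr_ge0// limit_indegree_ge0.
have [M HM] : exists M : R, forall n,
    \sum_(k < n) limit_indegree f k * g k `^ p <= M.
  apply: partial_sum_le_pairing hp => k.
  by rewrite mulr_ge0 ?powR_ge0// limit_indegree_ge0.
pose u n := \sum_(k < n) limit_indegree f k * g k.
have u_nd : nondecreasing_seq u.
  by apply/nondecreasing_seqP => n; rewrite /u big_ord_recr/= lerDl.
have u_le n : u n <= 1 + M.
  have mass : \sum_(k < n) limit_indegree f k <= 1.
    rewrite (eq_bigr (fun k : 'I_n => - (limit_tail f k.+1 - limit_tail f k))).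
      rewrite sumrN -(big_mkord xpredT (fun k => limit_tail f k.+1 - limit_tail f k)).
      rewrite telescope_sumr// limit_tail0 opprB gerBl.
      exact/ltW/limit_tail_gt0.
    by move=> k _; rewrite limit_indegreeE// opprB.
  apply: le_trans (lerD mass (HM n)); rewrite -big_split/=.
  apply: ler_sum => k _; rewrite -[X in _ <= X + _]mulr1 -mulrDr.
  rewrite ler_wpM2l ?limit_indegree_ge0//.
  have [g1|g1] := leP (g k) 1; first by rewrite (le_trans g1)// lerDl powR_ge0.
  apply: (@le_trans _ _ (g k `^ p)); last by rewrite lerDr.
  by rewrite -[leLHS]powRr1// ler_powR// ltW.
have u_cvg : cvgn u.
  by apply: nondecreasing_is_cvgn => //; exists (1 + M) => _ [n _ <-].
exists (limn u); last exact: u_cvg.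
by apply: (le_trans _ (nondecreasing_cvgn_le u_nd u_cvg 0%N)); rewrite /u big_ord0.
Qed.

End limit_mean.

Theorem theorem1 (R : realType) (d : measure_display) (Omega : measurableType d)
    (P : probability Omega R)
    (phi : R -> R) (f : nat -> R) (gamma : R)
    (phi_range : forall x : R, 0 <= x -> 0 <= phi x <= 1)
    (phi_nonincreasing : forall x y : R, 0 <= x -> x <= y -> phi y <= phi x)
    (phi_integral :
       (\int[lebesgue_measure]_(x in `[0%R, +oo[) (phi x)%:E = (1 / 2)%:E)%E)
    (f_gt0 : forall k, 0 < f k)
    (f_nondecreasing : forall k l, (k <= l)%N -> f k <= f l)
    (f_slope : f k / k%:R @[k --> \oo] --> gamma)
    (gamma_range : 0 < gamma < 1)
    (V : nat -> Omega -> R * R) (E : nat -> nat -> Omega -> bool)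
    (model : is_spatial_pa P phi f V E)
    (g : nat -> R)
    (g_ge0 : forall k, 0 <= g k)
    (g_nondecreasing : forall k l, (k <= l)%N -> g k <= g l)
    (g_moment : exists p : R, 1 < p /\
       (pairing (limit_indegree f) (fun k => g k `^ p)%R < +oo)%E) :
  cvg_in_probability P
    (fun t w => pairing (empirical_indegree V E t w) g)
    (pairing (limit_indegree f) g).
Proof.
have /andP[_ gamma1] := gamma_range.
have [l l0 hl] := limit_mean_exists f_gt0 g_ge0 g_moment.
rewrite (pairing_cvg hl).
have s0 := limit_tail_vanishes f_gt0 f_slope gamma1.
have hl' : \sum_(k < n) (limit_tail f k - limit_tail f k.+1) * g k @[n --> \oo] --> l.
  move: hl; under eq_fun do under eq_bigr do rewrite limit_indegreeE//.
  by [].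
have sge0 k : 0 <= limit_tail f k by exact/ltW/limit_tail_gt0.
have W_le := weighted_tail_le (limit_tail_nonincreasing f_gt0) s0 g_ge0
  g_nondecreasing hl'.
have W_ge := weighted_tail_ge sge0 g_ge0 hl'.
have model' := reorder_spatial_pa phi_range phi_nonincreasing f_gt0 model.
have mV := spa_vertex_measurable model.
have mE := spa_edge_measurable model.
move=> eps e0.
pose X t := [set w | (eps%:E < `|pairing (empirical_indegree V E t w) g - l%:E|)%E].
suff : P (X t) @[t --> +oo] --> 0%E by [].
have mX t : measurable (X t) by exact: measurable_deviation.
have small delta : 0 < delta -> exists t0 : R, forall t, t0 <= t ->
    (P (X t) <= delta%:E)%E.
  move=> d0; have [t0 H] := deviation_event phi_range phi_nonincreasing phi_integral
    f_gt0 model' (@reorder_birth_lt _ _ _ V) g_ge0 g_nondecreasing W_le W_ge l0 e0 d0.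
  exists t0 => t /H[C [mC PC] HC].
  have mD : measurable (~` well_ordered V).
    by apply: measurableC; exact: measurable_well_ordered.
  have sub : X t `<=` C `|` ~` well_ordered V.
    move=> w Xw; have [Dw|] := pselect (well_ordered V w); last by right.
    left; apply: contrapT => /HC; apply/negP; rewrite -ltNge.
    have eV : empirical_indegree (reorder V) E t w = empirical_indegree V E t w.
      have rV n : reorder V n w = V n w by exact: reorder_id.
      have vE : vertices_at (reorder V) t w = vertices_at V t w.
        by apply/seteqP; split=> i; rewrite /vertices_at/= rV.
      have iE n : indegree (reorder V) E n t w = indegree V E n t w.
        rewrite /indegree; congr (#|` fset_set _|%fset).
        by apply/seteqP; split=> i; rewrite /= rV.
      apply/funext => k; rewrite /empirical_indegree vE.
      by under eq_fsbigr do rewrite iE.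
    by rewrite eV.
  apply: (le_trans (le_measure P _ _ sub)); rewrite ?inE//; first exact: measurableU.
  apply: (le_trans (measureU2 _ mC mD)).
  have D0 : P (~` well_ordered V) = 0%E by exact: well_ordered_as model.
  have key : (P C + P (~` well_ordered V) <= delta%:E)%E by rewrite D0 adde0.
  exact: key.
have PE : (fun t => P (X t)) = EFin \o (fun t => fine (P (X t))).
  by apply/funext => t /=; rewrite fineK// fin_num_measure.
rewrite PE; apply: cvg_EFin; first by near=> t.
apply/cvgrPdist_le => delta d0; have [t0 H] := small delta d0.
near=> t.
have t0t : t0 <= t by near: t; apply: nbhs_pinfty_ge; rewrite num_real.
have fin : P (X t) \is a fin_num by exact: fin_num_measure.
have f0 : 0 <= fine (P (X t)) by apply: fine_ge0; exact: measure_ge0.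
have h := H t t0t; rewrite -(fineK fin) lee_fin in h.
by rewrite sub0r normrN /= ger0_norm.
Unshelve. all: by end_near. Qed.
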